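(* Let $(\theta_n)$ be a nonincreasing null sequence in $(0,1)$, let $0<\xi<\omega_1$, and let $(\beta_n)$ be countable ordinals with $0<\beta_n<\omega^\xi$ for all $n$ and $\sup_n\beta_n=\omega^\xi$. Let $(e_n)$ be the unit vector basis of $X=T[(\theta_n,\mathcal{S}_{\beta_n})_{n=1}^\infty]$. If condition $(\dagger)$ holds, then for every infinite $M\subseteq\mathbb{N}$ the closed span $[(e_n)_{n\in M}]$ contains an $\ell^1$-$\mathcal{S}_{\omega^\xi}$-spreading model. If $(\dagger)$ fails, then for every infinite $M\subseteq\mathbb{N}$ there exists an infinite $N\subseteq M$ such that $[(e_k)_{k\in N}]$ does not contain any $\ell^1$-$\mathcal{S}_{\omega^\xi}$-spreading model.
   Context: Schreier families: $\mathcal{S}_0=\{\{n\}\}\cup\{\emptyset\}$, $\mathcal{S}_1=\{F\subseteq\mathbb{N}:|F|\le\min F\}$, $\mathcal{S}_{\beta+1}=\mathcal{S}_1[\mathcal{S}_\beta]$, and for limit $\beta$, $\mathcal{S}_\beta=\{F: F\in\mathcal{S}_{\beta_k'}\text{ for some }k\le\min F\}$ for a fixed sequence $\beta'_k$ strictly increasing to $\beta$. Here $E_1<\dots<E_k$ means $\max E_i<\min E_{i+1}$; such a sequence is $\mathcal{F}$-admissible if $\{\min E_i\}\in\mathcal{F}$, and $\mathcal{M}[\mathcal{N}]$ is the set of unions of $\mathcal{M}$-admissible sequences of members of $\mathcal{N}$. $T[(\theta_n,\mathcal{F}_n)_{n=1}^\infty]$ is the completion of $c_{00}$ under $\|x\|=\max\{\|x\|_{c_0},\sup_n\sup\theta_n\sum_i\|E_ix\|\}$,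 inner sup over $\mathcal{F}_n$-admissible $(E_i)$, $Ex$ the restriction of $x$ to $E$. In this setting $\gamma(\varepsilon,m)=\max\{\beta_{n_s}+\dots+\beta_{n_1}:\varepsilon\theta_{n_s}\cdots\theta_{n_1}>\theta_m\}$ ($\max\emptyset=0$), and condition $(\dagger)$ is: there exists $\varepsilon>0$ such that for every ordinal $\beta<\omega^\xi$ there is $m\in\mathbb{N}$ with $\gamma(\varepsilon,m)+2+\beta<\beta_m$. A normalized sequence $(x_n)$ is an $\ell^1$-$\mathcal{F}$-spreading model if for some $K$, $\|\sum_{n\in F}a_nx_n\|\ge K^{-1}\sum_{n\in F}|a_n|$ for all $F\in\mathcal{F}$ and all scalars. *)

(* Defs.v *)
From HB Require Import structures.
From mathcomp Require Import all_boot all_order all_algebra.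
From mathcomp Require Import all_classical all_reals all_analysis.
Set Implicit Arguments. Unset Strict Implicit. Unset Printing Implicit Defensive.
Import Order.TTheory GRing.Theory Num.Theory numFieldNormedType.Exports.
Local Open Scope classical_set_scope.
Local Open Scope ring_scope.

(* Countable ordinals as Brouwer trees.  [Lim f] denotes sup_k f k.    *)
(* Every countable ordinal is the value of such a tree.  A tree is     *)
(* well-formed ([owf]) when every [Lim f] in it has f strictly         *)
(* increasing; then [Lim f] is a limit ordinal and f is the fixed     *)
(* sequence strictly increasing to it used by the Schreier families.  *)
Inductive ord : Type :=
| OZero : ord
| OSucc : ord -> ord
| OLim  : (nat -> ord) -> ord.

Inductive ole : ord -> ord -> Prop :=
| ole_zero b : ole OZero b
| ole_succ a b : ole a b -> ole (OSucc a) (OSucc b)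
| ole_limr a (f : nat -> ord) k : ole a (f k) -> ole a (OLim f)
| ole_liml (f : nat -> ord) b : (forall k, ole (f k) b) -> ole (OLim f) b.

Definition olt (a b : ord) : Prop := ole (OSucc a) b.

Fixpoint owf (a : ord) : Prop :=
  match a with
  | OZero => True
  | OSucc b => owf b
  | OLim f => (forall k, owf (f k)) /\ (forall k, olt (f k) (f k.+1))
  end.

Definition is_sup_pos (b : nat -> ord) (a : ord) : Prop :=
  (forall n, (0 < n)%N -> ole (b n) a) /\
  (forall c, (forall n, (0 < n)%N -> ole (b n) c) -> ole a c).

Fixpoint oadd (a b : ord) : ord :=
  match b with
  | OZero => a
  | OSucc c => OSucc (oadd a c)
  | OLim f => OLim (fun k => oadd a (f k))
  end.

Fixpoint omul (a b : ord) : ord :=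
  match b with
  | OZero => OZero
  | OSucc c => oadd (omul a c) a
  | OLim f => OLim (fun k => omul a (f k))
  end.

Fixpoint ofin (n : nat) : ord :=
  match n with 0 => OZero | n'.+1 => OSucc (ofin n') end.

Fixpoint opw (xi : ord) : ord :=
  match xi with
  | OZero => OSucc OZero
  | OSucc c => OLim (fun k => omul (opw c) (ofin k))
  | OLim f => OLim (fun k => opw (f k))
  end.

(* Finite subsets of N = {1,2,...} are strictly increasing lists.      *)
Definition fset_pos (F : seq nat) : bool :=
  sorted ltn F && all (fun n => 0 < n)%N F.

Definition fmin (F : seq nat) : nat := head 0%N F.
Definition fmax (F : seq nat) : nat := last 0%N F.

Definition successive (Es : seq (seq nat)) : Prop :=
  all (fun E => (E != [::]) && fset_pos E) Es /\
  sorted (fun E G => fmax E < fmin G)%N Es.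

Definition admissible (P : seq nat -> Prop) (Es : seq (seq nat)) : Prop :=
  successive Es /\ P (map fmin Es).

Definition schreier1 (F : seq nat) : Prop := (size F <= fmin F)%N.

Fixpoint inS (b : ord) (F : seq nat) {struct b} : Prop :=
  match b with
  | OZero => (size F <= 1)%N
  | OSucc c => exists Es : seq (seq nat),
      F = flatten Es /\ admissible schreier1 Es /\
      (forall E, E \in Es -> inS c E)
  | OLim f => F = [::] \/
      exists k, (0 < k)%N /\ (k <= fmin F)%N /\ inS (f k) F
  end.

Section Tnorm.
Variable R : realType.

Definition c00 (x : nat -> R) : Prop :=
  exists b : nat, forall i, (i == 0)%N || (b < i)%N -> x i = 0.

Definition restr (E : seq nat) (x : nat -> R) : nat -> R :=
  fun i => if i \in E then x i else 0.

Definition supnorm (x : nat -> R) : R := sup [set `|x i| | i in [set: nat]].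

Variables (theta : nat -> R) (beta : nat -> ord).

(* k-th iterate of the implicit equation *)
Fixpoint tnorm_it (k : nat) (x : nat -> R) : R :=
  match k with
  | 0 => supnorm x
  | k'.+1 => Num.max (supnorm x)
      (sup [set r | exists (n : nat) (Es : seq (seq nat)),
               (0 < n)%N /\ admissible (inS (beta n)) Es /\
               r = theta n * \sum_(E <- Es) tnorm_it k' (restr E x)])
  end.

Definition tnorm (x : nat -> R) : R := sup (range (fun k => tnorm_it k x)).

(* Elements of the completion X: Cauchy sequences of c_00 vectors *)
Definition Xelt (u : nat -> nat -> R) : Prop :=
  (forall k, c00 (u k)) /\
  (forall e : R, 0 < e -> exists K : nat, forall k l, (K <= k)%N -> (K <= l)%N ->
      tnorm (fun i => u k i - u l i) < e).

Definition Xnorm (u : nat -> nat -> R) : R := limn (fun k => tnorm (u k)).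

(* u represents an element of the closed span [(e_n)_{n in M}] *)
Definition in_span (M : set nat) (u : nat -> nat -> R) : Prop :=
  forall k i, u k i != 0 -> M i.

Definition l1_spreading_model (w : ord) (x : nat -> nat -> nat -> R) : Prop :=
  (forall n, (0 < n)%N -> Xnorm (x n) = 1) /\
  exists K : R, 0 < K /\
    forall (F : seq nat) (a : nat -> R), fset_pos F -> inS w F ->
      K^-1 * \sum_(n <- F) `|a n| <=
      Xnorm (fun k i => \sum_(n <- F) a n * x n k i).

Definition contains_l1_SM (w : ord) (M : set nat) : Prop :=
  exists x : nat -> nat -> nat -> R,
    (forall n, (0 < n)%N -> Xelt (x n) /\ in_span M (x n)) /\
    l1_spreading_model w x.

(* beta_{n_s} + ... + beta_{n_1} for s = [:: n_1; ...; n_s] *)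
Definition osum (s : seq nat) : ord :=
  foldl (fun acc n => oadd (beta n) acc) OZero s.

Definition gamma_set (eps : R) (m : nat) : set (seq nat) :=
  [set s | s != [::] /\ all (fun n => 0 < n)%N s /\
           theta m < eps * \prod_(n <- s) theta n].

Definition is_gamma (eps : R) (m : nat) (g : ord) : Prop :=
  (gamma_set eps m = set0 /\ g = OZero) \/
  ((exists s, gamma_set eps m s /\ g = osum s) /\
   (forall s, gamma_set eps m s -> ole (osum s) g)).

Definition dagger (xi : ord) : Prop :=
  exists eps : R, 0 < eps /\
    forall b : ord, olt b (opw xi) ->
      exists m : nat, (0 < m)%N /\
        exists g, is_gamma eps m g /\
          olt (oadd (oadd g (ofin 2)) b) (beta m).

End Tnorm.

(* Main.v *)
(** Both halves compare S_{beta_m}-admissible splittings, of weight theta_m, with the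
    splittings obtained along branches n_1, ..., n_s of a norming tree, of weight
    theta_{n_1} ... theta_{n_s} and complexity beta_{n_s} + ... + beta_{n_1}.

    If the dagger condition fails, then for each eps there is sigma < omega^xi such that,
    on a sparse set, every S_{beta_m}-admissible family with theta_m small is an
    S_sigma-admissible family of groups, each of which is split along a branch of weight
    greater than theta_m / eps.  Hence |v| <= max(eps, theta_1^r) sup_E sum |E v| up to small
    terms, the supremum being over S_{sigma r}-admissible E.  For an average v of a
    normalized block sequence whose weights are small on S_{sigma r}, such an E splits few
    blocks, so that the supremum is bounded and |v| is small: a lower l^1 estimate on
    S_{omega^xi} is impossible.

    If the condition holds for eps, choose levels l_0, l_1, ... such that beta_{l_j} exceeds
    gamma(eps, l_j) + 2 by more than all the ordinals used at earlier levels.  The vectors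
    of the spreading model are nested: theta_{l_0}^-1 times an average of e_i, interleaved
    with the same average of vectors y_i, where y_i is placed right after e_i and built in
    the same way from the levels l_1, l_2, ....  The nodes of a norming tree whose
    coefficient exceeds theta_{l_0} / eps form sets on which the average is negligible, so
    almost every pair e_i + y_i lies below one node; there the tree can exploit either e_i
    or y_i but not both, and the norms stay bounded.  On the other hand, for each j <= n the
    n-th vector has a part of l^1 norm theta_{l_j}^-1 supported in a Schreier set so small
    that S_{w_j}-many of these supports form a set in S_{beta_{l_j}}. *)

Require Import Defs.
From HB Require Import structures.
From mathcomp Require Import all_boot all_order all_algebra.
From mathcomp Require Import all_classical all_reals all_analysis.
From mathcomp Require Import lra ring.
Import Order.TTheory GRing.Theory Num.Theory numFieldNormedType.Exports.
Set Implicit Arguments. Unset Strict Implicit. Unset Printing Implicit Defensive.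
Local Open Scope classical_set_scope.
Local Open Scope ring_scope.

(** * Ordinals *)

(** The Schreier family of an ordinal depends on the tree chosen for it, and a smaller ordinal need
    not give a smaller family. One relation is exact: limits in [oadd a b] are taken along the tree
    of [b], so the family of [oadd a b] is the product of the families of [b] (outer) and [a]
    (inner), and complexities along a branch can be added as trees. Every other comparison is
    between strictly ordered trees and holds only on a thinner infinite set. Countably many of them
    are met by diagonalization, at the price that each inclusion holds only beyond some point. When
    the condition fails, the lost initial segment is paid for by weights 2^-p; when it holds, by
    starting the vectors far enough out. Only finitely many inclusions are needed at each stage
    because [theta] tends to 0; in particular only finitely many label words have weight above a
    given positive number. The vectors of a hypothetical spreading model need not be blocks or
    finitely supported; they are replaced by differences of two approximants that nearly agree on an
    initial segment. *)

Lemma ole_refl a : ole a a.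
Proof.
elim: a => [|a IH|f IH]; [exact: ole_zero|exact: ole_succ|].
by apply: ole_liml => k; apply: (@ole_limr _ _ k).
Qed.

Lemma ole_lim_inv f b : ole (OLim f) b -> forall k, ole (f k) b.
Proof.
move E : (OLim f) => a ab; elim: ab E => [| |a' g j _ IH E k|g c H _ [->] //] //.
by apply: ole_limr; exact: IH.
Qed.

Lemma ole_succ_inv a b : ole (OSucc a) (OSucc b) -> ole a b.
Proof. by move=> H; inversion H. Qed.

Lemma ole_succ_lim_inv a f : ole (OSucc a) (OLim f) -> exists k, ole (OSucc a) (f k).
Proof. by move=> H; inversion H; subst; exists k. Qed.

Lemma ole_trans b a c : ole a b -> ole b c -> ole a c.
Proof.
move=> ab; elim: ab c => [*|{}a {}b _ IH c|{}a f k _ IH c /ole_lim_inv/(_ k)|f {}b _ IH c bc].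
- exact: ole_zero.
- elim: c => [H|c _ /ole_succ_inv/IH|g IHg /ole_succ_lim_inv [k /IHg]].
  + by inversion H.
  + exact: ole_succ.
  + exact: ole_limr.
- exact: IH.
- by apply: ole_liml => k; exact: IH.
Qed.

Lemma ole_lim f k : ole (f k) (OLim f).
Proof. by apply: (@ole_limr _ _ k); exact: ole_refl. Qed.

Lemma oleS a : ole a (OSucc a).
Proof.
elim: a => [|a IH|f IH]; [exact: ole_zero|exact: ole_succ|].
by apply: ole_liml => k; apply: ole_trans (IH k) _; apply/ole_succ/ole_lim.
Qed.

Lemma oltW {a b} : olt a b -> ole a b.
Proof. by move=> ab; apply: ole_trans ab; exact: oleS. Qed.

Lemma olt_ole_trans b a c : olt a b -> ole b c -> olt a c.
Proof. exact: ole_trans. Qed.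

Lemma ole_olt_trans b a c : ole a b -> olt b c -> olt a c.
Proof. by move=> ab; apply: ole_trans; exact: ole_succ. Qed.

Lemma oltS a b : olt a (OSucc b) <-> ole a b.
Proof. by split; [exact: ole_succ_inv|exact: ole_succ]. Qed.

Lemma olt_irr a : ~ olt a a.
Proof.
elim: a => [H|a IH /ole_succ_inv //|f IH /ole_succ_lim_inv [k H]].
  by inversion H.
by apply: (IH k); apply: ole_olt_trans H; exact: ole_lim.
Qed.

Lemma ole_total a b : ole a b \/ olt b a.
Proof.
elim: a b => [b|a IH b|f IH b]; first by left; exact: ole_zero.
- elim: b => [|b _|g IHg]; first by right; apply/ole_succ/ole_zero.
  + by case: (IH b) => H; [left|right]; exact: ole_succ.
  + have [[k Hk]|/forallNP H] := pselect (exists k, ole (OSucc a) (g k)).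
      by left; exact: (@ole_limr _ _ k).
    right; apply/ole_succ/ole_liml => k; apply: ole_succ_inv.
    by case: (IHg k) => // /H.
- have [H|/existsNP [k Hk]] := pselect (forall k, ole (f k) b).
    by left; exact: ole_liml.
  by right; apply: (@ole_limr _ _ k); case: (IH k b).
Qed.

Lemma oleNgt a b : ~ olt b a -> ole a b.
Proof. by case: (ole_total a b). Qed.

(** Like [oaddA], an equality of trees and not only of values, so it can be rewritten inside [inS],
    which sees the tree. *)
Lemma oadd0l a : oadd OZero a = a.
Proof. by elim: a => //= [a ->|f IH] //; congr OLim; apply: funext. Qed.

Lemma oaddA a b c : oadd a (oadd b c) = oadd (oadd a b) c.
Proof. by elim: c => //= [c ->|f IH] //; congr OLim; apply: funext. Qed.

Lemma ole_addr a b : ole a (oadd a b).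
Proof.
elim: b => /= [|b IH|f IH]; first exact: ole_refl.
  by apply: ole_trans IH _; exact: oleS.
exact: (@ole_limr _ _ 0 (IH 0)).
Qed.

Lemma ole_addl a b : ole b (oadd a b).
Proof.
elim: b => /= [|b IH|f IH]; [exact: ole_zero|exact: ole_succ|].
by apply: ole_liml => k; apply: (@ole_limr _ _ k).
Qed.

Lemma ole_add2l a b c : ole b c -> ole (oadd a b) (oadd a c).
Proof.
elim=> /= [d|d e _ IH|d f k _ IH|f d _ IH].
- exact: ole_addr.
- exact: ole_succ.
- exact: (@ole_limr _ _ k).
- exact: ole_liml.
Qed.

Lemma ole_add2r a b c : ole a b -> ole (oadd a c) (oadd b c).
Proof.
move=> ab; elim: c => //= [c|f IH]; first exact: ole_succ.
by apply: ole_liml => k; apply: (@ole_limr _ _ k).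
Qed.

Lemma olt_add2l a b c : olt b c -> olt (oadd a b) (oadd a c).
Proof. exact: (@ole_add2l a (OSucc b)). Qed.

Lemma owf_add a b : owf a -> owf b -> owf (oadd a b).
Proof.
move=> wa; elim: b => //= f IH [wf sf]; split=> k; first exact: IH.
exact: olt_add2l.
Qed.

Lemma owf_ofin n : owf (ofin n).
Proof. by elim: n. Qed.

Lemma owf_muln a n : owf a -> owf (omul a (ofin n)).
Proof. by move=> wa; elim: n => //= n IH; exact: owf_add. Qed.

Lemma omulnD a m n : omul a (ofin (m + n)) = oadd (omul a (ofin m)) (omul a (ofin n)).
Proof.
elim: n => [|n IH]; first by rewrite addn0.
by rewrite addnS /= IH oaddA.
Qed.

(** Additive indecomposability of powers of omega. At a successor exponent both summands lie below
    finite multiples, whose sum is again a finite multiple; at a limit exponent both lie below the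
    larger of two earlier powers. *)
Lemma opw_add xi a b : olt a (opw xi) -> olt b (opw xi) -> olt (oadd a b) (opw xi).
Proof.
elim: xi a b => [a b /ole_succ_inv a0 /ole_succ_inv b0|xi _ a b|f IH a b] /=.
- apply: ole_succ; apply: ole_trans (ole_add2l a b0) _.
  exact: a0.
- move=> /ole_succ_lim_inv [m am] /ole_succ_lim_inv [n bn].
  apply: (@ole_limr _ _ (m + n)%N); rewrite omulnD.
  apply: ole_olt_trans (ole_add2r _ (oltW am)) _.
  exact: olt_add2l.
- move=> /ole_succ_lim_inv [m am] /ole_succ_lim_inv [n bn].
  have [mn|/oltW nm] := ole_total (opw (f m)) (opw (f n)).
    by apply: (@ole_limr _ _ n); apply: IH => //; exact: olt_ole_trans mn.
  by apply: (@ole_limr _ _ m); apply: IH => //; exact: olt_ole_trans nm.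
Qed.

Lemma opw_ge1 xi : ole (OSucc OZero) (opw xi).
Proof.
elim: xi => [|xi IH|f IH] /=; first exact: ole_refl.
  by apply: (@ole_limr _ _ 1%N); rewrite /= oadd0l.
exact: (@ole_limr _ _ 0%N).
Qed.

Lemma opw_gt1 xi : olt OZero xi -> olt (OSucc OZero) (opw xi).
Proof.
elim: xi => [H|xi _ _|f IH /ole_succ_lim_inv [k fk]] /=; first by inversion H.
  apply: (@ole_limr _ _ 2%N); rewrite /= oadd0l.
  apply: ole_trans (ole_add2l _ (opw_ge1 xi)); apply: ole_succ; exact: opw_ge1.
exact: (@ole_limr _ _ k (IH k fk)).
Qed.

Lemma opw_succ xi a : olt OZero xi -> olt a (opw xi) -> olt (OSucc a) (opw xi).
Proof. by move=> xi0 aW; exact: (opw_add aW (opw_gt1 xi0)). Qed.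

Lemma opw_muln xi a n : olt a (opw xi) -> olt (omul a (ofin n)) (opw xi).
Proof.
move=> aW; elim: n => [|n IH] /=; first exact: opw_ge1.
exact: opw_add.
Qed.

Lemma is_sup_olt b a c : is_sup_pos b a -> olt c a -> exists2 n, (0 < n)%N & olt c (b n).
Proof.
move=> [_ Hs] ca; apply: contrapT => /forall2NP H.
apply: (@olt_irr a); apply: ole_olt_trans ca; apply: Hs => n n0.
by apply: oleNgt; case: (H n).
Qed.

(** A power of omega with positive exponent is nonzero and closed under successor, so every tree of
    that value has a limit at its root. *)
Lemma opw_lim xi w : olt OZero xi -> ole w (opw xi) -> ole (opw xi) w ->
  exists f, w = OLim f.
Proof.
case: w => [_ _ H|c xi0 cW Wc|f]; last by exists f.
  by have := ole_trans (opw_ge1 xi) H => {}H; inversion H.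
by case: (@olt_irr (opw xi)); apply: ole_olt_trans Wc (opw_succ xi0 cW).
Qed.

(** The label at the root is the head of the word and becomes the last summand, which by [inS_add]
    is the outermost family. *)
Lemma osum_cons beta n s : osum beta (n :: s) = oadd (osum beta s) (beta n).
Proof.
rewrite /osum /=.
suff H a : foldl (fun acc n => oadd (beta n) acc) a s
         = oadd (foldl (fun acc n => oadd (beta n) acc) OZero s) a by rewrite H.
elim: s a => [|m s IH] a /=; first by rewrite oadd0l.
by rewrite (IH (oadd _ a)) (IH (beta m)) oaddA.
Qed.

Lemma osum_owf beta s : (forall n, (0 < n)%N -> owf (beta n)) ->
  all (fun n => 0 < n)%N s -> owf (osum beta s).
Proof.
move=> wb; elim: s => // n s IH /andP[n0 s0].
by rewrite osum_cons; apply: owf_add; [exact: IH|exact: wb].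
Qed.

(** * Schreier families *)

Lemma fset_pos_cat F G :
  fset_pos (F ++ G) = [&& allrel ltn F G, fset_pos F & fset_pos G].
Proof.
rewrite /fset_pos !(sorted_pairwise ltn_trans) pairwise_cat all_cat.
by case: allrel; case: pairwise; case: all; case: pairwise.
Qed.

Lemma fset_pos_cons p F : fset_pos (p :: F) = [&& (0 < p)%N, all (ltn p) F & fset_pos F].
Proof.
by rewrite -[p :: F]cat1s fset_pos_cat allrel1l {1}/fset_pos /= andbT andbCA.
Qed.

Lemma fset_pos_uniq F : fset_pos F -> uniq F.
Proof. by move=> /andP[/(sorted_uniq ltn_trans ltnn)]. Qed.

Lemma fset_pos_gt0 F p : fset_pos F -> p \in F -> (0 < p)%N.
Proof. by move=> /andP[_ /allP]; exact. Qed.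

Lemma fset_pos_subseq F G : subseq F G -> fset_pos G -> fset_pos F.
Proof.
move=> FG /andP[sG /allP pG]; apply/andP; split.
  exact: subseq_sorted ltn_trans _ _ FG sG.
by apply/allP => p /(mem_subseq FG)/pG.
Qed.

Lemma fset_pos_filter (D : pred nat) F : fset_pos F -> fset_pos [seq p <- F | D p].
Proof. exact/fset_pos_subseq/filter_subseq. Qed.

Lemma fmin_le F p : fset_pos F -> p \in F -> (fmin F <= p)%N.
Proof.
case: F => // q F; rewrite fset_pos_cons => /and3P[_ /allP qF _].
by rewrite inE => /orP[/eqP -> //|/qF /ltnW].
Qed.

Lemma fmin_mem F : F != [::] -> fmin F \in F.
Proof. by case: F => // p F _; rewrite mem_head. Qed.

Lemma fmax_mem F : F != [::] -> fmax F \in F.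
Proof. by case: F => // p F _; rewrite /fmax /= mem_last. Qed.

Lemma fmax_ge F p : fset_pos F -> p \in F -> (p <= fmax F)%N.
Proof.
elim: F => // q F IH; rewrite fset_pos_cons => /and3P[_ /allP qF sF].
rewrite inE => /orP[/eqP ->|pF]; last first.
  by have := IH sF pF; case: F pF {IH qF sF} => // r F.
case: F qF {IH sF} => // r F qF; apply: ltnW; apply: qF.
by rewrite /fmax /= mem_last.
Qed.

Lemma fmin_flatten Es : all (fun E => E != [::]) Es ->
  fmin (flatten Es) = fmin (map fmin Es).
Proof. by case: Es => //= -[]. Qed.

(** Replaces conditions on consecutive pairs by one strictly increasing list, which passes easily to
    subsequences and concatenations. *)
Lemma successiveE Es :
  successive Es <-> all (fun E => E != [::]) Es /\ fset_pos (flatten Es).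
Proof.
elim: Es => [|E Es IH]; first by split.
have -> : successive (E :: Es) <-> [/\ E != [::], fset_pos E, successive Es
    & (Es != [::]) ==> (fmax E < fmin (head [::] Es))%N].
  rewrite /successive; case: Es {IH} => [|G Es] /=.
    by rewrite andbT; split=> [[/andP[]]|[-> ->]].
  split=> [[/andP[/andP[-> ->] ->]] /andP[-> ->] //|[-> -> [/= -> ->] ->] //].
rewrite /= fset_pos_cat; split.
- move=> [-> pE /IH [nEs pEs] EEs]; rewrite nEs pE pEs !andbT; split=> //.
  apply/allrelP => p q pE' qEs; apply: leq_ltn_trans (fmax_ge pE pE') _.
  case: Es {IH} EEs nEs pEs qEs => //= G Es EG /andP[nG nEs] pEs qEs.
  apply: leq_trans EG _; rewrite -[G]/(head [::] (G :: Es)).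
  have -> : fmin G = fmin (flatten (G :: Es)) by case: G nG {pEs qEs}.
  exact: fmin_le.
- move=> [/andP[nE nEs] /and3P[/allrelP EEs pE pEs]]; split=> //; first exact/IH.
  apply/implyP; case: Es nEs EEs {IH pEs} => //= G Es /andP[nG _] EEs _.
  by apply: EEs; rewrite ?fmax_mem// mem_cat fmin_mem.
Qed.

Lemma successive_nonempty Es E : successive Es -> E \in Es -> E != [::].
Proof. by move=> /successiveE[/allP + _]; exact. Qed.

Lemma subseq_flatten (T : eqType) (Es : seq (seq T)) E : E \in Es -> subseq E (flatten Es).
Proof.
elim: Es => //= G Es IH; rewrite inE => /orP[/eqP ->|/IH]; first exact: prefix_subseq.
by move/subseq_trans; apply; exact: suffix_subseq.
Qed.

Lemma successive_fset_pos Es E : successive Es -> E \in Es -> fset_pos E.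
Proof.
by move=> /successiveE[_ pEs] EEs; exact: fset_pos_subseq (subseq_flatten EEs) pEs.
Qed.

Lemma mins_subseq Es : all (fun E => E != [::]) Es -> subseq (map fmin Es) (flatten Es).
Proof.
elim: Es => //= E Es IH /andP[nE /IH {}IH]; rewrite -cat1s; apply: cat_subseq => //.
by rewrite sub1seq fmin_mem.
Qed.

Lemma mins_fset_pos Es : successive Es -> fset_pos (map fmin Es).
Proof. by move=> /successiveE[nEs]; exact/fset_pos_subseq/mins_subseq. Qed.

Lemma flatten_filter_nonempty (T : eqType) (Es : seq (seq T)) :
  flatten [seq E <- Es | E != [::]] = flatten Es.
Proof. by elim: Es => //= -[|p E] Es /= ->. Qed.

Lemma flatten_map_flatten (T : Type) (Ess : seq (seq (seq T))) :
  flatten (map flatten Ess) = flatten (flatten Ess).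
Proof. by elim: Ess => //= Es Ess ->; rewrite flatten_cat. Qed.

(* [spread F G]: G is obtained from a subset of F by moving points to the right. *)
Fixpoint spread (F G : seq nat) : bool :=
  match F, G with
  | _, [::] => true
  | [::], _ => false
  | f :: F', g :: G' => (f <= g)%N && spread F' G' || spread F' G
  end.

Lemma spread_nil F : spread F [::].
Proof. by case: F. Qed.

Lemma spread_map (T : eqType) (f g : T -> nat) s' s : subseq s' s ->
  (forall x, x \in s' -> (f x <= g x)%N) -> spread (map f s) (map g s').
Proof.
elim: s s' => [|x s IH] [|y s'] //= H fg.
case: eqP H => [<-|_] H.
  rewrite fg ?mem_head //= IH // => z zs; apply: fg.
  by rewrite inE zs orbT.
by have := IH (y :: s') H fg => /= ->; rewrite orbT.
Qed.

Lemma spread_subseq G F : subseq G F -> spread F G.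
Proof. by move=> GF; have := spread_map (f := id) (g := id) GF; rewrite !map_id; apply. Qed.

Lemma spread_size F G : spread F G -> (size G <= size F)%N.
Proof.
elim: F G => [|f F IH] [|g G] //= /orP[/andP[_ /IH]|/IH] //.
by move=> /leq_trans; exact.
Qed.

Lemma spread_ge a F G : all (leq a) F -> spread F G -> all (leq a) G.
Proof.
elim: F G => [|f F IH] [|g G] //= /andP[af aF] /orP[/andP[fg FG]|/(IH _ aF)] //.
by rewrite (leq_trans af fg) IH.
Qed.

Lemma spread_fmin F G : fset_pos F -> spread F G -> G != [::] -> (fmin F <= fmin G)%N.
Proof.
move=> pF FG nG; have /allP : all (leq (fmin F)) G.
  by apply: spread_ge FG; apply/allP => p; exact: fmin_le.
by apply; exact: fmin_mem.
Qed.

Lemma spread_cat E F G : spread (E ++ F) G ->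
  exists G1 G2, [/\ G = G1 ++ G2, spread E G1 & spread F G2].
Proof.
elim: E G => [|e E IH] G /=; first by move=> FG; exists [::], G.
case: G => [_|g G /orP[/andP[eg /IH[G1 [G2 [-> EG FG]]]]|/IH[G1 [G2 [-> EG FG]]]]].
- by exists [::], [::]; rewrite spread_nil.
- by exists (g :: G1), G2; rewrite eg EG.
- by exists G1, G2; split=> //; case: G1 EG => //= g1 G1 ->; rewrite orbT.
Qed.

Lemma spread_flatten Es G : spread (flatten Es) G ->
  exists2 Gs, G = flatten Gs & all2 spread Es Gs.
Proof.
elim: Es G => [|E Es IH] G /=; first by case: G => // _; exists [::].
move=> /spread_cat[G1 [G2 [-> EG /IH[Gs -> EsGs]]]].
by exists (G1 :: Gs) => //=; rewrite EG.
Qed.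

Lemma inS_nil b : inS b [::].
Proof. by case: b => //= [c|f]; [exists [::]; repeat split|left]. Qed.

(** Heredity and spreading go together because cutting [G] along the pieces of [F] yields moved
    subsets of these pieces. Empty ones are dropped: the number of pieces does not grow and the
    minimum does not decrease, so the outer Schreier condition survives, and at a limit the same
    index k can be kept. *)
Lemma inS_spread b F G : fset_pos F -> fset_pos G -> inS b F -> spread F G -> inS b G.
Proof.
elim: b F G => [F G _ _ /= F1 /spread_size/leq_trans|c IH F G pF pG|f IH F G pF pG]; first exact.
- move=> [Es [FE [[sEs schr] cEs]]] FG; move: (FG); rewrite {1}FE => /spread_flatten[Gs GE EsGs].
  exists [seq E <- Gs | E != [::]]; rewrite flatten_filter_nonempty; split=> //.
  have sGs : successive [seq E <- Gs | E != [::]].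
    by apply/successiveE; rewrite filter_all flatten_filter_nonempty -GE.
  split; first split=> //.
  + rewrite /schreier1 -fmin_flatten ?filter_all // flatten_filter_nonempty -GE size_map.
    case: (eqVneq G [::]) => [G0|nG].
      suff -> : [seq E <- Gs | E != [::]] = [::] by rewrite G0.
      have := flatten_filter_nonempty Gs; rewrite -GE G0.
      have := filter_all (fun E : seq nat => E != [::]) Gs.
      by case: seq.filter => // -[].
    apply: leq_trans (spread_fmin pF FG nG).
    rewrite FE fmin_flatten; last by move/successiveE: sEs => [].
    apply: leq_trans schr; rewrite size_map size_filter.
    by apply: leq_trans (count_size _ _) _; move: EsGs; rewrite all2E => /andP[/eqP <-].
  + move=> E; rewrite mem_filter => /andP[nE EGs].
    have pE : fset_pos E.
      by apply: fset_pos_subseq pG; rewrite GE; exact: subseq_flatten.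
    have : exists2 E', E' \in Es & spread E' E.
      elim: (Es) (Gs) EsGs EGs => [|E' Es' IHs] [|G' Gs'] //= /andP[EG /IHs {}IHs].
      rewrite inE => /orP[/eqP ->|/IHs[E'' E''s E''E]]; first by exists E'; rewrite ?mem_head.
      by exists E'' => //; rewrite inE E''s orbT.
    move=> [E' E'Es E'E]; apply: (IH E') => //; last exact: cEs.
    exact: successive_fset_pos E'Es.
- move=> [->|[k [k0 [kF fkF]]]] FG; first by move: FG => /=; case: (G) => //; left.
  case: (eqVneq G [::]) => [->|nG]; first by left.
  right; exists k; split=> //; split; last exact: IH fkF _.
  by apply: leq_trans kF _; exact: spread_fmin.
Qed.

Lemma inS_subseq b F G : fset_pos F -> inS b F -> subseq G F -> inS b G.
Proof.
move=> pF bF GF; apply: inS_spread bF (spread_subseq GF) => //.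
exact: fset_pos_subseq pF.
Qed.

Lemma inS_single b p : (0 < p)%N -> inS b [:: p].
Proof.
move=> p0; elim: b => //= [c IH|f IH].
  exists [:: [:: p]]; split=> //; split; first by split=> //; apply/successiveE; rewrite fset_pos_cons p0.
  by move=> E; rewrite inE => /eqP ->.
by right; exists 1%N.
Qed.

Lemma inS_le1 b F : fset_pos F -> (size F <= 1)%N -> inS b F.
Proof.
by case: F => [|p [|]] // pF _; [exact: inS_nil|apply: inS_single; apply: fset_pos_gt0 pF _; rewrite mem_head].
Qed.

Lemma flatten_seq1 (T : Type) (F : seq T) : flatten [seq [:: p] | p <- F] = F.
Proof. by elim: F => //= p F ->. Qed.

Lemma successive_seq1 F : fset_pos F -> successive [seq [:: p] | p <- F].
Proof.
by move=> pF; apply/successiveE; rewrite flatten_seq1 pF; split=> //; elim: (F).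
Qed.

Lemma map_fmin_seq1 F : map fmin [seq [:: p] | p <- F] = F.
Proof. by rewrite -map_comp /fmin /= map_id. Qed.

(* The family M[N] of the informal statement. *)
Definition sprod (P Q : seq nat -> Prop) (F : seq nat) : Prop :=
  exists Es : seq (seq nat), F = flatten Es /\ admissible P Es /\
    (forall E, E \in Es -> Q E).

Lemma split_map (T U : Type) (f : T -> U) Ds Hs : map f Ds = flatten Hs ->
  exists2 Dss, Ds = flatten Dss & map (map f) Dss = Hs.
Proof.
elim: Hs Ds => [|H Hs IH] Ds /=; first by case: Ds => // _; exists [::].
move=> DH; have [|Dss DE HE] := IH (drop (size H) Ds); first by rewrite map_drop DH drop_size_cat.
exists (take (size H) Ds :: Dss); first by rewrite /= -DE cat_take_drop.
by rewrite /= HE map_take DH take_size_cat.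
Qed.

(** A decomposition of the list of minima cuts the list of sets into runs, and the union of a run
    has the minimum of its first set. *)
Lemma admissible_group P Q Es : successive Es -> sprod P Q (map fmin Es) ->
  exists Ess, [/\ Es = flatten Ess, admissible P (map flatten Ess)
    & forall Es', Es' \in Ess -> admissible Q Es'].
Proof.
move=> /successiveE[nEs pEs] [Hs [/split_map[Ess EE HE] [[/successiveE[nHs _] PHs] QHs]]].
have nEss Es' : Es' \in Ess -> Es' != [::].
  by move=> EE'; have := allP nHs (map fmin Es'); rewrite -HE map_f // => /(_ isT); case: (Es').
have fmE Es' : Es' \in Ess -> all (fun E => E != [::]) Es'.
  move=> EE'; apply/allP => E' E'E; apply: (allP nEs).
  by rewrite EE; apply/flattenP; exists Es'.
have fl Es' : Es' \in Ess -> fmin (flatten Es') = fmin (map fmin Es').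
  by move=> /fmE/fmin_flatten.
exists Ess; split=> //.
- split.
    apply/successiveE; rewrite flatten_map_flatten -EE; split=> //.
    apply/allP => _ /mapP[Es' Es'E ->].
    by move: (nEss _ Es'E) (fmE _ Es'E); case: (Es') => //= -[].
  suff -> : map fmin (map flatten Ess) = map fmin Hs by [].
  by rewrite -HE -!map_comp; apply/eq_in_map => Es' /fl.
- move=> Es' Es'E; split; last by apply: QHs; rewrite -HE map_f.
  apply/successiveE; split; first exact: fmE.
  apply: fset_pos_subseq pEs; rewrite EE -flatten_map_flatten.
  by apply: subseq_flatten; rewrite map_f.
Qed.

Lemma admissible_ungroup P Q Ess : admissible P (map flatten Ess) ->
  (forall Es, Es \in Ess -> admissible Q Es) -> admissible (sprod P Q) (flatten Ess).
Proof.
move=> [/successiveE[nE pE] PE] QE.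
have sE : successive (flatten Ess).
  apply/successiveE; rewrite -flatten_map_flatten; split=> //.
  apply/allP => E /flattenP[Es EsE EEs]; have [/successive_nonempty + _] := QE _ EsE.
  exact.
split=> //; exists (map (map fmin) Ess); rewrite map_flatten; split=> //.
have fE Es : Es \in Ess -> fmin (flatten Es) = fmin (map fmin Es).
  by move=> /QE[/successiveE[/fmin_flatten]].
split; last by move=> _ /mapP[Es /QE[_ QEs] ->].
split.
  apply/successiveE; rewrite -map_flatten; split; last exact: mins_fset_pos.
  apply/allP => _ /mapP[Es EsE ->]; have := allP nE (flatten Es); rewrite map_f // => /(_ isT).
  by case: (Es).
suff -> : map fmin (map (map fmin) Ess) = map fmin (map flatten Ess) by [].
by rewrite -!map_comp; apply/eq_in_map => Es /fE /= ->.
Qed.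

Lemma choice_seq (T U : eqType) (P : T -> U -> Prop) (s : seq T) (u0 : U) :
  (forall x, x \in s -> exists y, P x y) -> exists f, forall x, x \in s -> P x (f x).
Proof.
move=> H; have /choice[f Pf] : forall x, exists y, x \in s -> P x y.
  move=> x; have [/H[y Py]|xs] := boolP (x \in s); first by exists y.
  by exists u0.
by exists f.
Qed.

Lemma sprodA P Q S F : sprod P (sprod Q S) F <-> sprod (sprod P Q) S F.
Proof.
split.
- move=> [Es [FE [[sEs PEs] /(choice_seq [::])[D HD]]]].
  have EsE : Es = map flatten (map D Es).
    by rewrite -map_comp -[LHS]map_id; apply/eq_in_map => E /HD[].
  exists (flatten (map D Es)); rewrite -flatten_map_flatten -EsE; split=> //; split.
    apply: admissible_ungroup; first by rewrite -EsE.
    by move=> _ /mapP[E /HD[_ [? _]] ->].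
  by move=> E /flattenP[_ /mapP[G /HD[_ [_ H]] ->] /H].
- move=> [Es [-> [[sEs PQ] SEs]]].
  have [Ess [EE PE QE]] := admissible_group sEs PQ.
  exists (map flatten Ess); rewrite flatten_map_flatten -EE; split=> //; split=> //.
  move=> _ /mapP[Es' Es'E ->]; exists Es'; split=> //; split; first exact: QE.
  by move=> E EE'; apply: SEs; rewrite EE; apply/flattenP; exists Es'.
Qed.

Lemma eq_sprod P P' Q Q' F : fset_pos F -> (forall G, fset_pos G -> P G <-> P' G) ->
  (forall G, fset_pos G -> Q G <-> Q' G) -> sprod P Q F <-> sprod P' Q' F.
Proof.
move=> pF PP QQ; split=> -[Es [FE [[sEs PEs] QEs]]]; exists Es; (split=> //; split;
  [split=> //; apply/PP => //; exact: mins_fset_pos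
  |move=> E EE; apply/QQ; [exact: successive_fset_pos EE|exact: QEs]]).
Qed.

(** Exact, without passing to a subset: the sequence of [oadd a (OLim f)] is [oadd a (f k)], and a
    union has the same minimum as the set of minima of its pieces, so the index k is allowed on both
    sides simultaneously. *)
Lemma inS_add a b F : fset_pos F -> inS (oadd a b) F <-> sprod (inS b) (inS a) F.
Proof.
elim: b F => [F pF|b IH F pF|f IH F pF] /=.
- split=> [aF|[Es [-> [[_ Es1] aEs]]]].
  + case: (eqVneq F [::]) => [->|nF]; first by exists [::]; repeat split.
    exists [:: F]; rewrite /= cats0; split=> //; split; last by move=> E; rewrite inE => /eqP ->.
    by split=> //; apply/successiveE; rewrite /= cats0 nF pF.
  + case: Es Es1 aEs => [|E [|]] //= _ aEs; first exact: inS_nil.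
    by rewrite cats0; apply: aEs; rewrite mem_head.
- rewrite -[X in _ <-> X]/(sprod (sprod schreier1 (inS b)) (inS a) F).
  rewrite -[X in X <-> _]/(sprod schreier1 (inS (oadd a b)) F) -sprodA.
  by apply: eq_sprod => // G pG; exact: IH.
- split.
  + move=> [->|[k [k0 [kF /(IH k _ pF)[Es [FE [[sEs bEs] aEs]]]]]]].
      by exists [::]; split=> //; split=> //; split=> //; left.
    exists Es; split=> //; split=> //; split=> //; right; exists k; split=> //; split=> //.
    by rewrite -fmin_flatten -?FE//; case/successiveE: sEs.
  + move=> [Es [FE [[sEs bEs] aEs]]]; case: bEs => [E0|[k [k0 [kE bEs]]]].
      by left; rewrite FE; case: (Es) E0.
    right; exists k; split=> //; split; last by apply/IH => //; exists Es.
    by rewrite FE fmin_flatten; case/successiveE: sEs.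
Qed.

(** * Thinning of infinite sets and inclusions between Schreier families *)

Definition unbounded (A : set nat) := forall n, exists2 m, A m & (n < m)%N.

Lemma infinite_unbounded A : infinite_set A <-> unbounded A.
Proof.
split=> [iA n|uA /finite_seqP[s As]].
  apply: contrapT => /forall2NP H; apply: iA; apply: (sub_finite_set _ (finite_II n.+1)).
  by move=> m Am /=; rewrite ltnS leqNgt; apply/negP; case: (H m).
have [m + mn] := uA (\max_(i <- s) i)%N; rewrite As /= => ms.
by have := leq_bigmax_seq (P := xpredT) (F := id) m ms isT; rewrite leqNgt mn.
Qed.

Lemma unbounded_gt A n : unbounded A -> unbounded (A `&` [set m | (n < m)%N]).
Proof.
move=> uA k; have [m Am] := uA (maxn n k); rewrite gtn_max => /andP[nm km].
by exists m.
Qed.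

Lemma dependent_choice_nat (T : Type) (I : nat -> T -> Prop) (Q : nat -> T -> T -> Prop) x0 :
  I 0%N x0 -> (forall n x, I n x -> exists y, I n.+1 y /\ Q n x y) ->
  exists f, f 0%N = x0 /\ forall n, I n (f n) /\ Q n (f n) (f n.+1).
Proof.
move=> I0 H.
pose step n (u : {x | I n x}) : {y | I n.+1 y} :=
  let c := cid (H n (sval u) (svalP u)) in exist _ (sval c) (proj1 (svalP c)).
pose F := nat_rect (fun n => {x | I n x}) (exist _ x0 I0) step.
exists (fun n => sval (F n)); split=> // n; split; first exact: svalP.
by rewrite /= /step; case: cid => y [].
Qed.

Definition hereditary (P : nat -> set nat -> Prop) :=
  forall k A B, B `<=` A -> P k A -> P k B.

(** Density among infinite sets ordered by inclusion; together with [hereditary], the input of a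
    fusion argument. *)
Definition thinnable (P : set nat -> Prop) :=
  forall A, unbounded A -> exists B, [/\ B `<=` A, unbounded B & P B].

Lemma dense_forall_lt (P : nat -> set nat -> Prop) n : hereditary P ->
  (forall k, thinnable (P k)) -> thinnable (fun A => forall k, (k < n)%N -> P k A).
Proof.
move=> hP dP; elim: n => [A uA|n IH A uA]; first by exists A; split.
have [B [BA uB PB]] := IH A uA; have [C [CB uC PC]] := dP n B uB.
exists C; split=> [x /CB /BA| |k] //.
by rewrite ltnS leq_eqVlt => /orP[/eqP ->//|/PB]; exact: hP.
Qed.

(** Fusion: points are picked one by one from decreasing infinite sets, and once l is picked the
    remaining set is thinned for the finitely many k up to l. *)
Lemma diagonal_thinning (P : nat -> set nat -> Prop) A : hereditary P ->
  (forall k, thinnable (P k)) -> unbounded A ->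
  exists L, [/\ L `<=` A, unbounded L & forall l, L l -> forall k, (k <= l)%N ->
    P k (L `&` [set m | (l < m)%N])].
Proof.
move=> hP dP uA.
pose I (n : nat) (u : nat * set nat) := unbounded u.2 /\ u.2 `<=` A.
pose Q (n : nat) (u v : nat * set nat) := [/\ u.2 v.1, (u.1 < v.1)%N, v.2 `<=` u.2
  & forall k, (k <= v.1)%N -> P k v.2].
have step n u : I n u -> exists v, I n.+1 v /\ Q n u v.
  case: u => l B [/= uB BA]; have [m Bm lm] := uB l.
  have [C [CB uC PC]] := @dense_forall_lt P m.+1 hP dP B uB.
  by exists (m, C); split; split=> //= x /CB /BA.
have [f [f0 fP]] := dependent_choice_nat (I := I) (Q := Q) (x0 := (0%N, A)) (conj uA (fun _ x => x)) step.
have fI n : I n (f n) by case: (fP n).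
have fQ n : Q n (f n) (f n.+1) by case: (fP n).
have decr m n : (m <= n)%N -> (f n).2 `<=` (f m).2.
  elim: n => [|n IH]; first by rewrite leqn0 => /eqP ->.
  rewrite leq_eqVlt => /orP[/eqP -> //|/IH H] x fx; apply: H.
  by have [_ _ H _] := fQ n; exact: H.
have incr m n : (m < n)%N -> ((f m).1 < (f n).1)%N.
  elim: n => // n IH; rewrite ltnS leq_eqVlt => /orP[/eqP ->|/IH H]; first by case: (fQ n).
  by apply: ltn_trans H _; case: (fQ n).
exists [set (f n.+1).1 | n in setT]; split.
- by move=> _ [n _ <-]; have [_] := fI n; apply; case: (fQ n).
- move=> n; exists (f n.+1).1; first by exists n.
  by elim: n => [|n IH]; [exact: leq_ltn_trans (leq0n _) (incr 0%N 1%N isT)|exact: leq_ltn_trans IH (incr _ _ (ltnSn _))].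
- move=> _ [n _ <-] k kn; have [_ _ _ /(_ k kn)] := fQ n; apply: hP.
  move=> _ [[m _ <-] /=] nm; apply: (decr n.+1 m); last by case: (fQ m).
  rewrite leqNgt; apply/negP; rewrite leq_eqVlt => /orP[/eqP[mn]|mn].
    by rewrite mn ltnn in nm.
  by have := ltn_trans nm (incr _ _ mn); rewrite ltnn.
Qed.

Definition schreier_sub (L : set nat) (a b : ord) :=
  forall F, fset_pos F -> (forall p, p \in F -> L p) -> inS a F -> inS b F.

Lemma schreier_subS A B a b : B `<=` A -> schreier_sub A a b -> schreier_sub B a b.
Proof. by move=> BA H F pF FB; apply: H => // p /FB /BA. Qed.

(* Distinct trees of equal value give incomparable families, even up to finitely
   many points, so the inclusion is only obtained on a sparse set. *)
Lemma schreier_sub_thinnable a b : owf a -> owf b -> olt a b ->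
  thinnable (fun L => schreier_sub L a b).
Proof.
elim: b a => [a _ _ H|b IH a wa wb /ole_succ_inv ab|g IH a wa wb ab]; first by inversion H.
- case: a wa ab => [_ _|a /= wa ab|f [wf sf] /ole_lim_inv ab] A uA.
  + by exists A; split=> // F pF _; exact: inS_le1.
  + have [B [BA uB aB]] := IH a wa wb ab A uA; exists B; split=> // F pF FB.
    move=> [Es [FE [adm aEs]]]; exists Es; split=> //; split=> // E EE.
    apply: aB; [exact: successive_fset_pos adm.1 EE| |exact: aEs].
    by move=> p pE; apply: FB; rewrite FE; apply/flattenP; exists E.
  + have dP k : thinnable (fun L => schreier_sub L (f k) b).
      exact: (IH _ (wf k) wb (olt_ole_trans (sf k) (ab _))).
    have hP : hereditary (fun k L => schreier_sub L (f k) b).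
      by move=> k ? ?; exact: schreier_subS.
    (* A set of the limit family with minimum p lies in [inS (f k)] for one of the finitely many k
       up to p, so on the diagonal set its part beyond p is in [inS b]. With {p} this makes two
       pieces, a Schreier union since points are kept above 1. *)
    have [B [BA uB fB]] := diagonal_thinning hP dP (unbounded_gt 1%N uA).
    exists B; split=> // [p /BA[]//|F pF FB [->|[k [k0 [kF fkF]]]]]; first exact: inS_nil.
    case: F pF FB kF fkF => [|p F] pF FB kF fkF; first exact: inS_nil.
    move: (pF); rewrite fset_pos_cons => /and3P[p0 /allP pF' sF].
    case: (eqVneq F [::]) => [->|nF]; first exact: inS_single.
    exists [:: [:: p]; F]; rewrite /= cats0; split=> //; split.
      split; first by apply/successiveE; rewrite /= cats0 nF.
      by have /BA[] := FB p (mem_head _ _).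
    move=> E; rewrite !inE => /orP[/eqP ->|/eqP ->]; first exact: inS_single.
    apply: (fB p (FB p (mem_head _ _)) k kF) => //.
      by move=> q qF; split; [apply: FB; rewrite inE qF orbT|exact: pF'].
    by apply: inS_subseq fkF _ => //; exact: subseq_cons.
(* The index k + 1 is positive, as the limit clause of [inS] demands; discarding the points up to k
   gives k + 1 <= [fmin F]. *)
- have [wg sg] := wb; have [k ak] := ole_succ_lim_inv ab.
  move=> A uA; have [B [BA uB gB]] := IH k.+1 a wa (wg _) (olt_ole_trans ak (oltW (sg k))) _ (unbounded_gt k uA).
  exists B; split=> // [p /BA[]//|F pF FB aF].
  case: (eqVneq F [::]) => [->|nF]; [exact: inS_nil|right; exists k.+1].
  by split=> //; split; [have /BA[] := FB _ (fmin_mem nF)|exact: gB].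
Qed.

Lemma schreier_sub_thinnable_seq (T : eqType) (a b : T -> ord) (s : seq T) :
  (forall x, x \in s -> [/\ owf (a x), owf (b x) & olt (a x) (b x)]) ->
  thinnable (fun L => forall x, x \in s -> schreier_sub L (a x) (b x)).
Proof.
elim: s => [|x s IH] H A uA; first by exists A; split.
have [y ys|B [BA uB sB]] := IH _ A uA; first by apply: H; rewrite inE ys orbT.
have [wa wb ab] := H x (mem_head _ _).
have [C [CB uC xC]] := schreier_sub_thinnable wa wb ab uB.
exists C; split=> [z /CB /BA| |y] //.
by rewrite inE => /orP[/eqP -> //|/sB]; exact: schreier_subS.
Qed.

(** * Averages *)

Lemma fset_pos_filter_mem F G : fset_pos F -> fset_pos G -> {subset G <= F} ->
  [seq p <- F | p \in G] = G.
Proof.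
move=> /andP[sF _] /andP[sG _] GF.
apply: (irr_sorted_eq ltn_trans ltnn) => [| //|p].
  exact: sorted_filter ltn_trans _ _ sF.
by rewrite mem_filter andb_idr // => /GF.
Qed.

Lemma fset_pos_sub_subseq F G : fset_pos F -> fset_pos G -> {subset G <= F} -> subseq G F.
Proof. by move=> pF pG /fset_pos_filter_mem <- //; exact: filter_subseq. Qed.

Lemma olt_lim_mono f m n : owf (OLim f) -> (m < n)%N -> olt (f m) (f n).
Proof.
move=> [_ sf]; elim: n => // n IH; rewrite ltnS leq_eqVlt => /orP[/eqP -> //|/IH mn].
exact: olt_ole_trans mn (oltW (sf n)).
Qed.

Section Averages.
Variable R : realType.
Implicit Types (z : nat -> R) (M : set nat).

Definition mass z (F G : seq nat) : R := \sum_(p <- F | p \in G) z p.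

Definition average M (P : nat) (F : seq nat) z :=
  [/\ fset_pos F, forall p, p \in F -> M p /\ (P < p)%N, forall p, 0 <= z p
    & \sum_(p <- F) z p = 1].

Definition small_on z F a (eta : R) :=
  forall G, fset_pos G -> inS a G -> mass z F G <= eta.

Lemma mass_ge0 z F G : (forall p, 0 <= z p) -> 0 <= mass z F G.
Proof. by move=> z0; exact: sumr_ge0. Qed.

Lemma mass_le z F G : (forall p, 0 <= z p) -> mass z F G <= \sum_(p <- F) z p.
Proof.
move=> z0; rewrite /mass big_mkcond; apply: ler_sum => p _.
by case: ifP.
Qed.

Lemma mass_sub z F G : fset_pos F -> fset_pos G -> {subset G <= F} ->
  mass z F G = \sum_(p <- G) z p.
Proof. by move=> pF pG GF; rewrite /mass -big_filter fset_pos_filter_mem. Qed.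

Lemma average_nonempty M P F z : average M P F z -> F != [::].
Proof. by case=> _ _ _; case: F => //; rewrite big_nil => /eqP; rewrite eq_sym oner_eq0. Qed.

(** Repeated averages. Each new average is negligible on sets that start before it, so a set of
    [inS a] can take weight up to 1 only from the first block it meets, and averaging over r blocks
    divides this 1 by r. *)
Lemma average_blocks a :
  (forall M P q (eta : R), unbounded M -> 0 < eta -> exists F z,
     [/\ average M P F z, inS a F
       & forall G, fset_pos G -> inS a G -> (fmin G <= q)%N -> mass z F G <= eta]) ->
  forall M P (eta : R), unbounded M -> 0 < eta -> exists F z,
     [/\ average M P F z, inS (OSucc a) F & small_on z F a eta].
Proof.
move=> H M P eta uM eta0.
(* 1 / r uses one half of [eta] and the negligible blocks use the other. The points are also kept
   beyond r, so that r blocks form a Schreier union. *)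
pose r := (Num.truncn (2 / eta)).+1.
have rE : 2 / eta < r%:R :> R by exact: truncnS_gt.
have r0 : 0 < r%:R :> R by rewrite ltr0n.
have claim n : exists Fs z, [/\ successive Fs, size Fs = n,
     forall F, F \in Fs -> inS a F /\ forall p, p \in F -> M p /\ (maxn P r < p)%N,
     forall p, 0 <= z p
   & \sum_(p <- flatten Fs) z p = n%:R /\
     forall G, fset_pos G -> inS a G -> mass z (flatten Fs) G <= 1 + n%:R * (eta / 2)].
  elim: n => [|n [Fs [z [sFs szFs FsP z0 [sz mz]]]]].
    exists [::], (fun=> 0); split=> //=; split; first by rewrite big_nil.
    by move=> G _ _; rewrite /mass big_nil mul0r addr0.
  have [pFs nFs] : fset_pos (flatten Fs) /\ all (fun E => E != [::]) Fs.
    by case/successiveE: sFs.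
  have [F [x [[pF FP x0 sx] aF xF]]] :=
    H M (maxn (maxn P r) (fmax (flatten Fs))) (fmax (flatten Fs)) (eta / 2) uM (divr_gt0 eta0 (ltr0Sn _ _)).
  have nF : F != [::] by apply: (@average_nonempty M (maxn (maxn P r) (fmax (flatten Fs))) F x); split.
  have dis p q : p \in flatten Fs -> q \in F -> (p < q)%N.
    move=> pFs' /FP[_]; rewrite gtn_max => /andP[_]; apply: leq_ltn_trans; exact: fmax_ge.
  have FsF : flatten (rcons Fs F) = flatten Fs ++ F.
    by rewrite flatten_rcons.
  pose z' p := if p \in flatten Fs then z p else x p.
  have z'E (D : pred nat) : \sum_(p <- flatten Fs ++ F | D p) z' p =
      \sum_(p <- flatten Fs | D p) z p + \sum_(p <- F | D p) x p.
    rewrite big_cat /=; congr (_ + _); rewrite big_seq_cond [RHS]big_seq_cond;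
      apply: eq_bigr => p /andP[pF' _]; rewrite /z' ?pF' //.
    by case: ifP => // /dis/(_ pF'); rewrite ltnn.
  exists (rcons Fs F), z'; split.
  - apply/successiveE; rewrite all_rcons nF nFs FsF fset_pos_cat pFs pF !andbT; split=> //.
    by apply/allrelP => p q; exact: dis.
  - by rewrite size_rcons szFs.
  - move=> E; rewrite mem_rcons inE => /orP[/eqP ->|/FsP //]; split=> // p /FP[Mp].
    by rewrite gtn_max => /andP[].
  - by move=> p; rewrite /z'; case: ifP.
  - rewrite FsF z'E sz sx -natr1; split=> // G pG aG.
    rewrite /mass z'E -/(mass z _ G) -/(mass x _ G) mulrDl mul1r addrA.
    (* Either [G] meets an earlier block, hence starts early and takes at most [eta / 2] from [F],
       or all its mass comes from [F]. *)
    have [/hasP[p pFs' pG']|/hasPn nh] := boolP (has (fun p => p \in G) (flatten Fs)).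
      apply: lerD; first exact: mz.
      by apply: xF => //; exact: leq_trans (fmin_le pG pG') (fmax_ge pFs pFs').
    have -> : mass z (flatten Fs) G = 0.
      by rewrite /mass big_seq_cond big1 // => p /andP[/nh /negbTE ->].
    rewrite add0r -addrA; apply: le_trans (mass_le _ _ x0) _; rewrite sx lerDl.
    by rewrite addr_ge0 ?mulr_ge0 ?divr_ge0 // ltW.
have [Fs [z [sFs szFs FsP z0 [sz mz]]]] := claim r.
have [nFs pFs] : all (fun E => E != [::]) Fs /\ fset_pos (flatten Fs) by case/successiveE: sFs.
have FP p : p \in flatten Fs -> M p /\ (maxn P r < p)%N.
  by move=> /flattenP[F /FsP[_ H'] /H'].
exists (flatten Fs), (fun p => z p / r%:R); split.
- split=> //.
  + by move=> p /FP[Mp]; rewrite gtn_max => /andP[].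
  + by move=> p; rewrite divr_ge0.
  + by rewrite -mulr_suml sz divff // gt_eqF.
- exists Fs; split=> //; split; last by move=> E /FsP[].
  split=> //; rewrite /schreier1 -fmin_flatten // size_map szFs.
  have nf : flatten Fs != [::].
    by apply/eqP => E; move: sz; rewrite E big_nil => /eqP; rewrite eq_sym gt_eqF.
  by have [_] := FP _ (fmin_mem nf); rewrite gtn_max => /andP[_ /ltnW].
- move=> G pG aG; rewrite /mass -mulr_suml ler_pdivrMr //.
  apply: le_trans (mz G pG aG) _.
  have : 2 < r%:R * eta by rewrite -ltr_pdivrMr.
  lra.
Qed.

(** By [average_blocks] only sets with minimum at most q matter. At zero they miss a point chosen
    beyond q; at a successor they have at most q pieces; at a limit they belong to one of finitely
    many earlier families. *)
Lemma average_exists a : owf a ->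
  forall M P (eta : R), unbounded M -> 0 < eta -> exists F z,
     [/\ average M P F z, inS (OSucc a) F & small_on z F a eta].
Proof.
elim: a => [_|a IH wa|f IH [wf sf]]; apply: average_blocks => M P q eta uM eta0.
- have [p Mp] := uM (maxn P q); rewrite gtn_max => /andP[Pp qp].
  have p0 : (0 < p)%N by exact: leq_ltn_trans Pp.
  exists [:: p], (fun=> 1); split=> //.
    split=> //; first by rewrite fset_pos_cons p0.
      by move=> p'; rewrite inE => /eqP ->.
    by rewrite big_seq1.
  move=> [|g [|]] //= pG _ gq; rewrite /mass big_cons big_nil /=; first exact: ltW.
  rewrite inE; case: eqP => [pg|_]; last exact: ltW.
  by move: gq; rewrite /fmin /= -pg leqNgt qp.
- have q0 : 0 < q.+1%:R :> R by [].
  have [F [z [aF SF nF]]] := IH wa M P (eta / q.+1%:R) uM (divr_gt0 eta0 q0).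
  exists F, z; split=> // G pG [Es [GE [[sEs schr] aEs]]] Gq.
  have [_ _ z0 _] := aF.
  have : mass z F G <= \sum_(E <- Es) mass z F E.
    rewrite GE; elim: (Es) => [|E Es' IHE].
      by rewrite big_nil /mass big1.
    rewrite big_cons; apply: le_trans (lerD (lexx _) IHE); rewrite /mass.
    rewrite [X in X <= _]big_mkcond [X in _ <= X + _]big_mkcond [X in _ <= _ + X]big_mkcond -big_split /=.
    apply: ler_sum => p _; rewrite mem_cat.
    by case: (p \in E); case: (p \in flatten Es') => //=; rewrite ?addr0 ?add0r // lerDl.
  move/le_trans; apply.
  apply: (@le_trans _ _ (\sum_(E <- Es) (eta / q.+1%:R))).
    rewrite big_seq [leRHS]big_seq; apply: ler_sum => E EE.
    by apply: nF; [exact: successive_fset_pos EE|exact: aEs].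
  rewrite big_const_seq iter_addr_0 count_predT -[leLHS]mulr_natr mulrAC ler_pdivrMr //.
  rewrite ler_pM2l // ler_nat; apply: leqW.
  move: schr; rewrite /schreier1 size_map -fmin_flatten -?GE; last by case/successiveE: sEs.
  by move/leq_trans; exact.
- have fk k : (k <= q)%N -> olt (f k) (f q.+1) by move=> kq; exact: olt_lim_mono.
  (* The families [f k] with k <= q are absorbed by [f q.+1], whose successor is still below the
     limit; the latter puts the average itself into the limit family. *)
  have [|L [LM uL LP]] := @schreier_sub_thinnable_seq _ f (fun=> f q.+1) (iota 0 q.+1) _ M uM.
    by move=> k; rewrite mem_iota leq0n add0n ltnS => /fk kq; split; [exact: wf|exact: wf|exact: kq].
  have Sq : olt (OSucc (f q.+1)) (OLim f).
    by apply: (@ole_limr _ _ q.+3); apply: olt_ole_trans (sf q.+2); exact/ole_succ/sf.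
  have [L' [L'L uL' L'P]] :=
    @schreier_sub_thinnable (OSucc (f q.+1)) (OLim f) (wf _) (conj wf sf) Sq L uL.
  have [F [z [[pF FP z0 sz] SF nF]]] := IH q.+1 (wf _) L' P eta uL' eta0.
  exists F, z; split=> //.
  + by split=> // p /FP[/L'L /LM].
  + by apply: L'P => // p /FP[].
  + move=> G pG [->|[k [k0 [kG fG]]]] Gq; first by rewrite /mass big1 // ltW.
    (* The inclusions are known on [L] only, so [G] is replaced by its trace on [F]. *)
    have -> : mass z F G = mass z F [seq p <- G | p \in F].
      rewrite /mass big_seq_cond [RHS]big_seq_cond; apply: eq_bigl => p.
      by rewrite mem_filter; case: (p \in F).
    apply: nF; first exact: fset_pos_filter.
    apply: (LP k); first by rewrite mem_iota /= ltnS (leq_trans kG Gq).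
    - exact: fset_pos_filter.
    - by move=> p; rewrite mem_filter => /andP[/FP[/L'L]].
    - by apply: inS_subseq fG _ => //; exact: filter_subseq.
Qed.

Lemma spread_behead (p : nat -> nat) i I : sorted ltn (i :: I) ->
  (forall j k, j \in i :: I -> k \in i :: I -> (j < k)%N -> (p j < k)%N) ->
  spread (map p (i :: I)) I.
Proof.
elim: I i => [//|k I IH] i /= /andP[ik sI] H; apply/orP; left.
rewrite ltnW /=; last by apply: H; rewrite ?inE ?eqxx ?orbT.
by apply: IH => // a b aI bI; apply: H; rewrite inE ?aI ?bI orbT.
Qed.

(* The points of G hitting the blocks lie to the right of the block indices but to the
   left of the next ones, so all these indices except the first form a spread of G. *)
Lemma hit_mass F z a (eta : R) (B : nat -> nat) G :
  fset_pos F -> (forall p, 0 <= z p) -> small_on z F a eta ->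
  (forall i j, i \in F -> j \in F -> (i < j)%N -> (B i < j)%N) ->
  fset_pos G -> inS a G ->
  \sum_(i <- F | has (fun p => i <= p <= B i)%N G) z i <= 2 * eta.
Proof.
move=> pF z0 nF BF pG aG; rewrite -big_filter; set I := [seq i <- F | _].
have pI : fset_pos I by exact: fset_pos_filter.
have IF : {subset I <= F} by move=> i; rewrite mem_filter => /andP[].
pose p i := head 0%N [seq p <- G | (i <= p <= B i)%N].
have pP i : i \in I -> [/\ p i \in G, (i <= p i)%N & (p i <= B i)%N].
  rewrite mem_filter has_filter => /andP[ne _].
  have : p i \in [seq p <- G | (i <= p <= B i)%N] by exact: fmin_mem.
  by rewrite mem_filter => /andP[/andP[]].
have eta0 : 0 <= eta.
  by apply: le_trans (nF [::] _ (inS_nil a)) => //; exact: mass_ge0.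
have spI : sorted ltn (map p I).
  have /andP[] := pI; elim: (I) (IF) pP => [//|i [//|j J] IH] IF' pP /= /andP[ij sJ] /andP[_ aJ].
  have iI : i \in [:: i, j & J] by rewrite mem_head.
  have jI : j \in [:: i, j & J] by rewrite inE mem_head orbT.
  have [_ _ pi] := pP _ iI; have [_ jp _] := pP _ jI.
  rewrite (leq_trans (leq_ltn_trans pi (BF _ _ (IF' _ iI) (IF' _ jI) ij)) jp) /=.
  by apply: IH => // k kJ; [apply: IF'|apply: pP]; rewrite inE kJ orbT.
have ppI : fset_pos (map p I).
  rewrite /fset_pos spI; apply/allP => _ /mapP[i /pP[piG _ _] ->].
  exact: fset_pos_gt0 pG piG.
have aI : inS a (map p I).
  apply: inS_subseq aG _ => //; apply: fset_pos_sub_subseq => // _ /mapP[i /pP[? _ _] ->] //.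
case: (I) pI IF pP ppI aI => [|i J] pI IF pP ppI aI.
  by rewrite big_nil mulr_ge0.
have [i0 pJ] : (0 < i)%N /\ fset_pos J by move: pI; rewrite fset_pos_cons => /and3P[].
rewrite big_cons mulrDl mul1r; apply: lerD.
  rewrite -[z i](big_seq1 +%R i) -(mass_sub z pF).
  - by apply: nF; [rewrite fset_pos_cons i0|exact: inS_single].
  - by rewrite fset_pos_cons i0.
  - by move=> q; rewrite inE => /eqP ->; apply: IF; rewrite mem_head.
have JF : {subset J <= F} by move=> q qJ; apply: IF; rewrite inE qJ orbT.
rewrite -(mass_sub z pF) //; apply: nF => //.
apply: inS_spread aI _ => //; apply: spread_behead; first by case/andP: pI.
by move=> j k jI kI jk; have [_ _ /leq_ltn_trans] := pP _ jI; apply; apply: BF => //; exact: IF.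
Qed.
End Averages.

(** * The norm *)

Section Norm.
Variables (R : realType) (theta : nat -> R) (beta : nat -> ord).
Hypothesis theta01 : forall n, (0 < n)%N -> 0 < theta n < 1.
Implicit Types (x y : nat -> R) (F E : seq nat) (Es : seq (seq nat)).

Local Notation norm_it := (tnorm_it theta beta).
Local Notation norm := (tnorm theta beta).

Definition supported F x := forall i, i \notin F -> x i = 0.

Lemma c00_supp x : c00 x -> exists F, fset_pos F /\ forall i, (i \in F) = (x i != 0).
Proof.
move=> [b xb]; exists [seq i <- iota 1 b | x i != 0]; split.
  apply: fset_pos_filter; rewrite /fset_pos iota_ltn_sorted /=.
  by apply/allP => i; rewrite mem_iota => /andP[].
move=> i; rewrite mem_filter; apply: andb_idr => xi; rewrite mem_iota.
apply/negPn/negP => H; move/eqP: xi; apply; apply: xb.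
by move: H; rewrite add1n ltnS negb_and -leqNgt -ltnNge leqn0.
Qed.

Lemma supported_c00 F x : fset_pos F -> supported F x -> c00 x.
Proof.
move=> pF xF; exists (fmax F) => i H; apply: xF; apply/negP => iF.
by case/orP: H => [/eqP i0|]; [have := fset_pos_gt0 pF iF; rewrite i0|rewrite ltnNge fmax_ge].
Qed.

Lemma c00_supported x : c00 x -> exists2 F, fset_pos F & supported F x.
Proof.
by move=> /c00_supp[F [pF FE]]; exists F => // i; rewrite FE negbK => /eqP.
Qed.

Lemma c00_le x y : (forall i, y i = 0 -> x i = 0) -> c00 y -> c00 x.
Proof. by move=> xy [b yb]; exists b => i /yb /xy. Qed.

Lemma c00_restr E x : c00 x -> c00 (restr E x).
Proof. by apply: c00_le => i; rewrite /restr; case: ifP. Qed.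

Lemma c000 : c00 (fun=> 0 : R).
Proof. by exists 0%N. Qed.

Lemma c00D x y : c00 x -> c00 y -> c00 (fun i => x i + y i).
Proof.
move=> [b xb] [c yc]; exists (maxn b c) => i H.
by rewrite xb ?yc ?addr0 //; move: H; rewrite gtn_max; case: (i == 0%N) => //= /andP[].
Qed.

Lemma c00Z a x : c00 x -> c00 (fun i => a * x i).
Proof. by apply: c00_le => i ->; rewrite mulr0. Qed.

Lemma c00B x y : c00 x -> c00 y -> c00 (fun i => x i - y i).
Proof.
move=> cx cy; have := c00D cx (c00Z (-1) cy); congr (c00 _).
by apply: funext => i; rewrite mulN1r.
Qed.

Lemma c00_sum (I : eqType) (s : seq I) (v : I -> nat -> R) :
  (forall i, i \in s -> c00 (v i)) -> c00 (fun p => \sum_(i <- s) v i p).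
Proof.
elim: s => [|i s IH] H.
  by have := c000; congr (c00 _); apply: funext => p; rewrite big_nil.
have := c00D (H i (mem_head _ _)) (IH (fun j js => H j (mem_behead (s := i :: s) js))).
by congr (c00 _); apply: funext => p; rewrite big_cons.
Qed.

Lemma restr0 E : restr E (fun=> 0 : R) = fun=> 0.
Proof. by apply: funext => i; rewrite /restr if_same. Qed.

Lemma restr_nil x : restr [::] x = fun=> 0.
Proof. by []. Qed.

Lemma restrD E x y : restr E (fun i => x i + y i) = fun i => restr E x i + restr E y i.
Proof. by apply: funext => i; rewrite /restr; case: ifP; rewrite ?addr0. Qed.

Lemma restrZ E a x : restr E (fun i => a * x i) = fun i => a * restr E x i.
Proof. by apply: funext => i; rewrite /restr; case: ifP; rewrite ?mulr0. Qed.

Lemma restr_sum (I : Type) E (s : seq I) (v : I -> nat -> R) :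
  restr E (fun p => \sum_(i <- s) v i p) = fun p => \sum_(i <- s) restr E (v i) p.
Proof.
apply: funext => p; rewrite /restr; case: ifP => // _; by rewrite big1.
Qed.

Lemma restr_id F x : supported F x -> restr F x = x.
Proof. by move=> Fx; apply: funext => i; rewrite /restr; case: ifPn => // /Fx. Qed.

Lemma restr_sub E F x : {subset E <= F} -> restr E (restr F x) = restr E x.
Proof. by move=> EF; apply: funext => i; rewrite /restr; case: ifP => // /EF ->. Qed.

Lemma restr_filter E F x :
  restr E (restr F x) = restr [seq i <- E | i \in F] x.
Proof. by apply: funext => i; rewrite /restr mem_filter andbC; case: (i \in E). Qed.

Lemma normr_restr E x i : `|restr E x i| <= `|x i|.
Proof. by rewrite /restr; case: ifP => //; rewrite normr0. Qed.

Lemma sum_mem_successive Es i (c : R) : successive Es -> 0 <= c ->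
  \sum_(E <- Es) (if i \in E then c else 0) <= c.
Proof.
move=> /successiveE[_ /fset_pos_uniq] + c0.
elim: Es => [|E Es IH] /=; first by rewrite big_nil.
rewrite cat_uniq big_cons => /and3P[_ /hasPn H /IH {}IH].
case: ifPn => iE; last by rewrite add0r.
rewrite big_seq big1 ?addr0 // => G GEs; case: ifP => // iG.
by have /negP := H i (introT flattenP (ex_intro2 _ _ G GEs iG)).
Qed.

Lemma l1_successive Es F x : successive Es ->
  \sum_(E <- Es) \sum_(i <- F) `|restr E x i| <= \sum_(i <- F) `|x i|.
Proof.
move=> sEs; rewrite exchange_big /=; apply: ler_sum => i _.
apply: le_trans (sum_mem_successive i sEs (normr_ge0 (x i))).
by apply: ler_sum => E _; rewrite /restr; case: ifP => //; rewrite normr0.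
Qed.

Lemma supported_restr F E x : supported F x -> supported F (restr E x).
Proof. by move=> xF i /xF xi; rewrite /restr xi if_same. Qed.

Lemma norm_le_l1 F x i : supported F x -> fset_pos F -> `|x i| <= \sum_(j <- F) `|x j|.
Proof.
move=> xF pF; have [iF|/xF ->] := boolP (i \in F); last by rewrite normr0 sumr_ge0.
by rewrite (big_rem i iF) /= lerDl sumr_ge0.
Qed.

Lemma supnorm_le x B : (forall i, `|x i| <= B) -> supnorm x <= B.
Proof.
move=> xB; apply: ge_sup; first by exists `|x 0%N|, 0%N.
by move=> _ [i _ <-].
Qed.

Lemma supnorm_ge x i : c00 x -> `|x i| <= supnorm x.
Proof.
move=> /c00_supported[F pF xF]; apply: ub_le_sup; last by exists i.
by exists (\sum_(j <- F) `|x j|) => _ [j _ <-]; exact: norm_le_l1.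
Qed.

Let itset k x := [set r | exists (n : nat) (Es : seq (seq nat)),
  (0 < n)%N /\ admissible (inS (beta n)) Es /\
  r = theta n * \sum_(E <- Es) norm_it k (restr E x)].

Lemma admissible_nil b : admissible (inS b) [::].
Proof. by split=> //; exact: inS_nil. Qed.

Lemma tnorm_it_ge0_le_l1 k F x : fset_pos F -> supported F x ->
  0 <= norm_it k x <= \sum_(i <- F) `|x i|.
Proof.
move=> pF; elim: k x => [|k IH] x xF /=.
  rewrite supnorm_le ?andbT => [|i]; last exact: norm_le_l1.
  by apply: le_trans (supnorm_ge 0%N _) => //; exact: supported_c00 xF.
apply/andP; split.
  rewrite le_max; apply/orP; left.
  by apply: le_trans (supnorm_ge 0%N _) => //; exact: supported_c00 xF.
rewrite ge_max supnorm_le => [|i]; last exact: norm_le_l1.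
apply: ge_sup; first by exists 0, 1%N, [::]; rewrite big_nil mulr0; split=> //; split=> //; exact: admissible_nil.
move=> _ [n [Es [n0 [[sEs _] ->]]]]; have /andP[t0 t1] := theta01 n0.
apply: le_trans (l1_successive F x sEs); rewrite -[leRHS]mul1r.
apply: ler_pM; [exact: ltW| |exact: ltW|].
  by apply: sumr_ge0 => E _; have /andP[] := IH _ (supported_restr E xF).
by apply: ler_sum => E _; have /andP[] := IH _ (supported_restr E xF).
Qed.

Lemma tnorm_it_ge0 k x : c00 x -> 0 <= norm_it k x.
Proof. by move=> /c00_supported[F pF /(tnorm_it_ge0_le_l1 k pF)/andP[]]. Qed.

Let itset_ub k x : c00 x -> has_ubound (itset k x).
Proof.
move=> /c00_supported[F pF xF]; exists (\sum_(i <- F) `|x i|).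
move=> _ [n [Es [n0 [[sEs _] ->]]]]; have /andP[t0 t1] := theta01 n0.
apply: le_trans (l1_successive F x sEs); rewrite -[leRHS]mul1r.
apply: ler_pM; [exact: ltW| |exact: ltW|].
  by apply: sumr_ge0 => E _; have /andP[] := tnorm_it_ge0_le_l1 k pF (supported_restr E xF).
by apply: ler_sum => E _; have /andP[] := tnorm_it_ge0_le_l1 k pF (supported_restr E xF).
Qed.

Lemma tnorm_it_sup k x i : c00 x -> `|x i| <= norm_it k x.
Proof.
move=> cx; case: k => [|k] /=; first exact: supnorm_ge.
by rewrite le_max supnorm_ge.
Qed.

Lemma tnorm_it_adm k x n Es : c00 x -> (0 < n)%N -> admissible (inS (beta n)) Es ->
  theta n * \sum_(E <- Es) norm_it k (restr E x) <= norm_it k.+1 x.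
Proof.
move=> cx n0 adm /=; rewrite le_max; apply/orP; right.
by apply: ub_le_sup; [exact: itset_ub|exists n, Es].
Qed.

Lemma tnorm_it_le k x B : (forall i, `|x i| <= B) ->
  (forall n Es, (0 < n)%N -> admissible (inS (beta n)) Es ->
     theta n * \sum_(E <- Es) norm_it k (restr E x) <= B) ->
  norm_it k.+1 x <= B.
Proof.
move=> sB aB /=; rewrite ge_max supnorm_le //=; apply: ge_sup.
  by exists 0, 1%N, [::]; rewrite big_nil mulr0; split=> //; split=> //; exact: admissible_nil.
by move=> _ [n [Es [n0 [adm ->]]]]; exact: aB.
Qed.

Lemma tnorm_itS k x : c00 x -> norm_it k x <= norm_it k.+1 x.
Proof.
elim: k x => [|k IH] x cx; first by rewrite /= le_max lexx.
apply: tnorm_it_le => [i|n Es n0 adm]; first exact: tnorm_it_sup.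
apply: le_trans (tnorm_it_adm k.+1 cx n0 adm); have /andP[t0 _] := theta01 n0.
by rewrite ler_pM2l //; apply: ler_sum => E _; apply: IH; exact: c00_restr.
Qed.

Lemma tnorm_it_homo k l x : c00 x -> (k <= l)%N -> norm_it k x <= norm_it l x.
Proof.
move=> cx; elim: l => [|l IH]; first by rewrite leqn0 => /eqP ->.
rewrite leq_eqVlt => /orP[/eqP -> //|/IH H].
by apply: le_trans H _; exact: tnorm_itS.
Qed.

Lemma tnorm_it_le_tnorm k x : c00 x -> norm_it k x <= norm x.
Proof.
move=> /c00_supported[F pF xF]; apply: ub_le_sup; last by exists k.
exists (\sum_(i <- F) `|x i|) => _ [l _ <-].
by have /andP[] := tnorm_it_ge0_le_l1 l pF xF.
Qed.

Lemma tnorm_le_it x B : (forall k, norm_it k x <= B) -> norm x <= B.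
Proof.
move=> H; apply: ge_sup; first by exists (norm_it 0 x), 0%N.
by move=> _ [k _ <-].
Qed.

Lemma tnorm_ge0 x : c00 x -> 0 <= norm x.
Proof.
by move=> cx; apply: le_trans (tnorm_it_le_tnorm 0 cx); exact: tnorm_it_ge0.
Qed.

Lemma tnorm_le_l1 F x : fset_pos F -> supported F x -> norm x <= \sum_(i <- F) `|x i|.
Proof.
by move=> pF xF; apply: tnorm_le_it => k; have /andP[] := tnorm_it_ge0_le_l1 k pF xF.
Qed.

Lemma tnorm0 : norm (fun=> 0) = 0.
Proof.
apply/eqP; rewrite eq_le tnorm_ge0 ?andbT; last exact: c000.
by have := @tnorm_le_l1 [::] (fun=> 0); rewrite big_nil; exact.
Qed.

Lemma tnorm_sup x i : c00 x -> `|x i| <= norm x.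
Proof.
by move=> cx; apply: le_trans (tnorm_it_le_tnorm 0 cx); exact: tnorm_it_sup.
Qed.

(** Suprema of increasing sequences commute with finite sums; this carries the inequalities for the
    iterates over to their limit. *)
Lemma sum_sup_le (T : Type) (s : seq T) (a : nat -> T -> R) (A : T -> R) B :
  (forall k l t, (k <= l)%N -> a k t <= a l t) ->
  (forall t C, (forall k, a k t <= C) -> A t <= C) ->
  (forall k, \sum_(t <- s) a k t <= B) -> \sum_(t <- s) A t <= B.
Proof.
move=> am aA; elim: s B => [|t s IH] B H.
  by have := H 0%N; rewrite !big_nil.
rewrite big_cons -lerBrDr; apply: aA => k; rewrite lerBrDr addrC -lerBrDr.
apply: IH => l; rewrite lerBrDr addrC.
have := H (maxn k l); rewrite big_cons; apply: le_trans.
apply: lerD; first by apply: am; exact: leq_maxl.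
by apply: ler_sum => u _; apply: am; exact: leq_maxr.
Qed.

Lemma tnorm_adm x n Es : c00 x -> (0 < n)%N -> admissible (inS (beta n)) Es ->
  theta n * \sum_(E <- Es) norm (restr E x) <= norm x.
Proof.
move=> cx n0 adm; have /andP[t0 _] := theta01 n0.
rewrite mulrC -ler_pdivlMr //; apply: (@sum_sup_le _ _ (fun k E => norm_it k (restr E x))).
- by move=> k l E kl; apply: tnorm_it_homo => //; exact: c00_restr.
- by move=> E C; exact: tnorm_le_it.
- move=> k; rewrite ler_pdivlMr // mulrC.
  by apply: le_trans (tnorm_it_adm k cx n0 adm) _; exact: tnorm_it_le_tnorm.
Qed.

(** With [tnorm_sup] and [tnorm_adm], this is the implicit equation of the norm. *)
Lemma tnorm_le x B : c00 x -> (forall i, `|x i| <= B) ->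
  (forall n Es, (0 < n)%N -> admissible (inS (beta n)) Es ->
     theta n * \sum_(E <- Es) norm (restr E x) <= B) ->
  norm x <= B.
Proof.
move=> cx sB aB; apply: tnorm_le_it => k.
apply: le_trans (tnorm_itS k cx) _; apply: tnorm_it_le => // n Es n0 adm.
have /andP[t0 _] := theta01 n0.
apply: le_trans (aB n Es n0 adm); rewrite ler_pM2l //.
by apply: ler_sum => E _; apply: tnorm_it_le_tnorm; exact: c00_restr.
Qed.

Lemma tnorm_it_mono k x y : c00 y -> (forall i, `|x i| <= `|y i|) ->
  norm_it k x <= norm_it k y.
Proof.
elim: k x y => [|k IH] x y cy xy.
  by apply: supnorm_le => i; apply: le_trans (xy i) _; exact: supnorm_ge.
apply: tnorm_it_le => [i|n Es n0 adm].
  by apply: le_trans (xy i) _; exact: tnorm_it_sup.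
apply: le_trans (tnorm_it_adm k cy n0 adm); have /andP[t0 _] := theta01 n0.
rewrite ler_pM2l //; apply: ler_sum => E _; apply: IH; first exact: c00_restr.
by move=> i; rewrite /restr; case: ifP.
Qed.

Lemma tnorm_mono x y : c00 y -> (forall i, `|x i| <= `|y i|) -> norm x <= norm y.
Proof.
move=> cy xy; apply: tnorm_le_it => k.
by apply: le_trans (tnorm_it_le_tnorm k cy); exact: tnorm_it_mono.
Qed.

Lemma tnorm_restr E x : c00 x -> norm (restr E x) <= norm x.
Proof. by move=> cx; apply: tnorm_mono => // i; exact: normr_restr. Qed.

Lemma tnorm_itD k x y : c00 x -> c00 y ->
  norm_it k (fun i => x i + y i) <= norm_it k x + norm_it k y.
Proof.
elim: k x y => [|k IH] x y cx cy.
  apply: supnorm_le => i; apply: le_trans (ler_normD _ _) _.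
  by apply: lerD; exact: supnorm_ge.
apply: tnorm_it_le => [i|n Es n0 adm].
  by apply: le_trans (ler_normD _ _) _; apply: lerD; exact: tnorm_it_sup.
apply: le_trans (lerD (tnorm_it_adm k cx n0 adm) (tnorm_it_adm k cy n0 adm)).
have /andP[t0 _] := theta01 n0.
rewrite -mulrDr -big_split ler_pM2l //; apply: ler_sum => E _; rewrite restrD.
by apply: IH; exact: c00_restr.
Qed.

Lemma tnormD x y : c00 x -> c00 y -> norm (fun i => x i + y i) <= norm x + norm y.
Proof.
move=> cx cy; apply: tnorm_le_it => k; apply: le_trans (tnorm_itD k cx cy) _.
by apply: lerD; exact: tnorm_it_le_tnorm.
Qed.

Lemma tnorm_itZ k a x : c00 x -> norm_it k (fun i => a * x i) <= `|a| * norm_it k x.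
Proof.
elim: k x => [|k IH] x cx.
  apply: supnorm_le => i; rewrite normrM; apply: ler_wpM2l => //; exact: supnorm_ge.
apply: tnorm_it_le => [i|n Es n0 adm].
  by rewrite normrM; apply: ler_wpM2l => //; exact: tnorm_it_sup.
apply: le_trans (ler_wpM2l (normr_ge0 a) (tnorm_it_adm k cx n0 adm)).
have /andP[t0 _] := theta01 n0.
rewrite mulrCA ler_pM2l // mulr_sumr; apply: ler_sum => E _; rewrite restrZ.
by apply: IH; exact: c00_restr.
Qed.

Lemma tnormZ_le a x : c00 x -> norm (fun i => a * x i) <= `|a| * norm x.
Proof.
move=> cx; apply: tnorm_le_it => k; apply: le_trans (tnorm_itZ k a cx) _.
by apply: ler_wpM2l => //; exact: tnorm_it_le_tnorm.
Qed.

Lemma tnormB x y : c00 x -> c00 y -> norm (fun i => x i - y i) <= norm x + norm y.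
Proof.
move=> cx cy; have -> : (fun i => x i - y i) = (fun i => x i + (-1) * y i).
  by apply: funext => i; rewrite mulN1r.
apply: le_trans (tnormD cx (c00Z _ cy)) _; rewrite lerD2l.
by have := tnormZ_le (-1) cy; rewrite normrN1 mul1r.
Qed.

Lemma tnorm_sum (I : eqType) (s : seq I) (v : I -> nat -> R) :
  (forall i, i \in s -> c00 (v i)) ->
  norm (fun p => \sum_(i <- s) v i p) <= \sum_(i <- s) norm (v i).
Proof.
elim: s => [|i s IH] H.
  rewrite (_ : (fun p => _) = fun=> 0) ?tnorm0 ?big_nil //.
  by apply: funext => p; rewrite big_nil.
have H' j : j \in s -> c00 (v j) by move=> js; apply: H; rewrite inE js orbT.
rewrite big_cons; have -> : (fun p => \sum_(j <- i :: s) v j p) =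
   (fun p => v i p + (fun p => \sum_(j <- s) v j p) p).
  by apply: funext => p; rewrite big_cons.
apply: le_trans (tnormD (H i (mem_head _ _)) (c00_sum H')) _.
by rewrite lerD2l; exact: IH.
Qed.

Lemma tnorm_lincomb (I : eqType) (s : seq I) (a : I -> R) (v : I -> nat -> R) :
  (forall i, i \in s -> c00 (v i)) ->
  norm (fun p => \sum_(i <- s) a i * v i p) <= \sum_(i <- s) `|a i| * norm (v i).
Proof.
move=> cv; apply: le_trans (tnorm_sum (v := fun i p => a i * v i p) _) _.
  by move=> i /cv; exact: c00Z.
by rewrite big_seq [leRHS]big_seq; apply: ler_sum => i /cv; exact: tnormZ_le.
Qed.

(** Shrinking moves minima to the right and drops those of emptied sets, so the new minima are a
    spread of the old ones. *)
Lemma admissible_shrink b Es (f : seq nat -> seq nat) : admissible (inS b) Es ->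
  (forall E, subseq (f E) E) ->
  admissible (inS b) [seq E <- map f Es | E != [::]].
Proof.
move=> [sEs bEs] fE.
have sEs' : successive [seq E <- map f Es | E != [::]].
  apply/successiveE; split; first exact: filter_all.
  rewrite flatten_filter_nonempty; case/successiveE: sEs => _; apply: fset_pos_subseq.
  by elim: (Es) => //= E Es' IH; exact: cat_subseq.
split=> //; apply: inS_spread bEs _; try exact: mins_fset_pos.
rewrite filter_map -map_comp; apply: spread_map; first exact: filter_subseq.
move=> E; rewrite mem_filter => /andP[/= nfE EEs].
apply: fmin_le; first exact: successive_fset_pos EEs.
by apply: mem_subseq (fE E) _ _; exact: fmin_mem.
Qed.

Lemma admissible_points (I : eqType) b (g : I -> seq nat) (s : seq I) (p : I -> nat) :
  admissible (inS b) (map g s) -> (forall i, i \in s -> p i \in g i) ->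
  fset_pos (map p s) /\ inS b (map p s).
Proof.
move=> [sEs bEs] pE.
have pp : fset_pos (map p s).
  have /successiveE[_] := sEs; apply: fset_pos_subseq.
  elim: s pE {sEs bEs} => //= i s IH pE; rewrite -cat1s; apply: cat_subseq.
    by rewrite sub1seq; apply: pE; rewrite mem_head.
  by apply: IH => j js; apply: pE; rewrite inE js orbT.
split=> //; apply: inS_spread bEs _ => //; first exact: mins_fset_pos.
rewrite -map_comp; apply: spread_map => // i si; apply: fmin_le; last exact: pE.
by apply: successive_fset_pos sEs _; exact: map_f.
Qed.

Lemma sum_shrink (h : (nat -> R) -> R) Es x : h (fun=> 0) = 0 ->
  \sum_(E <- [seq E <- Es | E != [::]]) h (restr E x) = \sum_(E <- Es) h (restr E x).
Proof.
move=> h0; rewrite big_filter big_mkcond; apply: eq_bigr => E _.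
by case: eqP => // ->; rewrite restr_nil h0.
Qed.

(** Iterates the implicit equation along the branch [s]: [osum_cons] and [inS_add] peel off the
    label at the root, and each group below it is treated by induction. *)
Lemma tnorm_osum s Es x : all (fun n => 0 < n)%N s -> admissible (inS (osum beta s)) Es ->
  c00 x ->
  \prod_(n <- s) theta n * \sum_(E <- Es) norm (restr E x) <= norm (restr (flatten Es) x).
Proof.
elim: s Es x => [|n s IH] Es x.
  move=> _ [sEs /=] E1 cx; rewrite big_nil mul1r.
  case: Es E1 {sEs} => [|E [|]] //= _; first by rewrite big_nil tnorm_ge0 //; exact: c00_restr.
  by rewrite big_seq1 cats0.
move=> /andP[n0 s0] [sEs bEs] cx; have /andP[t0 _] := theta01 n0.
move: bEs; rewrite osum_cons inS_add; last exact: mins_fset_pos.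
move=> /(admissible_group sEs)[Ess [EE bE sE]].
rewrite EE big_flatten big_cons /= -mulrA.
have cf : c00 (restr (flatten (flatten Ess)) x) by exact: c00_restr.
apply: le_trans (tnorm_adm cf n0 bE); rewrite ler_pM2l // mulr_sumr big_map.
rewrite big_seq [leRHS]big_seq; apply: ler_sum => Es' Es'E.
rewrite restr_sub; first exact: IH (sE _ Es'E) cx.
move=> p pE; rewrite -flatten_map_flatten; apply/flattenP.
by exists (flatten Es') => //; exact: map_f.
Qed.

Lemma prod_theta_gt0 s : all (fun n => 0 < n)%N s -> 0 < \prod_(n <- s) theta n.
Proof.
by move=> /allP s0; rewrite big_seq; apply: prodr_gt0 => n /s0 /theta01 /andP[].
Qed.

End Norm.

(** * Failure of the dagger condition *)

Section Splitting.
Variables (R : realType) (theta : nat -> R) (beta : nat -> ord).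
Hypothesis theta01 : forall n, (0 < n)%N -> 0 < theta n < 1.
Hypothesis theta_noninc : forall n, (0 < n)%N -> theta n.+1 <= theta n.
Implicit Types (v : nat -> R) (F E : seq nat) (Es : seq (seq nat)) (h : (nat -> R) -> R).

Local Notation norm := (tnorm theta beta).

Lemma theta_le1 n : (0 < n)%N -> theta n <= theta 1%N.
Proof.
elim: n => // -[_ _|n IH _]; first exact: lexx.
exact: le_trans (theta_noninc _) (IH _).
Qed.

Lemma wl1_successive (w : nat -> R) Es F v : successive Es -> (forall i, 0 <= w i) ->
  \sum_(E <- Es) \sum_(i <- F) w i * `|restr E v i| <= \sum_(i <- F) w i * `|v i|.
Proof.
move=> sEs w0; rewrite exchange_big /=; apply: ler_sum => i _.
rewrite -mulr_sumr ler_wpM2l //.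
apply: le_trans (sum_mem_successive i sEs (normr_ge0 (v i))).
by apply: ler_sum => E _; rewrite /restr; case: ifP => //; rewrite normr0.
Qed.

(** Common interface of the two functionals that get split: the norm carries the main term and the
    sup norm the error. *)
Definition l1_bounded h :=
  forall F v, fset_pos F -> supported F v -> 0 <= h v <= \sum_(i <- F) `|v i|.

Lemma tnorm_l1_bounded : l1_bounded norm.
Proof.
move=> F v pF vF; rewrite (tnorm_le_l1 _ theta01) ?andbT//.
by apply: tnorm_ge0 => //; exact: supported_c00 vF.
Qed.

Lemma supnorm_l1_bounded : l1_bounded (@supnorm R).
Proof. exact: (tnorm_it_ge0_le_l1 beta theta01 0). Qed.

Lemma l1_bounded0 h : l1_bounded h -> h (fun=> 0) = 0.
Proof.
move=> H; have := H [::] (fun=> 0) isT (fun _ _ => erefl).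
by rewrite big_nil => /andP[h0 h0']; apply/eqP; rewrite eq_le h0 h0'.
Qed.

Definition split_norm h b v : R :=
  sup [set r | exists2 Es, admissible (inS b) Es & r = \sum_(E <- Es) h (restr E v)].

Lemma split_norm_le h b v B :
  (forall Es, admissible (inS b) Es -> \sum_(E <- Es) h (restr E v) <= B) ->
  split_norm h b v <= B.
Proof.
move=> H; apply: ge_sup.
  by exists 0, [::]; [exact: admissible_nil|rewrite big_nil].
by move=> _ [Es /H + ->].
Qed.

Lemma split_norm_ge h b v Es : l1_bounded h -> c00 v -> admissible (inS b) Es ->
  \sum_(E <- Es) h (restr E v) <= split_norm h b v.
Proof.
move=> hl /c00_supported[F pF vF] adm; apply: ub_le_sup; last by exists Es.
exists (\sum_(i <- F) `|v i|) => _ [Ds [sDs _] ->].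
apply: le_trans (l1_successive F v sDs); apply: ler_sum => E _.
by have /andP[] := hl F (restr E v) pF (supported_restr E vF).
Qed.

Lemma split_norm_ge0 h b v : l1_bounded h -> c00 v -> 0 <= split_norm h b v.
Proof.
by move=> hl cv; have := split_norm_ge hl cv (admissible_nil b); rewrite big_nil.
Qed.

Lemma split_norm_self h b v : l1_bounded h -> c00 v -> h v <= split_norm h b v.
Proof.
move=> hl cv; have [F pF vF] := c00_supported cv.
case: (eqVneq F [::]) => [F0|nF].
  have /andP[_] := hl F v pF vF; rewrite F0 big_nil => /le_trans; apply.
  exact: split_norm_ge0.
have := @split_norm_ge h b v [:: F] hl cv; rewrite big_seq1 restr_id //; apply.
split; first by apply/successiveE; rewrite /= cats0 nF pF.
by apply: inS_single; apply: fset_pos_gt0 pF _; exact: fmin_mem.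
Qed.

(** Nearly optimal splittings inside the members of an outer family combine into one splitting for
    the product family, which [inS_add] identifies. *)
Lemma split_norm_sum h b c v Es : l1_bounded h -> c00 v -> admissible (inS c) Es ->
  \sum_(E <- Es) split_norm h b (restr E v) <= split_norm h (oadd b c) v.
Proof.
move=> hl cv adm; apply/ler_addgt0Pr => e e0.
pose d := e / (size Es).+1%:R.
have d0 : 0 < d by exact: divr_gt0.
have /choice[D DP] : forall E, exists Ds, admissible (inS b) Ds /\
    split_norm h b (restr E v) <= \sum_(G <- Ds) h (restr G (restr E v)) + d.
  move=> E; apply: contrapT => /forallNP H.
  have : split_norm h b (restr E v) <= split_norm h b (restr E v) - d.
    apply: split_norm_le => Ds aDs; have /not_andP[//|/negP] := H Ds.
    by rewrite -ltNge -ltrBrDr => /ltW.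
  by rewrite lerBrDr gerDl leNgt d0.
(* The pieces chosen for [E] may stick out of [E]; cutting them changes no restriction of
   [restr E v] and makes the combined family successive. *)
pose cut E := [seq [seq p <- G | p \in E] | G <- D E].
pose D' E := [seq G <- cut E | G != [::]].
have D'P E : admissible (inS b) (D' E).
  by apply: admissible_shrink (DP E).1 _ => G; exact: filter_subseq.
have sumD' E : \sum_(G <- D E) h (restr G (restr E v)) = \sum_(G <- D' E) h (restr G v).
  rewrite sum_shrink; last exact: l1_bounded0.
  by rewrite big_map; apply: eq_bigr => G _; rewrite restr_filter.
pose Ess := [seq Ds <- [seq D' E | E <- Es] | flatten Ds != [::]].
pose f E := [seq p <- E | p \in flatten (D' E)].
have fE E : E \in Es -> f E = flatten (D' E).
  move=> EEs; apply: fset_pos_filter_mem; first exact: successive_fset_pos adm.1 EEs.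
    by case: (D'P E) => /successiveE[].
  move=> p; rewrite flatten_filter_nonempty => /flattenP[_ /mapP[G _ ->]].
  by rewrite mem_filter => /andP[].
have aE : admissible (sprod (inS c) (inS b)) (flatten Ess).
  apply: admissible_ungroup; last first.
    by move=> Ds; rewrite mem_filter => /andP[_ /mapP[E _ ->]].
  have := admissible_shrink adm (fun E => filter_subseq (fun p => p \in flatten (D' E)) E).
  congr admissible; rewrite -[X in X = _]/([seq E <- [seq f E | E <- Es] | E != [::]]).
  rewrite [Ess]filter_map -!map_comp [LHS]filter_map.
  have -> : [seq E <- Es | preim f (fun E => E != [::]) E] =
            [seq E <- Es | preim D' (fun Ds => flatten Ds != [::]) E].
    by apply: eq_in_filter => E EEs /=; rewrite fE.
  by apply/eq_in_map => E; rewrite mem_filter => /andP[_ EEs] /=; exact: fE.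
have aE' : admissible (inS (oadd b c)) (flatten Ess).
  by case: aE => sE cE; split=> //; apply/inS_add => //; exact: mins_fset_pos.
apply: (@le_trans _ _ (\sum_(E <- Es) (\sum_(G <- D' E) h (restr G v) + d))).
  by apply: ler_sum => E _; rewrite -sumD'; exact: (DP E).2.
rewrite big_split /=; apply: lerD; last first.
  rewrite big_const_seq iter_addr_0 count_predT -[leLHS]mulr_natr /d mulrAC.
  by rewrite ler_pdivrMr // ler_pM2l // ler_nat.
apply: le_trans (split_norm_ge hl cv aE').
rewrite big_flatten /= big_filter big_map [leRHS]big_mkcond /=; apply: ler_sum => E _.
case: ifPn => // /negPn/eqP D0.
have -> : D' E = [::]; last by rewrite big_nil.
have := filter_all (fun E : seq nat => E != [::]) (cut E); rewrite -/(D' E).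
by case: (D' E) D0 => [|[|]].
Qed.

(* The inclusion in [schreier_sub] is only available beyond some l, which depends on m.
   Below l, theta m is dominated by the weights 2^-p; l itself is one coordinate. *)
Lemma step_bound eps s F (S0 : set nat) v B :
  fset_pos F -> (forall p, p \in F -> S0 p) -> supported F v ->
  (forall m, (0 < m)%N -> exists l g, [/\ is_gamma theta beta eps m g,
     forall p, S0 p -> (p < l)%N -> theta m <= 2^-1 ^+ p
   & schreier_sub (S0 `&` [set p | (l < p)%N]) (beta m) (oadd g s)]) ->
  (forall Es, admissible (inS s) Es -> theta 1%N * \sum_(E <- Es) norm (restr E v) <= B) ->
  (forall Es, admissible (inS s) Es -> eps * \sum_(E <- Es) norm (restr E v) <= B) ->
  norm v <= supnorm v + \sum_(i <- F) 2^-1 ^+ i * `|v i| + B.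
Proof.
move=> pF FS vF H H1 He.
have cv := supported_c00 pF vF.
have B0 : 0 <= B by have := H1 [::] (admissible_nil s); rewrite big_nil mulr0.
have w0 i : 0 <= 2^-1 ^+ i :> R by rewrite exprn_ge0 // invr_ge0.
have tau0 : 0 <= \sum_(i <- F) 2^-1 ^+ i * `|v i|.
  by apply: sumr_ge0 => i _; rewrite mulr_ge0.
apply: tnorm_le => // [i|m Es m0 adm].
  by apply: le_trans (supnorm_ge i cv) _; rewrite -addrA lerDl addr_ge0.
have [l [g [gg small sub]]] := H m m0.
have /andP[t0 t1] := theta01 m0.
(* Coordinates up to [l] go to an l1 estimate. The remaining sets are also cut to [F], so that their
   minima lie in [S0], where the inclusion is known. *)
pose f E := [seq i <- E | (l < i)%N && (i \in F)].
pose Es2 := [seq E <- map f Es | E != [::]].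
have aEs2 : admissible (inS (beta m)) Es2.
  by apply: admissible_shrink adm _ => E; exact: filter_subseq.
have inEs2 E p : E \in Es2 -> p \in E -> (l < p)%N && (p \in F).
  by rewrite mem_filter => /andP[_ /mapP[G _ ->]]; rewrite mem_filter => /andP[].
have aEs3 : inS (oadd g s) (map fmin Es2).
  apply: sub; [exact: mins_fset_pos aEs2.1| |exact: aEs2.2].
  move=> _ /mapP[E EE ->].
  have /(inEs2 _ _ EE)/andP[lE EF] := fmin_mem (successive_nonempty aEs2.1 EE).
  by split=> //; exact: FS.
have part2 : theta m * \sum_(E <- Es) norm (restr (f E) v) <= B.
  rewrite -(big_map f xpredT (fun E => norm (restr E v))) /=.
  rewrite -sum_shrink; last exact: tnorm0.
  (* If no branch has weight above [theta m / eps], then g = 0, the family itself is admissible for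
     [s], and [theta m <= theta 1] suffices. Otherwise a branch [t] realizing g bounds the norm on
     each group from below, with weight above [theta m / eps]. *)
  rewrite -/Es2; case: gg => [[_ g0]|[[t [[_ [tpos tm]] gE]] _]].
    apply: le_trans (H1 Es2 _); last by split; [exact: aEs2.1|rewrite g0 oadd0l in aEs3].
    rewrite ler_wpM2r ?theta_le1 //; apply: sumr_ge0 => E _.
    by apply: tnorm_ge0 => //; exact: c00_restr.
  have /inS_add : inS (oadd g s) (map fmin Es2) by [].
  move=> /(_ (mins_fset_pos aEs2.1))/(admissible_group aEs2.1)[Ess [EE aEss sE]].
  apply: le_trans (He _ aEss); rewrite EE big_flatten /= big_map !mulr_sumr.
  rewrite big_seq [leRHS]big_seq; apply: ler_sum => Es' Es'E.
  have aEs' : admissible (inS (osum beta t)) Es' by rewrite -gE; exact: sE.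
  have osm := tnorm_osum theta01 tpos aEs' cv.
  have P0 := prod_theta_gt0 theta01 tpos.
  have S0' : 0 <= \sum_(E <- Es') norm (restr E v).
    by apply: sumr_ge0 => E _; apply: tnorm_ge0 => //; exact: c00_restr.
  have eps0 : 0 <= eps.
    by rewrite -(pmulr_lge0 _ P0) ltW // (lt_trans t0).
  apply: le_trans (ler_wpM2l eps0 osm); rewrite mulrA.
  by apply: ler_wpM2r => //; exact: ltW.
have split E : norm (restr E v) <=
    \sum_(i <- F | (i <= l)%N) `|restr E v i| + norm (restr (f E) v).
  pose lo : nat -> R := fun i => if (i <= l)%N then restr E v i else 0.
  have loF : supported F lo.
    by move=> i iF; rewrite /lo; case: ifP => // _; rewrite (supported_restr E vF).
  have vE : restr E v = fun i => lo i + restr (f E) v i.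
    apply: funext => i; rewrite /lo /restr mem_filter ltnNge.
    case: (i <= l)%N; rewrite ?addr0 //= add0r andbC; case: (i \in E) => //=.
    by case: ifPn => // /vF.
  rewrite [X in norm X <= _]vE.
  apply: le_trans (tnormD _ theta01 (supported_c00 pF loF) (c00_restr _ cv)) _.
  rewrite lerD2r; apply: le_trans (tnorm_le_l1 beta theta01 pF loF) _.
  rewrite [leRHS]big_mkcond; apply: ler_sum => i _; rewrite /lo.
  by case: (i <= l)%N => //; rewrite normr0.
have part1 : theta m * \sum_(E <- Es) \sum_(i <- F | (i <= l)%N) `|restr E v i| <=
    supnorm v + \sum_(i <- F) 2^-1 ^+ i * `|v i|.
  apply: (@le_trans _ _ (\sum_(i <- F | (i <= l)%N) theta m * `|v i|)).
    rewrite mulr_sumr -mulr_sumr exchange_big /= mulr_sumr; apply: ler_sum => i _.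
    rewrite ler_pM2l //; apply: le_trans (sum_mem_successive i adm.1 (normr_ge0 (v i))).
    by apply: ler_sum => E _; rewrite /restr; case: ifP => //; rewrite normr0.
  apply: (@le_trans _ _ (\sum_(i <- F) ((if i == l then `|v i| else 0) + 2^-1 ^+ i * `|v i|))).
    rewrite big_mkcond big_seq [leRHS]big_seq; apply: ler_sum => i iF; case: ifP => [|_].
      rewrite leq_eqVlt => /orP[/eqP il|il].
        rewrite il eqxx; apply: (@le_trans _ _ `|v l|); last by rewrite lerDl mulr_ge0.
        by rewrite ler_piMl // ltW.
      by rewrite (ltn_eqF il) add0r ler_wpM2r //; apply: small => //; exact: FS.
    by rewrite addr_ge0 ?mulr_ge0 //; case: ifP.
  rewrite big_split /= lerD2r -big_mkcond /= -big_filter.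
  have sv : 0 <= supnorm v by apply: le_trans (supnorm_ge 0%N cv).
  have [lF|lF] := boolP (l \in F).
    have -> : [seq i <- F | i == l] = [:: l].
      by rewrite (filter_pred1_uniq (fset_pos_uniq pF)).
    by rewrite big_seq1; exact: supnorm_ge.
  rewrite big_filter big_seq_cond big1 // => i /andP[iF /eqP il].
  by rewrite -il iF in lF.
apply: le_trans (lerD part1 part2); rewrite -mulrDr ler_pM2l // -big_split.
by apply: ler_sum => E _; exact: split.
Qed.

(** A step either gains the factor [theta 1] and is repeated on the pieces, or gains [eps] and
    stops. The error terms, summed over an admissible family, are bounded by those of the whole
    vector at the next complexity, so each step adds them once. *)
Lemma iterate_step eps s F (S0 : set nat) : 0 < eps ->
  fset_pos F -> (forall p, p \in F -> S0 p) ->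
  (forall m, (0 < m)%N -> exists l g, [/\ is_gamma theta beta eps m g,
     forall p, S0 p -> (p < l)%N -> theta m <= 2^-1 ^+ p
   & schreier_sub (S0 `&` [set p | (l < p)%N]) (beta m) (oadd g s)]) ->
  forall r v, supported F v ->
  norm v <= Num.max eps (theta 1%N ^+ r) * split_norm norm (omul s (ofin r)) v +
     r%:R * (split_norm (@supnorm R) (omul s (ofin r)) v + \sum_(i <- F) 2^-1 ^+ i * `|v i|).
Proof.
move=> eps0 pF FS H; have /andP[t0 t1] := theta01 (ltn0Sn 0).
have hn := tnorm_l1_bounded; have hs := supnorm_l1_bounded.
elim=> [|r IH] v vF.
  rewrite mul0r addr0 expr0; apply: le_trans (split_norm_self (omul s (ofin 0)) hn (supported_c00 pF vF)) _.
  rewrite ler_peMl // ?le_max ?lexx ?orbT //.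
  by apply: split_norm_ge0 => //; exact: supported_c00 vF.
have cv := supported_c00 pF vF.
have w0 i : 0 <= 2^-1 ^+ i :> R by rewrite exprn_ge0 // invr_ge0.
pose tau (u : nat -> R) : R := \sum_(i <- F) 2^-1 ^+ i * `|u i|.
have tau0 : 0 <= tau v by apply: sumr_ge0 => i _; rewrite mulr_ge0.
set b := omul s (ofin r); have bE : omul s (ofin r.+1) = oadd b s by [].
rewrite bE; set A := split_norm norm _ v; set Ao := split_norm (@supnorm R) _ v.
have A0 : 0 <= A by exact: split_norm_ge0.
have Ao0 : 0 <= Ao by exact: split_norm_ge0.
set c := Num.max eps (theta 1%N ^+ r.+1).
have epsc : eps <= c by rewrite le_max lexx.
have c0 : 0 <= c by rewrite (le_trans (ltW eps0)).
have thc : theta 1%N * Num.max eps (theta 1%N ^+ r) <= c.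
  rewrite maxr_pMr ?(ltW t0)// -exprS ge_max; apply/andP; split; last by rewrite le_max lexx orbT.
  by apply: le_trans epsc; rewrite ler_piMl // ltW.
have := @step_bound eps s F S0 v (c * A + r%:R * (Ao + tau v)) pF FS vF H.
have svA : supnorm v <= Ao by exact: split_norm_self.
move=> /(_ _ _)/le_trans; apply.
- move=> Es adm; apply: (@le_trans _ _ (theta 1%N * \sum_(E <- Es)
      (Num.max eps (theta 1%N ^+ r) * split_norm norm b (restr E v) +
       r%:R * (split_norm (@supnorm R) b (restr E v) + tau (restr E v))))).
    rewrite ler_pM2l //; apply: ler_sum => E _; apply: IH; exact: supported_restr.
  rewrite big_split /= -!mulr_sumr mulrDr mulrA; apply: lerD.
    apply: ler_pM => //.
    + by rewrite mulr_ge0 ?le_max ?(ltW t0) ?(ltW eps0).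
    + by apply: sumr_ge0 => E _; apply: split_norm_ge0 => //; exact: c00_restr.
    + exact: split_norm_sum.
  rewrite mulrA [X in X * _]mulrC -mulrA; apply: ler_wpM2l => //.
  rewrite big_split /=.
  apply: (@le_trans _ _ (\sum_(E <- Es) split_norm (@supnorm R) b (restr E v) +
     \sum_(E <- Es) tau (restr E v))).
    rewrite ler_piMl ?(ltW t1) // addr_ge0 //; apply: sumr_ge0 => E _.
      by apply: split_norm_ge0 => //; exact: c00_restr.
    by apply: sumr_ge0 => i _; rewrite mulr_ge0.
  apply: lerD; first exact: split_norm_sum.
  exact: wl1_successive adm.1 _.
- move=> Es adm.
  have SA : \sum_(E <- Es) norm (restr E v) <= A.
    apply: le_trans (split_norm_sum b hn cv adm).
    by apply: ler_sum => E _; apply: split_norm_self => //; exact: c00_restr.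
  have S0' : 0 <= \sum_(E <- Es) norm (restr E v).
    by apply: sumr_ge0 => E _; apply: tnorm_ge0 => //; exact: c00_restr.
  apply: (@le_trans _ _ (c * A)); last by rewrite lerDl mulr_ge0 // addr_ge0.
  by apply: ler_pM => //; exact: ltW.
- rewrite -/(tau v) -natr1; lra.
Qed.
End Splitting.

(** * The completion and approximation by finitely supported vectors *)

Section Completion.
Variables (R : realType) (theta : nat -> R) (beta : nat -> ord).
Hypothesis theta01 : forall n, (0 < n)%N -> 0 < theta n < 1.
Local Notation norm := (tnorm theta beta).
Local Notation inX := (Xelt theta beta).

Lemma tnorm_sub_sym (x y : nat -> R) : c00 x -> c00 y ->
  norm (fun i => y i - x i) = norm (fun i => x i - y i).
Proof.
move=> cx cy; apply/eqP; rewrite eq_le.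
by apply/andP; split; apply: tnorm_mono => // [|i]; rewrite ?[`|_ - y _|]distrC //;
  exact: c00B.
Qed.

Lemma Xelt0 : inX (fun _ _ => 0).
Proof.
split=> [k|e e0]; first exact: c000.
by exists 0%N => k l _ _; rewrite subrr tnorm0.
Qed.

Lemma XeltD u v : inX u -> inX v -> inX (fun k i => u k i + v k i).
Proof.
move=> [cu hu] [cv hv]; split=> [k|e e0]; first exact: c00D.
have e20 : 0 < e / 2 by exact: divr_gt0.
have [K uK] := hu _ e20; have [L vL] := hv _ e20.
exists (maxn K L) => k l; rewrite !geq_max => /andP[Kk Lk] /andP[Kl Ll].
have -> : (fun i => u k i + v k i - (u l i + v l i)) =
          (fun i => (fun i => u k i - u l i) i + (fun i => v k i - v l i) i).
  by apply: funext => i; rewrite opprD addrACA.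
apply: le_lt_trans (tnormD _ theta01 (c00B _ _) (c00B _ _)) _ => //.
by rewrite [ltRHS]splitr ltrD ?uK ?vL.
Qed.

Lemma XeltZ a u : inX u -> inX (fun k i => a * u k i).
Proof.
move=> [cu hu]; split=> [k|e e0]; first exact: c00Z.
have a1 : 0 < `|a| + 1 by rewrite ltr_wpDl.
have [K uK] := hu _ (divr_gt0 e0 a1).
exists K => k l Kk Kl.
have -> : (fun i => a * u k i - a * u l i) = (fun i => a * (fun i => u k i - u l i) i).
  by apply: funext => i; rewrite mulrBr.
apply: le_lt_trans (tnormZ_le _ theta01 _ (c00B _ _)) _ => //.
have := uK k l Kk Kl; rewrite ltr_pdivlMr // mulrC; apply: le_lt_trans.
by rewrite ler_wpM2r ?lerDl // tnorm_ge0 //; exact: c00B.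
Qed.

Lemma Xelt_lincomb (F : seq nat) (a : nat -> R) x : (forall n, n \in F -> inX (x n)) ->
  inX (fun k i => \sum_(n <- F) a n * x n k i).
Proof.
elim: F => [|n F IH] H.
  have := Xelt0; congr (inX _); apply: funext => k; apply: funext => i.
  by rewrite big_nil.
have := XeltD (XeltZ (a n) (H n (mem_head _ _)))
  (IH (fun m mF => H m (mem_behead (s := n :: F) mF))).
congr (inX _); apply: funext => k; apply: funext => i.
by rewrite big_cons.
Qed.

Lemma Xelt_cvg u : inX u -> cvgn (fun k => norm (u k)).
Proof.
move=> [cu hu]; apply/cauchy_cvgP; apply: cauchy_exP => e e0.
have [K uK] := hu _ e0; exists (norm (u K)); exists K => // k /= Kk.
have h m l : norm (u m) <= norm (u l) + norm (fun i => u m i - u l i).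
  have {1}-> : u m = (fun i => u l i + (fun i => u m i - u l i) i).
    by apply: funext => i; rewrite addrC subrK.
  by apply: tnormD => //; exact: c00B.
have h1 := h k K; have h2 := h K k.
have e1 := uK K k (leqnn K) Kk; have e2 := uK k K Kk (leqnn K).
rewrite /ball /= ltr_norml; apply/andP; split; lra.
Qed.

Lemma Xnorm_le u B K : inX u -> (forall k, (K <= k)%N -> norm (u k) <= B) ->
  Xnorm theta beta u <= B.
Proof.
move=> /Xelt_cvg cu H; apply: limr_le => //; near=> k.
by apply: H; near: k; exact: nbhs_infty_ge.
Unshelve. all: by end_near.
Qed.

Lemma Xnorm_ge u B K : inX u -> (forall k, (K <= k)%N -> B <= norm (u k)) ->
  B <= Xnorm theta beta u.
Proof.
move=> /Xelt_cvg cu H; apply: limr_ge => //; near=> k.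
by apply: H; near: k; exact: nbhs_infty_ge.
Unshelve. all: by end_near.
Qed.

Lemma Xnorm_cst x : Xnorm theta beta (fun=> x) = norm x.
Proof. by rewrite /Xnorm lim_cst. Qed.

Lemma Xelt_cst x : c00 x -> inX (fun=> x).
Proof.
move=> cx; split=> // e e0; exists 0%N => k l _ _.
rewrite (_ : (fun i => _) = fun=> 0) ?tnorm0 //.
by apply: funext => i; rewrite subrr.
Qed.

Lemma eventually_all (F : seq nat) (Q : nat -> nat -> Prop) :
  (forall n, n \in F -> exists K, forall k, (K <= k)%N -> Q n k) ->
  exists K, forall k, (K <= k)%N -> forall n, n \in F -> Q n k.
Proof.
elim: F => [|n F IH] H; first by exists 0%N.
have [m mF|K HK] := IH; first by apply: H; rewrite inE mF orbT.
have [L HL] := H n (mem_head _ _); exists (maxn K L) => k.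
rewrite geq_max => /andP[Kk Lk] m; rewrite inE => /orP[/eqP ->|mF]; first exact: HL.
exact: HK.
Qed.

Lemma Xnorm_lincomb_approx (F : seq nat) (a : nat -> R) x (y : nat -> nat -> R) (d : R) :
  (forall n, n \in F -> inX (x n)) -> (forall n, n \in F -> c00 (y n)) ->
  (forall n, n \in F -> exists K, forall k, (K <= k)%N -> norm (fun i => x n k i - y n i) <= d) ->
  Xnorm theta beta (fun k i => \sum_(n <- F) a n * x n k i) <=
  norm (fun i => \sum_(n <- F) a n * y n i) + d * \sum_(n <- F) `|a n|.
Proof.
move=> Xx cy /eventually_all[K HK]; apply: (Xnorm_le (K := K)); first exact: Xelt_lincomb.
move=> k Kk.
have cx n : n \in F -> c00 (x n k) by move=> /Xx[].
have -> : (fun i => \sum_(n <- F) a n * x n k i) = (fun i =>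
   (fun i => \sum_(n <- F) a n * y n i) i + (fun i => \sum_(n <- F) a n * (fun i => x n k i - y n i) i) i).
  apply: funext => i; rewrite -big_split /=; apply: eq_bigr => n _.
  by rewrite -mulrDr addrC subrK.
have cxy n : n \in F -> c00 (fun i => x n k i - y n i) by move=> nF; apply: c00B; [exact: cx|exact: cy].
have cy' : c00 (fun i => \sum_(n <- F) a n * y n i).
  by apply: (c00_sum (v := fun n i => a n * y n i)) => n /cy; exact: c00Z.
have cxy' : c00 (fun i => \sum_(n <- F) a n * (x n k i - y n i)).
  by apply: (c00_sum (v := fun n i => a n * (x n k i - y n i))) => n /cxy; exact: c00Z.
apply: le_trans (tnormD _ theta01 cy' cxy') _; rewrite lerD2l.
apply: le_trans (tnorm_lincomb _ theta01 _ cxy) _.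
rewrite mulr_sumr big_seq [leRHS]big_seq; apply: ler_sum => n nF.
by rewrite mulrC ler_wpM2r //; exact: HK.
Qed.

End Completion.

(** * Branches of large weight *)

Section Labels.
Variables (R : realType) (theta : nat -> R) (beta : nat -> ord).
Hypothesis theta01 : forall n, (0 < n)%N -> 0 < theta n < 1.
Hypothesis theta_noninc : forall n, (0 < n)%N -> theta n.+1 <= theta n.
Hypothesis theta_to0 : theta @ \oo --> (0 : R).

Lemma theta_small (e : R) : 0 < e -> exists N, forall n, (N <= n)%N -> (0 < n)%N -> theta n < e.
Proof.
move=> e0; have /cvgrPdist_lt/(_ e e0)[N _ HN] := theta_to0.
exists N => n Nn n0; have := HN n Nn; rewrite /= sub0r normrN.
by apply: le_lt_trans; exact: ler_norm.
Qed.

Lemma theta_exp_small (e : R) : 0 < e -> exists r, theta 1%N ^+ r < e.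
Proof.
move=> e0; have /andP[t0 t1] := theta01 (ltn0Sn 0).
have : theta 1%N ^+ n @[n --> \oo] --> (0 : R) by apply: cvg_expr; rewrite gtr0_norm.
move=> /cvgrPdist_lt/(_ e e0)[N _ /(_ N (leqnn N))].
by rewrite sub0r normrN => H; exists N; apply: le_lt_trans H; exact: ler_norm.
Qed.

Fixpoint words (N r : nat) : seq (seq nat) :=
  if r is r'.+1 then words N r' ++ [seq n :: s | n <- iota 0 N, s <- words N r'] else [:: [::]].

Lemma mem_words N r s : (size s <= r)%N -> all (fun n => n < N)%N s -> s \in words N r.
Proof.
elim: r s => [|r IH] [|n s] //= H.
  by rewrite mem_cat IH.
move=> /andP[nN sN]; rewrite mem_cat; apply/orP; right.
by apply/allpairsP; exists (n, s); rewrite mem_iota /= nN IH.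
Qed.

Lemma prod_theta_le1 s : all (fun n => 0 < n)%N s -> \prod_(m <- s) theta m <= 1.
Proof.
elim: s => [|m s IH] /=; first by rewrite big_nil.
move=> /andP[m0 s0]; rewrite big_cons; have /andP[t0 t1] := theta01 m0.
by rewrite mulr_ile1 ?(ltW t0) ?(ltW t1) ?IH // ltW // prod_theta_gt0.
Qed.

Lemma prod_theta_le s n : all (fun n => 0 < n)%N s -> n \in s ->
  \prod_(m <- s) theta m <= theta n.
Proof.
elim: s => // m s IH /= /andP[m0 s0]; rewrite big_cons inE => /orP[/eqP ->|ns].
  have /andP[t0 t1] := theta01 m0.
  by rewrite ler_piMr ?(ltW t0) // prod_theta_le1.
have /andP[t0 t1] := theta01 m0.
apply: le_trans (IH s0 ns); rewrite ler_piMl ?(ltW t1) // ltW //.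
exact: prod_theta_gt0.
Qed.

Lemma prod_theta_le_exp s : all (fun n => 0 < n)%N s ->
  \prod_(m <- s) theta m <= theta 1%N ^+ size s.
Proof.
elim: s => [|m s IH] /=; first by rewrite big_nil expr0.
move=> /andP[m0 s0]; rewrite big_cons exprS; have /andP[t0 _] := theta01 m0.
apply: ler_pM; [exact: ltW|exact/ltW/prod_theta_gt0|exact: theta_le1|exact: IH].
Qed.

(** A weight above [tau] bounds the length of the word through powers of [theta 1], and each label
    because [theta] tends to 0. Hence the maximum defining gamma is attained. *)
Lemma finite_labels (tau : R) : 0 < tau -> exists S : seq (seq nat), forall s,
  all (fun n => 0 < n)%N s -> tau < \prod_(n <- s) theta n -> s \in S.
Proof.
move=> tau0; have [N HN] := theta_small tau0; have [r Hr] := theta_exp_small tau0.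
exists (words N r) => s s0 ts; apply: mem_words.
  rewrite leqNgt; apply/negP => rs.
  have /andP[t0 t1] := theta01 (ltn0Sn 0).
  have : theta 1%N ^+ size s <= theta 1%N ^+ r by rewrite ler_iXn2l ?(ltW t0) ?(ltW t1) // ltnW.
  by rewrite leNgt (lt_trans Hr) // (lt_le_trans ts) // prod_theta_le_exp.
apply/allP => n ns; rewrite ltnNge; apply/negP => Nn.
have n0 := allP s0 _ ns.
by have := lt_trans (lt_le_trans ts (prod_theta_le s0 ns)) (HN n Nn n0); rewrite ltxx.
Qed.

Lemma ord_max (T : eqType) (S : seq T) (A : T -> Prop) (o : T -> ord) :
  (exists2 s, s \in S & A s) ->
  exists s, A s /\ forall t, t \in S -> A t -> ole (o t) (o s).
Proof.
elim: S => [[]//|u S IH [s sS As]].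
have [H|H] := pselect (exists2 s, s \in S & A s).
  have [v [Av vm]] := IH H.
  have [Au|nAu] := pselect (A u); last first.
    by exists v; split=> // t; rewrite inE => /orP[/eqP ->//|]; exact: vm.
  have [uv|vu] := ole_total (o u) (o v).
    by exists v; split=> // t; rewrite inE => /orP[/eqP ->//|]; exact: vm.
  exists u; split=> // t; rewrite inE => /orP[/eqP -> _|tS At]; first exact: ole_refl.
  by apply: ole_trans (oltW vu); exact: vm.
exists s; split=> // t; rewrite inE => /orP[/eqP -> Au|tS At]; last by case: H; exists t.
move: sS; rewrite inE => /orP[/eqP ->|sS]; first exact: ole_refl.
by case: H; exists s.
Qed.

Lemma is_gamma_exists (eps : R) m : 0 < eps -> (0 < m)%N -> exists g, is_gamma theta beta eps m g.
Proof.
move=> eps0 m0; have /andP[t0 _] := theta01 m0.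
have [S HS] := finite_labels (divr_gt0 t0 eps0).
have gS s : gamma_set theta eps m s -> s \in S.
  by move=> [_ [s0 ts]]; apply: HS => //; rewrite ltr_pdivrMr // mulrC.
have [[s As]|/forallNP H] := pselect (exists s, gamma_set theta eps m s).
  have [|u [Au um]] := @ord_max _ S (gamma_set theta eps m) (osum beta).
    by exists s => //; exact: gS.
  exists (osum beta u); right; split; first by exists u.
  by move=> t At; apply: um => //; exact: gS.
by exists OZero; left; split=> //; apply/seteqP; split=> // s /H.
Qed.

Lemma is_gamma_owf (eps : R) m g : (forall n, (0 < n)%N -> owf (beta n)) ->
  is_gamma theta beta eps m g -> owf g.
Proof.
move=> wb [[_ ->]//|[[s [[_ [s0 _]] ->]] _]]; exact: osum_owf.
Qed.
End Labels.

(** * Weighted sums of blocks under splitting *)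

Section Blocks.
Variables (R : realType) (theta : nat -> R) (beta : nat -> ord).
Hypothesis theta01 : forall n, (0 < n)%N -> 0 < theta n < 1.
Local Notation norm := (tnorm theta beta).

Lemma count_hit_le1 (I : eqType) (g : I -> seq nat) (s : seq I) a b :
  successive (map g s) -> ~~ has (fun p => a <= p <= b)%N (map fmin (map g s)) ->
  (count (fun i => has (fun p => a <= p <= b)%N (g i)) s <= 1)%N.
Proof.
elim: s => //= i s IH /successiveE[/= /andP[ni ns]]; rewrite fset_pos_cat => /and3P[/allrelP is' pi ps].
rewrite negb_or => /andP[_ nh].
have ss : successive (map g s) by exact/successiveE.
case: hasP => [[p pi' /andP[ap pb]]|_]; last exact: IH.
rewrite add1n ltnS leqn0 eqn0Ngt -has_count; apply/hasPn => j js; apply/hasPn => q qj.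
apply/negP => /andP[aq qb]; move/hasPn: nh => /(_ (fmin (g j))).
rewrite map_f ?map_f // => /(_ isT)/negP; apply.
have gj := map_f g js.
have mj := fmin_mem (successive_nonempty ss gj).
rewrite (leq_trans ap) /=; last first.
  by apply/ltnW/is' => //; apply/flattenP; exists (g j).
by rewrite (leq_trans _ qb) // fmin_le //; exact: successive_fset_pos gj.
Qed.

Lemma sum_count_le (I : eqType) (s : seq I) (hit : pred I) (h : I -> R) (C : R) : 0 <= C ->
  (count hit s <= 1)%N -> (forall i, i \in s -> ~~ hit i -> h i <= 0) ->
  (forall i, i \in s -> hit i -> h i <= C) -> \sum_(i <- s) h i <= C.
Proof.
move=> C0 c1 h0 hC.
apply: (@le_trans _ _ (\sum_(i <- s) if hit i then C else 0)).
  rewrite big_seq [leRHS]big_seq; apply: ler_sum => i si.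
  by case: ifPn; [exact: hC|exact: h0].
rewrite -big_mkcond big_const_seq iter_addr_0 -[leLHS]mulr_natr ler_piMr //.
by rewrite -[leRHS]/(1%:R) ler_nat.
Qed.

Lemma supnorm_attained (E : seq nat) (x : nat -> R) : E != [::] ->
  exists2 p, p \in E & supnorm (restr E x) <= `|x p|.
Proof.
move=> nE; have [p pE pm] : exists2 p, p \in E & forall q, q \in E -> `|x q| <= `|x p|.
  elim: E nE => // e E IH _; case: (eqVneq E [::]) => [->|/IH[p pE pm]].
    by exists e; rewrite ?mem_head // => q; rewrite inE => /eqP ->.
  have [ep|pe] := leP `|x e| `|x p|.
    by exists p => [|q]; rewrite inE ?pE ?orbT // => /orP[/eqP ->|/pm].
  exists e => [|q]; rewrite ?mem_head // inE => /orP[/eqP ->//|/pm]/le_trans; apply.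
  exact: ltW.
exists p => //; apply: supnorm_le => i; rewrite /restr; case: ifP => [/pm//|_].
by rewrite normr0.
Qed.

Variables (F : seq nat) (z : nat -> R) (b : ord) (eta : R) (B : nat -> nat).
Variable y : nat -> nat -> R.
Variables (C W : R).
Hypotheses (pF : fset_pos F) (z0 : forall p, 0 <= z p) (sz : \sum_(p <- F) z p = 1).
Hypothesis nF : small_on z F b eta.
Hypothesis BF : forall i j, i \in F -> j \in F -> (i < j)%N -> (B i < j)%N.
Hypothesis cy : forall s, s \in F -> c00 (y s).
Hypothesis yB : forall s i, s \in F -> y s i != 0 -> (s <= i <= B s)%N.
Hypothesis yC : forall s, s \in F -> norm (y s) <= C.
Hypothesis yW : forall s Es, s \in F -> admissible (inS b) Es ->
  \sum_(E <- Es) norm (restr E (y s)) <= W.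

Let u i := \sum_(s <- F) z s * y s i.

Let cu : c00 u.
Proof. by apply: (c00_sum (v := fun s i => z s * y s i)) => s /cy; exact: c00Z. Qed.

Let C0 : 0 <= C.
Proof.
have : exists s, s \in F.
  by case: (F) sz => [|s F' _]; [rewrite big_nil => /eqP; rewrite eq_sym oner_eq0|exists s; rewrite mem_head].
by move=> [s sF]; apply: le_trans (yC sF); apply: tnorm_ge0 => //; exact: cy.
Qed.

Let W0 : 0 <= W.
Proof.
have : exists s, s \in F.
  by case: (F) sz => [|s F' _]; [rewrite big_nil => /eqP; rewrite eq_sym oner_eq0|exists s; rewrite mem_head].
by move=> [s sF]; have := yW sF (admissible_nil b); rewrite big_nil.
Qed.

Lemma blocks_sup i : `|u i| <= 2 * eta * C.
Proof.
have [->|i0] := posnP i.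
  have -> : u 0%N = 0.
    rewrite /u big_seq big1 // => s sF; apply/eqP; rewrite mulf_eq0; apply/orP; right.
    apply/negPn/negP => /(yB sF)/andP[]; rewrite leqn0 => /eqP s0.
    by have := fset_pos_gt0 pF sF; rewrite s0.
  rewrite normr0 !mulr_ge0 //; apply: le_trans (nF _ (inS_nil b)) => //; exact: mass_ge0.
apply: le_trans (ler_norm_sum _ _ _) _.
have H := hit_mass pF z0 nF BF (G := [:: i]) _ (inS_single b i0).
apply: le_trans (ler_wpM2r C0 (H _)); last by rewrite fset_pos_cons i0.
rewrite mulr_suml big_seq [leRHS]big_mkcond [leRHS]big_seq; apply: ler_sum => s sF.
rewrite /= orbF; case: ifPn => [_|si].
  rewrite normrM ger0_norm // ler_wpM2l //; apply: le_trans (yC sF).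
  by apply: tnorm_sup => //; exact: cy.
have -> : y s i = 0; last by rewrite mulr0 normr0.
by apply/eqP/negPn/negP => /(yB sF); rewrite (negbTE si).
Qed.

Lemma restr_block0 s E : s \in F -> ~~ has (fun p => s <= p <= B s)%N E ->
  restr E (y s) = fun=> 0.
Proof.
move=> sF /hasPn H; apply: funext => i; rewrite /restr; case: ifP => // iE.
by apply/eqP/negPn/negP => /(yB sF); rewrite (negbTE (H i iE)).
Qed.

(** Blocks containing a minimum of the family have total weight at most [2 * eta] and are charged
    [W]; every other block meets at most one set and is charged [C]. *)
Lemma blocks_split_norm : split_norm norm b u <= C + 2 * eta * W.
Proof.
apply: split_norm_le => Es adm.
apply: (@le_trans _ _ (\sum_(s <- F) z s * \sum_(E <- Es) norm (restr E (y s)))).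
  under [leRHS]eq_bigr do rewrite mulr_sumr.
  rewrite exchange_big /=; apply: ler_sum => E _.
  have -> : restr E u = (fun p => \sum_(s <- F) z s * restr E (y s) p).
    by rewrite /u (restr_sum E F (fun s i => z s * y s i)); apply: funext => p;
      apply: eq_bigr => s _; rewrite restrZ.
  apply: le_trans (tnorm_lincomb beta theta01 (fun s => z s) (v := fun s => restr E (y s)) _) _.
    by move=> s /cy; exact: c00_restr.
  by apply: ler_sum => s _; rewrite ger0_norm.
pose hit s := has (fun p => s <= p <= B s)%N (map fmin Es).
apply: (@le_trans _ _ (\sum_(s <- F) (z s * C + (if hit s then z s else 0) * W))).
  rewrite big_seq [leRHS]big_seq; apply: ler_sum => s sF.
  case: ifPn => [_|nh]; first by apply: ler_wpDl; [rewrite mulr_ge0|rewrite ler_wpM2l // yW].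
  rewrite mul0r addr0 ler_wpM2l //.
  apply: (sum_count_le C0 (hit := fun E => has (fun p => s <= p <= B s)%N E)).
  - by apply: (@count_hit_le1 _ id); rewrite map_id //; case: adm.
  - by move=> E _ /(restr_block0 sF) ->; rewrite tnorm0.
  - by move=> E _ _; apply: le_trans (yC sF); apply: tnorm_restr => //; exact: cy.
rewrite big_split /= -!mulr_suml sz mul1r lerD2l ler_wpM2r // -big_mkcond.
by apply: (hit_mass pF z0 nF BF) => //; [exact: mins_fset_pos adm.1|exact: adm.2].
Qed.

(** Each supremum is realized at a point of its set, and these points form a member of [inS b]; only
    the few blocks containing one of them contribute, so no term [C] appears. *)
Lemma blocks_split_sup : split_norm (@supnorm R) b u <= 2 * eta * W.
Proof.
apply: split_norm_le => Es adm.
have [|p pP] := @choice_seq _ _ (fun (E : seq nat) (p : nat) => p \in E /\ supnorm (restr E u) <= `|u p|) Es 0%N.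
  by move=> E /(successive_nonempty adm.1)/supnorm_attained-/(_ u)[p ? ?]; exists p.
apply: (@le_trans _ _ (\sum_(s <- F) z s * \sum_(E <- Es) `|y s (p E)|)).
  under [leRHS]eq_bigr do rewrite mulr_sumr.
  rewrite exchange_big /= big_seq [leRHS]big_seq; apply: ler_sum => E /pP[_ /le_trans]; apply.
  apply: le_trans (ler_norm_sum _ _ _) _; apply: ler_sum => s _.
  by rewrite normrM ger0_norm.
have [||pp bp] := @admissible_points _ b id Es p; first by rewrite map_id.
  by move=> E /pP[].
apply: le_trans (ler_wpM2r W0 (hit_mass pF z0 nF BF pp bp)).
rewrite mulr_suml [leRHS]big_mkcond big_seq [leRHS]big_seq; apply: ler_sum => s sF.
case: ifPn => [_|/hasPn H].
  rewrite ler_wpM2l //; apply: le_trans (yW sF adm).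
  rewrite big_seq [leRHS]big_seq; apply: ler_sum => E /pP[pE _].
  have := tnorm_sup beta theta01 (p E) (c00_restr E (cy sF)).
  by rewrite {1}/restr pE.
rewrite big_seq big1 ?mulr0 // => E EE.
have -> : y s (p E) = 0; last by rewrite normr0.
by apply/eqP/negPn/negP => /(yB sF); rewrite (negbTE (H _ (map_f p EE))).
Qed.

End Blocks.

(** * Vectors that nearly agree on an initial segment *)

Section Pigeonhole.
Variable R : realType.

Lemma unbounded_color A (col : nat -> nat) m : unbounded A -> (forall n, A n -> (col n < m)%N) ->
  exists c, unbounded (A `&` [set n | col n = c]).
Proof.
elim: m A => [A uA H|m IH A uA H]; first by have [n /H] := uA 0%N.
have [um|/existsNP[N HN]] := pselect (unbounded (A `&` [set n | col n = m])); first by exists m.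
have [||c uc] := IH (A `&` [set n | (N < n)%N]); first exact: unbounded_gt.
  move=> n [An /= Nn]; have := H n An; rewrite ltnS leq_eqVlt => /orP[/eqP cm|//].
  by case: HN; exists n.
by exists c => k; have [n [[An _] cn] kn] := uc k; exists n.
Qed.

Lemma unbounded_close1 A (f : nat -> R) (C d : R) : 0 < d -> unbounded A ->
  (forall n, A n -> `|f n| <= C) ->
  exists A', [/\ A' `<=` A, unbounded A' & forall m n, A' m -> A' n -> `|f m - f n| <= d].
Proof.
move=> d0 uA fC.
pose col n := Num.truncn ((f n + C) / d).
have colP n : A n -> (col n)%:R <= (f n + C) / d < (col n).+1%:R.
  move=> An; apply: truncn_itv; apply: divr_ge0; last exact: ltW.
  have := fC n An; rewrite ler_norml; lra.
have [n An|c uc] := @unbounded_color A col (Num.truncn ((C + C) / d)).+1 uA.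
  rewrite ltnS; apply: le_truncn; rewrite ler_pM2r ?invr_gt0 // lerD2r.
  exact: le_trans (ler_norm _) (fC n An).
exists (A `&` [set n | col n = c]); split=> [n []| |m n [Am cm] [An cn]] //.
have := colP m Am; have := colP n An; rewrite cm cn -natr1 => /andP[n1 n2] /andP[m1 m2].
have -> : f m - f n = ((f m + C) / d - (f n + C) / d) * d.
  by rewrite -mulrBl mulfVK ?gt_eqF // opprD addrACA subrr addr0.
rewrite normrM (gtr0_norm d0) ler_piMl ?(ltW d0) // ler_norml; lra.
Qed.

Lemma unbounded_close A (v : nat -> nat -> R) (C d : R) s : 0 < d -> unbounded A ->
  (forall n i, A n -> `|v n i| <= C) ->
  exists A', [/\ A' `<=` A, unbounded A'
    & forall m n i, A' m -> A' n -> (i < s)%N -> `|v m i - v n i| <= d].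
Proof.
move=> d0 uA vC; elim: s => [|s [A' [AA uA' H]]]; first by exists A; split.
have [|A2 [AA2 uA2 H2]] := @unbounded_close1 A' (fun n => v n s) C d d0 uA'.
  by move=> n /AA; exact: vC.
exists A2; split=> [n /AA2/AA| |m n i Am An] //.
rewrite ltnS leq_eqVlt => /orP[/eqP ->|]; first exact: H2.
by apply: H; exact: AA2.
Qed.

Lemma sum_pow2 F : fset_pos F -> \sum_(i <- F) 2^-1 ^+ i <= 2 * 2^-1 ^+ fmin F :> R.
Proof.
elim: F => [_|p F IH]; first by rewrite big_nil mulr_ge0 // exprn_ge0 // invr_ge0.
rewrite fset_pos_cons big_cons => /and3P[_ /allP pF sF].
have h0 : 0 <= 2^-1 ^+ p :> R by rewrite exprn_ge0 // invr_ge0.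
have : \sum_(i <- F) 2^-1 ^+ i <= 2^-1 ^+ p :> R.
  case: (eqVneq F [::]) => [->|nF]; first by rewrite big_nil.
  apply: le_trans (IH sF) _.
  have -> : 2^-1 ^+ p = 2 * 2^-1 ^+ p.+1 :> R by rewrite exprS mulrA divff ?mul1r // pnatr_eq0.
  have h2 : 2^-1 <= 1 :> R by rewrite invf_le1 ?ler1n.
  rewrite ler_pM2l //; apply: ler_wiXn2l => //.
  by apply: pF; exact: fmin_mem.
rewrite /fmin /=; lra.
Qed.
End Pigeonhole.

(** * Absence of spreading models when the condition fails *)

Section Negative.
Variables (R : realType) (theta : nat -> R) (xi : ord) (beta : nat -> ord).
Hypothesis theta01 : forall n, (0 < n)%N -> 0 < theta n < 1.
Hypothesis theta_noninc : forall n, (0 < n)%N -> theta n.+1 <= theta n.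
Hypothesis theta_to0 : theta @ \oo --> (0 : R).
Hypothesis xi0 : olt OZero xi.
Hypothesis beta_wf : forall n, (0 < n)%N -> owf (beta n).
Hypothesis beta_lt : forall n, (0 < n)%N -> olt (beta n) (opw xi).
Hypothesis beta_sup : is_sup_pos beta (opw xi).
Local Notation norm := (tnorm theta beta).

(** The data for one norm estimate at precision [c]: [eps] and [s] come from the failure of the
    condition, [r] is the number of iterations, [q] makes the resulting splittings admissible for a
    single [beta q], which bounds their total by the norm divided by [theta q], and [l0] is where
    the inclusions begin. *)
Definition thin (N : set nat) (c : R) := exists eps s r q l0,
  let S0 := N `&` [set p | (l0 < p)%N] in
  [/\ 0 < eps <= c, theta 1%N ^+ r <= eps,
      owf (omul s (ofin r)) /\ olt (omul s (ofin r)) (opw xi),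
      (0 < q)%N /\ schreier_sub S0 (omul s (ofin r)) (beta q)
    & forall m, (0 < m)%N -> exists l g, [/\ is_gamma theta beta eps m g,
     forall p, S0 p -> (p < l)%N -> theta m <= 2^-1 ^+ p
   & schreier_sub (S0 `&` [set p | (l < p)%N]) (beta m) (oadd g s)]].

Lemma thin_exists M : ~ dagger theta beta xi -> unbounded M ->
  exists N, [/\ N `<=` M, unbounded N & forall c, 0 < c -> thin N c].
Proof.
move=> nd uM.
pose eps k : R := k.+1%:R^-1.
have eps0 k : 0 < eps k by rewrite invr_gt0.
(* The 2 is that of the condition; the successor makes the comparison with [beta m] strict, as
   [schreier_sub_thinnable] requires. *)
pose sg p := oadd (ofin 2) (OSucc (beta p)).
have W2 : olt (ofin 2) (opw xi) by apply: opw_succ => //; exact: opw_gt1.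
have sgW p : (0 < p)%N -> owf (sg p) /\ olt (sg p) (opw xi).
  move=> p0; split; first by apply: owf_add => //; exact: beta_wf.
  by apply: opw_add => //; apply: opw_succ => //; exact: beta_lt.
have /choice[d dP] : forall k, exists d : nat * nat * nat,
    [/\ (0 < d.1.1)%N, (0 < d.2)%N, theta 1%N ^+ d.1.2 <= eps k,
      olt (omul (sg d.1.1) (ofin d.1.2)) (beta d.2)
    & forall m g, (0 < m)%N -> is_gamma theta beta (eps k) m g ->
        ole (beta m) (oadd (oadd g (ofin 2)) (beta d.1.1))].
  move=> k; have [b [bW Hb]] : exists b, olt b (opw xi) /\ forall m g, (0 < m)%N ->
      is_gamma theta beta (eps k) m g -> ~ olt (oadd (oadd g (ofin 2)) b) (beta m).
    apply: contrapT => /forallNP H; apply: nd; exists (eps k); split=> // b bW.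
    have /not_andP[//|H'] := H b.
    apply: contrapT => /forallNP H2; apply: H' => m g m0 gg lt.
    by apply: (H2 m); split=> //; exists g.
  have [p p0 bp] := is_sup_olt beta_sup bW.
  have [r /ltW Hr] := theta_exp_small theta01 (eps0 k).
  have [q q0 sq] := is_sup_olt beta_sup (opw_muln r (sgW p p0).2).
  exists (p, r, q); split=> //= m g m0 gg; apply: oleNgt => lt.
  by apply: (Hb m g m0 gg); apply: ole_olt_trans lt; apply: ole_add2l; exact: oltW.
have /choice[g gP] : forall km : nat * nat, exists g, (0 < km.2)%N ->
    is_gamma theta beta (eps km.1) km.2 g.
  move=> [k m] /=; have [m0|] := ltnP 0 m; last by exists OZero.
  by have [g] := is_gamma_exists beta theta01 theta_noninc theta_to0 (eps0 k) m0; exists g.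
(* Stage l of the diagonalization can serve only finitely many m, those up to [Mb l]; for all others
   [theta m] is at most 2^-l. *)
have /choice[Mb MbP] : forall l, exists Mb, (l <= Mb)%N /\
    forall m, (Mb < m)%N -> theta m <= 2^-1 ^+ l.
  move=> l; have [|N HN] := theta_small theta_to0 (e := 2^-1 ^+ l); first by rewrite exprn_gt0.
  exists (maxn l N); split; first exact: leq_maxl.
  move=> m; rewrite gtn_max => /andP[_ Nm]; apply/ltW/HN; first exact: ltnW.
  exact: leq_ltn_trans Nm.
pose lst l := [seq (k, m) | k <- iota 0 l.+1, m <- iota 1 (Mb l)].
pose P l (A : set nat) := (forall x, x \in lst l ->
    schreier_sub A (beta x.2) (oadd (g x) (sg (d x.1).1.1))) /\
  (forall k, k \in iota 0 l.+1 ->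
    schreier_sub A (omul (sg (d k).1.1) (ofin (d k).1.2)) (beta (d k).2)).
have hP : hereditary P.
  by move=> l A B BA [H1 H2]; split=> x xl; [apply: schreier_subS BA (H1 _ xl)|apply: schreier_subS BA (H2 _ xl)].
have dP' l : thinnable (P l).
  move=> A uA.
  have [x|B [BA uB HB]] := @schreier_sub_thinnable_seq _ (fun x : nat * nat => beta x.2)
      (fun x => oadd (g x) (sg (d x.1).1.1)) (lst l) _ A uA.
    move=> /allpairsP[[k m] /= [_ + ->]]; rewrite mem_iota => /andP[m0 _] /=.
    have [p0 q0 _ _ H] := dP k; split; first exact: beta_wf.
      apply: owf_add; last exact: (sgW _ p0).1.
      exact: is_gamma_owf (gP (k, m) m0).
    by rewrite /sg oaddA /=; apply/oltS; exact: H m0 (gP (k, m) m0).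
  have [x _|C [CB uC HC]] := @schreier_sub_thinnable_seq _ (fun k => omul (sg (d k).1.1) (ofin (d k).1.2))
      (fun k => beta (d k).2) (iota 0 l.+1) _ B uB.
    have [p0 q0 _ lt _] := dP x; split=> //; last exact: beta_wf.
    by apply: owf_muln; exact: (sgW _ p0).1.
  by exists C; split=> [x /CB/BA| |] //; split=> // x /HB; exact: schreier_subS.
have [L [LM uL LP]] := diagonal_thinning hP dP' uM.
exists L; split=> // c c0.
pose k := Num.truncn c^-1.
have kc : eps k <= c.
  by rewrite /eps invf_ple ?posrE //; apply/ltW; exact: truncnS_gt.
have [l0 Ll0 kl0] := uL k.
have [p0 q0 rk sq H] := dP k.
exists (eps k), (sg (d k).1.1), (d k).1.2, (d k).2, l0 => S0.
have kl l : (l0 <= l)%N -> k \in iota 0 l.+1.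
  by move=> l0l; rewrite mem_iota add0n ltnS (leq_trans (ltnW kl0)).
split=> //.
- by rewrite eps0.
- split; first by apply: owf_muln; exact: (sgW _ p0).1.
  by apply: opw_muln; exact: (sgW _ p0).2.
- split=> //; have [_] := LP l0 Ll0 l0 (leqnn _).
  by apply; exact: kl.
- move=> m m0.
  (* The first point of [S0] whose stage serves m. Points p of [S0] before it have [Mb p < m],
     whence [theta m] is at most 2^-p. *)
  have [|l /andP[/asboolP[Ll /= l0l] ml] lmin] := @ex_minnP (fun l => `[< S0 l >] && (m <= Mb l)%N).
    have [l Ll] := uL (maxn l0 m); rewrite gtn_max => /andP[l0l ml].
    exists l; apply/andP; split; first exact/asboolP.
    by apply: leq_trans (ltnW ml) _; case: (MbP l).
  exists l, (g (k, m)); split; first exact: (gP (k, m)).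
    move=> p Sp pl; have [_] := MbP p; apply; rewrite ltnNge; apply/negP => mp.
    by have := lmin p; rewrite mp leqNgt pl andbT => /(_ (asboolT Sp)).
  have [H1 _] := LP l Ll l (leqnn _).
  have /schreier_subS : (S0 `&` [set p | (l < p)%N]) `<=` (L `&` [set p | (l < p)%N]).
    by move=> p [[Lp _] lp].
  apply; apply: (H1 (k, m)); apply/allpairsP; exists (k, m); split=> //=.
    by apply: kl; exact: ltnW.
  by rewrite mem_iota add1n ltnS m0.
Qed.

Lemma not_contains_SM w N : owf w -> ole (opw xi) w -> unbounded N ->
  (forall c, 0 < c -> thin N c) -> ~ contains_l1_SM theta beta w N.
Proof.
move=> wfw Ww uN thinN [x [xP [x1 [K [K0 lowx]]]]].
pose c := K^-1; have c0 : 0 < c by rewrite invr_gt0.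
(* The main term will be at most [eps * 5], hence at most [c / 4]. *)
have [|eps [s [r [q [l0 [/andP[eps0 epsc] thr [ws sW] [q0 sq] H]]]]]] := thinN (c / 20).
  by rewrite divr_gt0.
set S0 := N `&` _ in sq H; set s' := omul s (ofin r) in ws sW sq.
(* Four copies of [del] occur in the end: two from approximating the vectors with coefficients of
   total mass 2, one from the discarded initial parts, one from the errors of the iteration. With
   the main term [c / 4] they stay below the lower bound [2 * c]. *)
pose del : R := Num.min 1 (c / 4).
have del0 : 0 < del by rewrite lt_min ltr01 divr_gt0.
have del1 : del <= 1 by rewrite ge_min lexx.
have delc : del <= c / 4 by rewrite ge_min lexx orbT.
have /choice[kk kkP] : forall n, exists k, (0 < n)%N -> forall l, (k <= l)%N ->
    norm (fun i => x n l i - x n k i) <= del.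
  move=> n; have [n0|] := ltnP 0 n; last by exists 0%N.
  have [[_ /(_ _ del0)[k Hk]] _] := xP n n0; exists k => _ l kl.
  by apply/ltW/Hk.
pose X n := x n (kk n).
have cX n : (0 < n)%N -> c00 (X n) by move=> n0; have [[cx _] _] := xP n n0; exact: cx.
have NX n i : (0 < n)%N -> X n i != 0 -> N i.
  by move=> n0; have [_] := xP n n0; apply.
have X2 n : (0 < n)%N -> norm (X n) <= 2.
  move=> n0; have [xX _] := xP n n0.
  have : norm (X n) - del <= Xnorm theta beta (x n).
    apply: (Xnorm_ge theta01 (K := kk n)) => // k kn; have [cx _] := xX.
    rewrite lerBlDr; apply: le_trans (_ : norm (x n k) + norm (fun i => X n i - x n k i) <= _).
      have {1}-> : X n = (fun i => x n k i + (fun i => X n i - x n k i) i).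
        by apply: funext => i; rewrite addrC subrK.
      by apply: tnormD => //; apply: c00B => //; exact: cX.
    by rewrite lerD2l tnorm_sub_sym //; [exact: kkP|exact: cX].
  by rewrite x1 //; lra.
(* Complexity of the set of indices used below: pairs, which lie in S_1 once their minimum exceeds
   1, indexed by a set of [inS (OSucc s')]. *)
pose a0 := oadd (OSucc OZero) (OSucc s').
have a0w : olt a0 w.
  apply: olt_ole_trans Ww; apply: opw_add; first exact: opw_gt1.
  exact: opw_succ.
have wa0 : owf a0 by exact: owf_add.
have uT : unbounded [set n | (1 < n)%N].
  by move=> n; exists (maxn 2 n.+1); rewrite /= ?leq_maxl ?leq_maxr.
have [I [I1 uI Iw]] := schreier_sub_thinnable wa0 wfw a0w uT.
have I0 n : I n -> (0 < n)%N by move=> /I1 /ltnW.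
(* Two indices beyond t whose vectors nearly agree up to t; the tolerance is divided by t + 1
   because it is summed over t coordinates. *)
have /choice[nn nnP] : forall t, exists nn : nat * nat,
   [/\ I nn.1, I nn.2, (t < nn.1)%N, (nn.1 < nn.2)%N
     & forall i, (i <= t)%N -> `|X nn.1 i - X nn.2 i| <= del / t.+1%:R].
  move=> t; have dt : 0 < del / t.+1%:R by rewrite divr_gt0.
  have [|A [AI uA HA]] := @unbounded_close R _ X 2 _ t.+1 dt (unbounded_gt t uI).
    move=> n i [/I0 n0 _]; apply: le_trans (X2 n n0); apply: tnorm_sup => //; exact: cX.
  have [m Am _] := uA 0%N; have [n An mn] := uA m.
  have [Im tm] := AI m Am; have [In _] := AI n An.
  by exists (m, n); split=> // i it; apply: HA.
pose df t i := X (nn t).1 i - X (nn t).2 i.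
have cdf t : c00 (df t).
  by have [/I0 ? /I0 ? _ _ _] := nnP t; apply: c00B; exact: cX.
have dfN t i : df t i != 0 -> N i.
  have [/I0 p1 /I0 p2 _ _ _] := nnP t; move=> dn.
  have [X1|X1] := eqVneq (X (nn t).1 i) 0; last exact: NX X1.
  by apply: NX p2 _; apply: contraNneq dn => X2'; rewrite /df X1 X2' subrr.
pose y t i := if (t < i)%N then df t i else 0.
pose low t i := if (i <= t)%N then df t i else 0.
have dfE t i : df t i = y t i + low t i.
  by rewrite /y /low ltnNge; case: (i <= t)%N; rewrite ?add0r ?addr0.
have cy t : c00 (y t) by apply: c00_le (cdf t) => i di; rewrite /y di if_same.
have clow t : c00 (low t) by apply: c00_le (cdf t) => i di; rewrite /low di if_same.
have df4 t : norm (df t) <= 4.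
  have [/I0 p1 /I0 p2 _ _ _] := nnP t.
  apply: le_trans (tnormB beta theta01 (cX _ p1) (cX _ p2)) _.
  have := X2 _ p1; have := X2 _ p2; lra.
have y4 t : norm (y t) <= 4.
  apply: le_trans (df4 t); apply: tnorm_mono => // i.
  by rewrite /y; case: ifP => // _; rewrite normr0.
have low1 t : norm (low t) <= del.
  have pit : fset_pos (iota 1 t).
    by rewrite /fset_pos iota_ltn_sorted; apply/allP => i; rewrite mem_iota => /andP[].
  have sl : supported (iota 1 t) (low t).
    move=> i; rewrite mem_iota add1n ltnS negb_and -leqNgt leqn0 /low.
    case/orP => [/eqP ->|/negbTE -> //]; have [b] := cdf t.
    by move=> d0; rewrite leq0n; exact: d0.
  apply: le_trans (tnorm_le_l1 beta theta01 pit sl) _.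
  apply: (@le_trans _ _ (\sum_(i <- iota 1 t) (del / t.+1%:R))).
    rewrite big_seq [leRHS]big_seq; apply: ler_sum => i; rewrite mem_iota add1n ltnS => /andP[_ it].
    by rewrite /low it; have [_ _ _ _] := nnP t; apply.
  rewrite big_const_seq iter_addr_0 count_predT size_iota -[leLHS]mulr_natr mulrAC.
  by rewrite ler_pdivrMr // ler_pM2l // ler_nat.
(* The bound covers the index pair as well as the support, so that the pairs are successive too. *)
have /choice[B BP] : forall t, exists b, ((nn t).2 <= b)%N /\ forall i, y t i != 0 -> (i <= b)%N.
  move=> t; have [b yb] := cy t; exists (maxn b (nn t).2); split; first exact: leq_maxr.
  move=> i; apply: contraNT; rewrite -ltnNge gtn_max => /andP[bi _].
  by rewrite yb // bi orbT.
have hB : hereditary (fun k A => forall a, A a -> (B k < a)%N).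
  by move=> k A A' AA H' a /AA; exact: H'.
have dB k : thinnable (fun A => forall a, A a -> (B k < a)%N).
  move=> A uA; exists (A `&` [set a | (B k < a)%N]); split=> [a []//| |a []//].
  exact: unbounded_gt.
have [D [_ uD DB]] := diagonal_thinning hB dB uT.
have /andP[tq0 tq1] := theta01 q0.
pose W := 4 / theta q.
(* [eta * Z] is [2 * eta * W + 16 * eta], the error of one step of the iteration; [eta] is chosen so
   that r steps cost at most [del]. *)
pose Z := 8 / theta q + 16.
have Z0 : 0 < Z by rewrite addr_gt0 ?divr_gt0.
pose eta := del / (Z * r.+1%:R).
have eta0 : 0 < eta by rewrite divr_gt0 // mulr_gt0.
have [F [z [[pF FD z0 sz] SF nF]]] := average_exists ws (maxn l0 1) uD eta0.
have Fl t : t \in F -> [/\ D t, (l0 < t)%N & (0 < t)%N].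
  by move=> /FD[Dt]; rewrite gtn_max => /andP[? /ltnW].
have BF i j : i \in F -> j \in F -> (i < j)%N -> (B i < j)%N.
  by move=> /Fl[Di _ _] /Fl[Dj _ _] ij; apply: (DB i Di i (leqnn _)).
have yB t i : t \in F -> y t i != 0 -> (t <= i <= B t)%N.
  move=> _ yi; rewrite (BP t).2 // andbT; move: yi; rewrite /y.
  by case: ifP => [/ltnW //|_]; rewrite eqxx.
have yS0 t i : t \in F -> y t i != 0 -> S0 i.
  move=> /Fl[_ lt _]; rewrite /y; case: ifP => [ti /dfN Ni|_]; last by rewrite eqxx.
  by split=> //=; exact: ltn_trans ti.
have yW t Es : t \in F -> admissible (inS s') Es -> \sum_(E <- Es) norm (restr E (y t)) <= W.
  move=> tF adm; have [Sy [pSy SyE]] := c00_supp (cy t).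
  have aE := admissible_shrink adm (fun E => filter_subseq (fun i => i \in Sy) E).
  have eE E : restr E (y t) = restr [seq i <- E | i \in Sy] (y t).
    by rewrite -restr_filter (@restr_id R Sy) // => i; rewrite SyE negbK => /eqP.
  under eq_bigr do rewrite eE.
  rewrite -(big_map (fun E => [seq i <- E | i \in Sy]) xpredT (fun E => norm (restr E (y t)))).
  rewrite -sum_shrink; last exact: tnorm0.
  rewrite ler_pdivlMr // mulrC; apply: le_trans (y4 t).
  apply: tnorm_adm => //; split; first by case: aE.
  apply: sq; [exact: mins_fset_pos aE.1| |exact: aE.2].
  move=> _ /mapP[E EE ->]; apply: (yS0 t) => //; rewrite -SyE.
  have := fmin_mem (successive_nonempty aE.1 EE); move: EE.
  rewrite mem_filter => /andP[_ /mapP[G _ {2}->]].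
  by rewrite mem_filter => /andP[].
pose u i := \sum_(t <- F) z t * y t i.
have cu : c00 u.
  by apply: (c00_sum (v := fun t i => z t * y t i)) => t _; exact: c00Z.
have uA : split_norm norm s' u <= 4 + 2 * eta * W.
  by apply: (blocks_split_norm theta01 pF z0 sz nF BF).
have uO : split_norm (@supnorm R) s' u <= 2 * eta * W.
  by apply: (blocks_split_sup (beta := beta) theta01 pF z0 sz nF BF).
have us i : `|u i| <= 2 * eta * 4.
  by apply: (blocks_sup (beta := beta) theta01 pF z0 sz nF BF).
have [Fu [pFu FuE]] := c00_supp cu.
have FuS p : p \in Fu -> S0 p.
  rewrite FuE => up; apply: contrapT => nS; move/eqP: up; apply.
  rewrite /u big_seq big1 // => t tF; apply/eqP; rewrite mulf_eq0; apply/orP; right.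
  by apply/negPn/negP => /(yS0 t _ tF).
have sFu : supported Fu u by move=> i; rewrite FuE negbK => /eqP.
have upper := iterate_step theta01 theta_noninc eps0 pFu FuS H r sFu.
rewrite -/s' in upper.
have tau : \sum_(i <- Fu) 2^-1 ^+ i * `|u i| <= 16 * eta.
  apply: (@le_trans _ _ (\sum_(i <- Fu) 2^-1 ^+ i * (2 * eta * 4))).
    by apply: ler_sum => i _; rewrite ler_wpM2l // exprn_ge0 // invr_ge0.
  rewrite -mulr_suml.
  have := sum_pow2 R pFu.
  have : 2^-1 ^+ fmin Fu <= 1 :> R by rewrite exprn_ile1 ?invr_ge0 // invf_le1 ?ler1n.
  have : 0 <= \sum_(i <- Fu) 2^-1 ^+ i :> R.
    by apply: sumr_ge0 => i _; rewrite exprn_ge0 // invr_ge0.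
  nra.
have etaZ : eta * Z * r.+1%:R = del.
  by rewrite /eta -mulrA divfK // mulf_neq0 // gt_eqF.
have etaZ1 : eta * Z <= del.
  by rewrite -etaZ ler_peMr ?ler1n // mulr_ge0 ?ltW.
have u_small : norm u <= c / 2.
  apply: le_trans upper _; rewrite max_l //.
  have h1 : 2 * eta * W + 16 * eta = eta * Z by rewrite /W /Z; field; rewrite gt_eqF.
  have h2 : 2 * eta * W <= 1.
    have : 0 <= 16 * eta by rewrite mulr_ge0 ?ltW.
    lra.
  have h3 : eps * split_norm norm s' u <= eps * 5 by rewrite ler_pM2l //; lra.
  have h4 : r%:R * (split_norm (@supnorm R) s' u + \sum_(i <- Fu) 2^-1 ^+ i * `|u i|) <= del.
    rewrite -etaZ mulrC; apply: ler_pM => //; last by rewrite ler_nat.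
      apply: addr_ge0; first by apply: split_norm_ge0 => //; exact: (supnorm_l1_bounded beta theta01).
      by apply: sumr_ge0 => i _; rewrite mulr_ge0 // exprn_ge0 // invr_ge0.
    by rewrite -h1; exact: lerD.
  lra.
pose pr t := [:: (nn t).1; (nn t).2].
pose G := flatten [seq pr t | t <- F].
have prB t p : t \in F -> p \in pr t -> (t < p <= B t)%N.
  move=> tF; have [_ _ tn n12 _] := nnP t; have [nB _] := BP t.
  rewrite !inE => /orP[/eqP ->|/eqP ->]; first by rewrite tn (leq_trans (ltnW n12)).
  by rewrite (ltn_trans tn).
have sG : successive [seq pr t | t <- F].
  apply/successiveE; split; first by apply/allP => _ /mapP[t _ ->].
  have : forall F', {subset F' <= F} -> fset_pos F' -> fset_pos (flatten [seq pr t | t <- F']).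
    elim=> // t F' IH F'F; rewrite fset_pos_cons /= => /and3P[t0 /allP tF' pF'].
    have tF : t \in F by apply: F'F; rewrite mem_head.
    have IH' : fset_pos (flatten [seq pr t | t <- F']).
      by apply: IH => // a aF; apply: F'F; rewrite inE aF orbT.
    rewrite -[X in fset_pos X]/(pr t ++ flatten [seq pr t | t <- F']) fset_pos_cat IH' andbT; apply/andP; split.
      apply/allrelP => a b aT /flattenP[_ /mapP[t' t'F ->] bT].
      have t'F2 : t' \in F by apply: F'F; rewrite inE t'F orbT.
      have /andP[_ aB] := prB _ _ tF aT; have /andP[tb _] := prB _ _ t'F2 bT.
      by apply: leq_ltn_trans aB (ltn_trans (BF _ _ tF t'F2 (tF' _ t'F)) tb).
    have [_ _ tn n12 _] := nnP t.
    by rewrite /pr !fset_pos_cons /= n12 (leq_ltn_trans _ tn) //= (leq_ltn_trans _ n12).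
  by apply.
have pG : fset_pos G by case/successiveE: sG.
have IG p : p \in G -> I p.
  move=> /flattenP[_ /mapP[t _ ->]]; have [? ? _ _ _] := nnP t.
  by rewrite !inE => /orP[/eqP ->|/eqP ->].
have wG : inS w G.
  apply: Iw => //; apply/inS_add => //; exists [seq pr t | t <- F]; split=> //; split.
    split=> //; apply: inS_spread SF _ => //; first exact: mins_fset_pos.
    rewrite -map_comp -{1}[F]map_id; apply: spread_map => // t _.
    by have [_ _ /ltnW] := nnP t.
  move=> _ /mapP[t tF ->]; have [i1 i2 tn n12 _] := nnP t.
  have ppr : fset_pos (pr t) by apply: successive_fset_pos sG _; exact: map_f.
  exists [seq [:: p] | p <- pr t]; rewrite flatten_seq1; split=> //; split.
    split; first exact: successive_seq1.
    by rewrite /schreier1 map_fmin_seq1; exact: I1.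
  by move=> _ /mapP[p _ ->].
have inj t t' p : t \in F -> t' \in F -> p \in pr t -> p \in pr t' -> t = t'.
  move=> tF t'F /(prB _ _ tF)/andP[tp pB] /(prB _ _ t'F)/andP[t'p pB'].
  have [tt|tt|//] := ltngtP t t'.
    by have := leq_ltn_trans pB (ltn_trans (BF _ _ tF t'F tt) t'p); rewrite ltnn.
  by have := leq_ltn_trans pB' (ltn_trans (BF _ _ t'F tF tt) tp); rewrite ltnn.
(* Coefficients z_t and -z_t on the pair of t: the combination becomes [u] up to the small initial
   parts, while the absolute values sum to 2. *)
have [|a aP] := @choice_seq nat R (fun p v => forall t, t \in F ->
    (p = (nn t).1 -> v = z t) /\ (p = (nn t).2 -> v = - z t)) G 0.
  move=> p /flattenP[_ /mapP[t tF ->] pT].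
  have [_ _ _ n12 _] := nnP t.
  move: (pT); rewrite !inE => /orP[/eqP pE|/eqP pE]; [exists (z t)|exists (- z t)] => t' t'F; split=> pE'.
  - by rewrite (inj t t' p) // pE' mem_head.
  - have tt : t = t' by apply: (inj t t' p) => //; rewrite pE' !inE eqxx orbT.
    by move: n12; rewrite -pE tt -pE' ltnn.
  - have tt : t = t' by apply: (inj t t' p) => //; rewrite pE' mem_head.
    by move: n12; rewrite -pE {1}tt -pE' ltnn.
  - by rewrite (inj t t' p) // pE' !inE eqxx orbT.
have sumG (f : nat -> R) : \sum_(p <- G) f p = \sum_(t <- F) (f (nn t).1 + f (nn t).2).
  by rewrite big_flatten big_map; apply: eq_bigr => t _; rewrite big_cons big_seq1.
have aE t : t \in F -> a (nn t).1 = z t /\ a (nn t).2 = - z t.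
  move=> tF; have inG p : p \in pr t -> p \in G.
    by move=> pT; apply/flattenP; exists (pr t) => //; exact: map_f.
  split; first by apply: (proj1 (aP _ (inG _ (mem_head _ _)) t tF)).
  by apply: (proj2 (aP _ (inG _ _) t tF)) => //; rewrite !inE eqxx orbT.
have suma : \sum_(p <- G) `|a p| = 2.
  have -> : 2 = \sum_(t <- F) 2 * z t by rewrite -mulr_sumr sz mulr1.
  rewrite sumG big_seq [RHS]big_seq; apply: eq_bigr => t /aE[-> ->].
  by rewrite normrN ger0_norm // mulr_natl mulr2n.
have := lowx G a pG wG; rewrite suma => lower.
have G0 p : p \in G -> (0 < p)%N by move=> /IG/I0.
have := @Xnorm_lincomb_approx R theta beta theta01 G a x X del
  (fun p pG' => (xP p (G0 p pG')).1) (fun p pG' => cX p (G0 p pG'))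
  (fun p pG' => ex_intro _ (kk p) (kkP p (G0 p pG'))).
rewrite suma => /(le_trans lower) {}lower.
have uE : (fun i => \sum_(p <- G) a p * X p i) = (fun i => u i + (fun i => \sum_(t <- F) z t * low t i) i).
  apply: funext => i; rewrite sumG /u -big_split /= big_seq [RHS]big_seq.
  by apply: eq_bigr => t /aE[-> ->]; rewrite mulNr -mulrBr -mulrDr -dfE.
have clow' : c00 (fun i => \sum_(t <- F) z t * low t i).
  by apply: (c00_sum (v := fun t i => z t * low t i)) => t _; exact: c00Z.
have lowS : norm (fun i => \sum_(t <- F) z t * low t i) <= del.
  apply: le_trans (tnorm_lincomb beta theta01 z (v := low) (fun t _ => clow t)) _.
  rewrite -[leRHS]mul1r -sz mulr_suml; apply: ler_sum => t _.
  by rewrite ger0_norm // ler_wpM2l.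
rewrite uE in lower.
have := tnormD beta theta01 cu clow'.
rewrite -/c in lower.
lra.
Qed.

End Negative.

(** * Consequences of the dagger condition *)

Section Decomposition.
Variables (R : realType) (theta : nat -> R) (beta : nat -> ord).
Hypothesis theta01 : forall n, (0 < n)%N -> 0 < theta n < 1.
Implicit Types (x : nat -> R) (F E : seq nat) (Es : seq (seq nat)).

Local Notation norm := (tnorm theta beta).
Local Notation norm_it := (tnorm_it theta beta).

(* A norming tree truncated at the first nodes whose coefficient drops below tau is
   recorded by its terminal nodes (labels n_1, ..., n_s along the branch; set; value). *)
Definition node : Type := seq nat * seq nat * R.
Definition lab (T : node) := T.1.1.
Definition nset (T : node) := T.1.2.
Definition coef (s : seq nat) : R := \prod_(n <- s) theta n.

(** The stopping case: one further splitting would bring the coefficient down to [tau], so the value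
    is bounded through that splitting and not expanded. *)
Definition split_value x tau c (T : node) := exists n Es,
  [/\ (0 < n)%N, admissible (inS (beta n)) Es, c * coef (lab T) * theta n <= tau
    & T.2 <= theta n * \sum_(E <- Es) norm (restr E (restr (nset T) x))].

Definition leaf_value x tau c (T : node) p :=
  p \in nset T /\ (T.2 <= `|x p| \/ split_value x tau c T).

(** Minima are sorted by label word because each word has its own complexity. For one tree [b] is
    [osum beta]; for the forest below a [beta n]-admissible family the outer summand [beta n] is
    added. *)
Definition terminal x tau c (b : seq nat -> ord) (Ts : seq node) :=
  [/\ successive (map nset Ts), forall T p, T \in Ts -> p \in nset T -> x p != 0,
      forall s, inS (b s) (map fmin (map nset [seq T <- Ts | lab T == s]))
    & forall T, T \in Ts -> [/\ all (fun n => 0 < n)%N (lab T), tau < c * coef (lab T)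
        & exists p, leaf_value x tau c T p]].

Definition tree_value (Ts : seq node) : R := \sum_(T <- Ts) coef (lab T) * T.2.

Lemma terminal_nil x tau c b : terminal x tau c b [::].
Proof. by split=> // s; exact: inS_nil. Qed.

Lemma terminal1 x tau c b G v p : tau < c -> fset_pos G -> (forall q, q \in G -> x q != 0) ->
  leaf_value x tau c ([::], G, v) p -> terminal x tau c b [:: ([::], G, v)].
Proof.
move=> tc pG xG lv.
have nG : G != [::] by case: lv => + _; rewrite /nset /=; case: (G).
split.
- by apply/successiveE; rewrite /= cats0 nG.
- by move=> T q; rewrite inE => /eqP ->; exact: xG.
- move=> s /=; case: ifP => _ /=; last exact: inS_nil.
  by apply: inS_single; apply: fset_pos_gt0 pG _; exact: fmin_mem.
- move=> T; rewrite inE => /eqP ->; split=> //; last by exists p.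
  by rewrite /coef big_nil mulr1.
Qed.

Lemma leaf_value_restr E x tau c T p : (forall q, q \in nset T -> q \in E) ->
  leaf_value (restr E x) tau c T p -> leaf_value x tau c T p.
Proof.
move=> GE [pG H]; split=> //; case: H => [H|[n [Es [n0 aEs cn H]]]]; [left|right].
  by apply: le_trans H _; exact: normr_restr.
by exists n, Es; split=> //; move: H; rewrite (restr_sub (E := nset T) (F := E)).
Qed.

Lemma subseq_flatten_map (T : eqType) (h : seq T -> seq T) (ss : seq (seq T)) :
  (forall s, s \in ss -> subseq (h s) s) -> subseq (flatten (map h ss)) (flatten ss).
Proof.
elim: ss => //= s ss IH H; apply: cat_subseq; first by apply: H; rewrite mem_head.
by apply: IH => t ts; apply: H; rewrite inE ts orbT.
Qed.

Lemma flatten_subseq (T : eqType) (ss ts : seq (seq T)) :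
  subseq ts ss -> subseq (flatten ts) (flatten ss).
Proof.
elim: ss ts => [|s ss IH] [|t ts] //=; first by rewrite sub0seq.
case: eqP => [->|_] H; first exact: cat_subseq (subseq_refl _) (IH _ H).
by apply: subseq_trans (IH _ H) _; exact: suffix_subseq.
Qed.

Lemma successive_subseq Es Es' : subseq Es' Es -> successive Es -> successive Es'.
Proof.
move=> EE /successiveE[/allP nEs pEs]; apply/successiveE; split.
  by apply/allP => E /(mem_subseq EE)/nEs.
exact: fset_pos_subseq (flatten_subseq EE) pEs.
Qed.

Lemma terminal_flatten n Es x tau c (TsF : seq nat -> seq node) :
  admissible (inS (beta n)) Es ->
  (forall E, E \in Es -> terminal (restr E x) tau c (osum beta) (TsF E)) ->
  terminal x tau c (fun s => oadd (osum beta s) (beta n)) (flatten (map TsF Es)).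
Proof.
move=> adm H; have [sEs bEs] := adm.
have GE E T p : E \in Es -> T \in TsF E -> p \in nset T -> p \in E.
  move=> /H[_ + _ _] TE pT => /(_ T p TE pT).
  by rewrite /restr; case: ifP => //; rewrite eqxx.
have pE E : E \in Es -> fset_pos E by exact: successive_fset_pos.
have sT : successive (map nset (flatten (map TsF Es))).
  apply/successiveE; rewrite map_flatten -map_comp; split.
    apply/allP => G /flattenP[_ /mapP[E EEs ->] GTs].
    by have [+ _ _ _] := H E EEs; move/successive_nonempty; apply.
  rewrite -flatten_map_flatten -map_comp; case/successiveE: sEs => _; apply: fset_pos_subseq.
  apply: subseq_flatten_map => E EEs /=; apply: fset_pos_sub_subseq; first exact: pE.
    by have [/successiveE[]] := H E EEs.
  by move=> p /flattenP[_ /mapP[T TE ->]]; exact: GE.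
split=> //.
- move=> T p /flattenP[_ /mapP[E EEs ->] TE] pT; have [_ + _ _] := H E EEs.
  by move=> /(_ T p TE pT); rewrite /restr; case: ifP => //; rewrite eqxx.
- move=> s; set Ts := flatten _.
  have sTs : successive (map nset [seq T <- Ts | lab T == s]).
    by apply: successive_subseq sT; exact/map_subseq/filter_subseq.
  apply/inS_add; first exact: mins_fset_pos.
  pose mm E := map fmin (map nset [seq T <- TsF E | lab T == s]).
  have mmE E : E \in Es -> [seq p <- E | p \in mm E] = mm E.
    move=> EEs; apply: fset_pos_filter_mem; first exact: pE.
      apply: mins_fset_pos; have [sE _ _ _] := H E EEs; apply: successive_subseq sE.
      exact/map_subseq/filter_subseq.
    move=> _ /mapP[_ /mapP[T + ->] ->]; rewrite mem_filter => /andP[_ TE].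
    apply: (GE E T) => //; apply: fmin_mem; have [sE _ _ _] := H E EEs.
    by apply: successive_nonempty sE _; exact: map_f.
  exists [seq A <- [seq mm E | E <- Es] | A != [::]]; split.
    by rewrite flatten_filter_nonempty /Ts filter_flatten !map_flatten -!map_comp.
  split; last first.
    move=> A; rewrite mem_filter => /andP[_ /mapP[E EEs ->]].
    by have [_ _ + _] := H E EEs; exact.
  have -> : [seq mm E | E <- Es] = [seq [seq p <- E | p \in mm E] | E <- Es].
    by apply/eq_in_map => E EEs; rewrite mmE.
  by apply: admissible_shrink => // E; exact: filter_subseq.
- move=> T /flattenP[_ /mapP[E EEs ->] TE]; have [_ _ _ /(_ T TE)[Tpos Tc [p lv]]] := H E EEs.
  by split=> //; exists p; apply: leaf_value_restr lv => q; exact: GE.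
Qed.

Definition relabel n (T : node) : node := (n :: lab T, nset T, T.2).

(** Joining a forest to a root labelled n makes its outer family part of each word, by [osum_cons],
    and moves [theta n] from c into the coefficients. *)
Lemma terminal_relabel n x tau c Ts : (0 < n)%N ->
  terminal x tau (c * theta n) (fun s => oadd (osum beta s) (beta n)) Ts ->
  terminal x tau c (osum beta) (map (relabel n) Ts).
Proof.
move=> n0 [sT xT bT cT].
have nm : map nset (map (relabel n) Ts) = map nset Ts by rewrite -map_comp.
have cE T : c * coef (lab (relabel n T)) = c * theta n * coef (lab T).
  by rewrite /coef big_cons mulrA.
split.
- by rewrite nm.
- by move=> _ p /mapP[T TT ->]; exact: (xT T p TT).
- case=> [|m s].
    suff -> : [seq T <- map (relabel n) Ts | lab T == [::]] = [::] by exact: inS_nil.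
    by elim: (Ts).
  case: (eqVneq n m) => [<-|nm'].
    have -> : [seq T <- map (relabel n) Ts | lab T == n :: s] =
              map (relabel n) [seq T <- Ts | lab T == s].
      by elim: (Ts) => //= T Ts' ->; rewrite eqseq_cons eqxx /=; case: ifP.
    by rewrite osum_cons -(map_comp nset); exact: bT.
  suff -> : [seq T <- map (relabel n) Ts | lab T == m :: s] = [::] by exact: inS_nil.
  by elim: (Ts) => //= T Ts' ->; rewrite eqseq_cons (negbTE nm').
- move=> _ /mapP[T TT ->]; have [Tpos Tc [p [pT lv]]] := cT T TT; split.
  + by rewrite /= n0.
  + by rewrite cE.
  + exists p; split=> //; case: lv => [|[m [Es [m0 aEs cm H]]]]; [by left|right].
    by exists m, Es; split=> //; rewrite cE.
Qed.

Lemma tree_value_relabel n Ts : tree_value (map (relabel n) Ts) = theta n * tree_value Ts.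
Proof.
rewrite /tree_value big_map mulr_sumr; apply: eq_bigr => T _.
by rewrite /coef big_cons mulrA.
Qed.

Lemma decompose_point x tau c i : c00 x -> tau < c -> exists Ts,
  terminal x tau c (osum beta) Ts /\ `|x i| <= tree_value Ts.
Proof.
move=> cx tc; have [xi|xi] := eqVneq (x i) 0.
  exists [::]; split; first exact: terminal_nil.
  by rewrite xi normr0 /tree_value big_nil.
have [b xb] := cx; have i0 : (0 < i)%N.
  by rewrite lt0n; apply: contraNneq xi => ->; rewrite xb.
exists [:: ([::], [:: i], `|x i|)]; split; last by rewrite /tree_value big_seq1 /coef big_nil mul1r.
apply: (@terminal1 _ _ _ _ _ _ i) => //; first by rewrite fset_pos_cons i0.
  by move=> q; rewrite inE => /eqP ->.
by split; [rewrite mem_head|left].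
Qed.

(** Recursion along the iterates: a coordinate gives a leaf, a splitting that keeps the coefficient
    above [tau] is expanded, any other ends in a single node. The loss [e] avoids having to realize
    the suprema. *)
Lemma decompose k x tau c (e : R) : c00 x -> tau < c -> 0 < e -> exists Ts,
  terminal x tau c (osum beta) Ts /\ norm_it k x <= tree_value Ts + e.
Proof.
elim: k x c e => [|k IH] x c e cx tc e0.
  apply: contrapT => /forallNP H.
  have : supnorm x <= supnorm x - e.
    apply: supnorm_le => i; have [Ts [tT xT]] := decompose_point i cx tc.
    rewrite leNgt; apply/negP => lt; apply: (H Ts); split=> //=.
    by rewrite -lerBlDr (le_trans _ xT) // ltW.
  by rewrite lerBrDr gerDl leNgt e0.
apply: contrapT => /forallNP H.
have e20 : 0 < e / 2 by rewrite divr_gt0.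
have : norm_it k.+1 x <= norm_it k.+1 x - e / 2; last by rewrite lerBrDr gerDl leNgt e20.
apply: tnorm_it_le => [i|n Es n0 adm].
  have [Ts [tT xT]] := decompose_point i cx tc.
  rewrite leNgt; apply/negP => lt; apply: (H Ts); split=> //.
  lra.
have /andP[t0 t1] := theta01 n0.
rewrite leNgt; apply/negP => lt.
have [cn|cn] := leP (c * theta n) tau.
  have [F [pF FE]] := c00_supp cx.
  have sF : supported F x by move=> i; rewrite FE negbK => /eqP.
  have [F0|nF] := eqVneq F [::].
    apply: (H [::]); split; first exact: terminal_nil.
    have /andP[_] := tnorm_it_ge0_le_l1 beta theta01 k.+1 pF sF.
    by rewrite /tree_value F0 !big_nil add0r => /le_trans; apply; exact: ltW.
  pose v := theta n * \sum_(E <- Es) norm_it k (restr E x).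
  apply: (H [:: ([::], F, v)]); split.
    apply: (@terminal1 _ _ _ _ _ _ (fmin F)) => //; first by move=> q; rewrite FE.
    split; first exact: fmin_mem.
    right; exists n, Es; split=> //; first by rewrite /coef big_nil mulr1.
    rewrite ler_pM2l // (restr_id (F := F)) //; apply: ler_sum => E _.
    by apply: tnorm_it_le_tnorm => //; exact: c00_restr.
  have -> : tree_value [:: ([::], F, v)] = v by rewrite /tree_value big_seq1 /coef big_nil mul1r.
  rewrite -/v in lt; lra.
move: H lt; set Nk := norm_it k.+1 x => H lt.
pose d := e / 2 / (size Es).+1%:R.
have d0 : 0 < d by rewrite divr_gt0.
have [E EEs|TsF TsP] := @choice_seq _ _ (fun E Ts => terminal (restr E x) tau (c * theta n) (osum beta) Ts /\
    norm_it k (restr E x) <= tree_value Ts + d) Es [::].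
  by apply: IH => //; exact: c00_restr.
apply: (H (map (relabel n) (flatten (map TsF Es)))); split.
  apply: terminal_relabel => //; apply: terminal_flatten => // E /TsP[].
  by [].
rewrite tree_value_relabel {1}/tree_value big_flatten big_map.
have : theta n * \sum_(E <- Es) norm_it k (restr E x) <=
    theta n * \sum_(E <- Es) (tree_value (TsF E) + d).
  by rewrite ler_pM2l // big_seq [leRHS]big_seq; apply: ler_sum => E /TsP[].
rewrite big_split /= mulrDr big_const_seq iter_addr_0 count_predT.
have : theta n * (d *+ size Es) <= e / 2.
  apply: (@le_trans _ _ (1 * (d *+ size Es))).
    by apply: ler_wpM2r; [rewrite mulrn_wge0 // ltW|exact: ltW].
  by rewrite mul1r -[leLHS]mulr_natr /d mulrAC ler_pdivrMr // ler_pM2l // ler_nat.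
rewrite /tree_value; lra.
Qed.
End Decomposition.

Lemma sum_has_le (R : realType) (T : eqType) (S : seq T) (Q : T -> nat -> bool) (F : seq nat) (z : nat -> R) :
  (forall i, 0 <= z i) ->
  \sum_(i <- F | has (Q^~ i) S) z i <= \sum_(s <- S) \sum_(i <- F | Q s i) z i.
Proof.
move=> z0; elim: S => [|s S IH]; first by rewrite big_nil big_pred0.
rewrite big_cons; apply: le_trans (lerD (lexx _) IH).
rewrite [leLHS]big_mkcond [X in _ <= X + _]big_mkcond [X in _ <= _ + X]big_mkcond -big_split /=.
apply: ler_sum => i _; case: (Q s i); case: (has _ S) => //=; rewrite ?addr0 ?add0r //.
by rewrite lerDl.
Qed.

(** * Norm estimate for one level of the nested average *)

Section LevelBound.
Variables (R : realType) (theta : nat -> R) (beta : nat -> ord).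
Hypothesis theta01 : forall n, (0 < n)%N -> 0 < theta n < 1.
Hypothesis theta_noninc : forall n, (0 < n)%N -> theta n.+1 <= theta n.
Local Notation norm := (tnorm theta beta).
Local Notation coef := (coef theta).

Variables (eps delta C K W W1 eta : R) (l N t0 : nat) (a : ord).
Variables (F : seq nat) (z : nat -> R) (B : nat -> nat) (Y : nat -> nat -> R).
Variable S : seq (seq nat).
Hypotheses (l0 : (0 < l)%N) (eps0 : 0 < eps) (C0 : 0 <= C).
Let tau := theta l / eps.
Hypothesis tau1 : tau < 1.
Hypotheses (pF : fset_pos F) (z0 : forall p, 0 <= z p) (sz : \sum_(p <- F) z p = 1).
Hypothesis nF : small_on z F a eta.
Hypothesis BF : forall i j, i \in F -> j \in F -> (i < j)%N -> (B i < j)%N.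
Hypothesis cY : forall i, i \in F -> c00 (Y i).
Hypothesis YB : forall i p, i \in F -> Y i p != 0 -> (i <= p <= B i)%N.
Hypothesis iB : forall i, i \in F -> (i <= B i)%N.
Hypothesis YC : forall i, i \in F -> norm (Y i) <= C.
Hypothesis YN : forall i n Es, i \in F -> (0 < n <= N)%N -> admissible (inS (beta n)) Es ->
  \sum_(E <- Es) norm (restr E (Y i)) <= C.
Hypothesis YW : forall i G, i \in F -> fset_pos G -> \sum_(p <- G) `|Y i p| <= W1.
Hypothesis thetaN : forall n, (N < n)%N -> theta n <= delta * theta l.
Hypothesis KC : (1 + theta l * C) / eps <= K.
Hypothesis Kd : delta + C <= K.
Hypothesis W1W : (theta l)^-1 + W1 <= W.

Definition unit_vec (i p : nat) : R := if p == i then 1 else 0.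
Let V i p := (theta l)^-1 * unit_vec i p + Y i p.
Let x p := \sum_(i <- F) z i * V i p.

Hypothesis labS : forall s, all (fun n => 0 < n)%N s -> tau < coef s -> s \in S /\
  forall P, fset_pos P -> (forall p, p \in P -> x p != 0) ->
    inS (oadd (osum beta s) (beta t0)) P -> inS a P.

Let thl0 : 0 < theta l. Proof. by have /andP[] := theta01 l0. Qed.
Let tau0 : 0 < tau. Proof. by rewrite divr_gt0. Qed.

Let in_block i p := (i <= p <= B i)%N.

Lemma c00_unit_vec i : (0 < i)%N -> c00 (unit_vec i).
Proof.
move=> i0; apply: (@supported_c00 R [:: i]); first by rewrite fset_pos_cons i0.
by move=> p; rewrite inE /unit_vec => /negbTE ->.
Qed.

Let Fpos i : i \in F -> (0 < i)%N. Proof. exact: fset_pos_gt0. Qed.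

Let cV i : i \in F -> c00 (V i).
Proof.
by move=> iF; apply: c00D; [apply/c00Z/c00_unit_vec/Fpos|exact: cY].
Qed.

Let VB i p : i \in F -> V i p != 0 -> in_block i p.
Proof.
move=> iF; have [->|pi] := eqVneq p i; first by rewrite /in_block leqnn iB.
by rewrite /V /unit_vec (negbTE pi) mulr0 add0r; exact: YB.
Qed.

Lemma level_l1 i G : i \in F -> fset_pos G -> \sum_(p <- G) `|V i p| <= W.
Proof.
move=> iF pG; apply: le_trans W1W.
apply: (@le_trans _ _ (\sum_(p <- G) ((theta l)^-1 * unit_vec i p + `|Y i p|))).
  apply: ler_sum => p _; apply: le_trans (ler_normD _ _) _; rewrite lerD2r ger0_norm //.
  by rewrite mulr_ge0 ?invr_ge0 ?(ltW thl0) // /unit_vec; case: ifP.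
rewrite big_split /= lerD ?YW // -mulr_sumr ler_piMr ?invr_ge0 ?(ltW thl0) //.
rewrite /unit_vec -big_mkcond /= big_const_seq iter_addr_0 -[leRHS]/(1%:R) ler_nat.
by rewrite (count_uniq_mem _ (fset_pos_uniq pG)) leq_b1.
Qed.

Let cx : c00 x.
Proof. by apply: (c00_sum (v := fun i p => z i * V i p)) => i /cV; exact: c00Z. Qed.

Let W0 : 0 <= W.
Proof.
have : exists s, s \in F.
  by case: (F) sz => [|s F' _]; [rewrite big_nil => /eqP; rewrite eq_sym oner_eq0|exists s; rewrite mem_head].
by move=> [s sF]; have := @level_l1 s [::] sF isT; rewrite big_nil.
Qed.

Let K0 : 0 <= K.
Proof.
apply: le_trans KC; rewrite divr_ge0 ?(ltW eps0) // addr_ge0 // mulr_ge0 //; exact: ltW.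
Qed.

(** For n <= N the coefficient, at most [tau], pays both for the unit vector and for the bounded sum
    over [Y i]. For n > N, [theta n] is tiny against [theta l], so the unit vector contributes at
    most [delta], and the rest is bounded by the norm of [Y i]. *)
Lemma split_good i n Es c G : i \in F -> (0 < n)%N -> admissible (inS (beta n)) Es ->
  0 < c <= 1 -> c * theta n <= tau ->
  c * (theta n * \sum_(E <- Es) norm (restr E (restr G (V i)))) <= K.
Proof.
move=> iF n0 adm /andP[c0 c1] ctau; have /andP[tn0 tn1] := theta01 n0.
have cG : c00 (restr G (Y i)) by apply: c00_restr; exact: cY.
have pi : fset_pos [:: i] by rewrite fset_pos_cons Fpos.
have su : supported [:: i] (unit_vec i) by move=> p; rewrite inE /unit_vec => /negbTE ->.
pose SY := \sum_(E <- Es) norm (restr E (restr G (Y i))).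
have Vle : \sum_(E <- Es) norm (restr E (restr G (V i))) <= (theta l)^-1 + SY.
  apply: (@le_trans _ _ (\sum_(E <- Es) ((theta l)^-1 * (\sum_(p <- [:: i]) `|restr E (restr G (unit_vec i)) p|)
      + norm (restr E (restr G (Y i)))))).
    apply: ler_sum => E _; rewrite /V restrD restrD restrZ restrZ.
    apply: le_trans (tnormD _ theta01 _ _) _.
    - by apply/c00Z/c00_restr/c00_restr/c00_unit_vec/Fpos.
    - exact/c00_restr.
    rewrite lerD2r; apply: le_trans (tnormZ_le _ theta01 _ _) _.
      by apply/c00_restr/c00_restr/c00_unit_vec/Fpos.
    rewrite ger0_norm ?invr_ge0 ?(ltW thl0) // ler_wpM2l ?invr_ge0 ?(ltW thl0) //.
    by apply: tnorm_le_l1 => //; exact/supported_restr/supported_restr.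
  rewrite big_split /= lerD2r -mulr_sumr ler_piMr ?invr_ge0 ?(ltW thl0) //.
  apply: le_trans (l1_successive _ _ adm.1) _; rewrite big_seq1.
  apply: le_trans (normr_restr _ _ _) _; rewrite /unit_vec eqxx normr1 //.
have SY0 : 0 <= SY.
  by apply: sumr_ge0 => E _; apply: tnorm_ge0 => //; exact: c00_restr.
apply: (@le_trans _ _ (c * (theta n * ((theta l)^-1 + SY)))).
  by rewrite ler_pM2l // ler_pM2l.
have [nN|Nn] := leqP n N.
  apply: le_trans KC; rewrite mulrA.
  have -> : (1 + theta l * C) / eps = tau * ((theta l)^-1 + C).
    by rewrite /tau; field; rewrite !gt_eqF.
  apply: ler_pM => //; [by rewrite mulr_ge0 // ltW|by rewrite addr_ge0 // invr_ge0 ltW|].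
  rewrite lerD2l; have n0N : (0 < n <= N)%N by rewrite n0.
  apply: le_trans (YN iF n0N adm); apply: ler_sum => E _; rewrite restr_filter.
  rewrite /SY; apply: tnorm_mono => //; first by apply: c00_restr; exact: cY.
  by move=> p; rewrite /restr mem_filter andbC; case: (p \in E) => //=; case: ifP => // _; rewrite normr0.
apply: le_trans Kd; apply: (@le_trans _ _ (1 * (theta n * ((theta l)^-1 + SY)))).
  by apply: ler_wpM2r => //; rewrite mulr_ge0 ?(ltW tn0) // addr_ge0 // invr_ge0 ltW.
rewrite mul1r mulrDr; apply: lerD; first by rewrite ler_pdivrMr // thetaN.
apply: le_trans (YC iF); apply: le_trans (tnorm_restr beta theta01 G (cY iF)).
exact: tnorm_adm.
Qed.

(** A block is bad if it contains the minimum or the chosen coordinate of a terminal node. For each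
    word in [S] these points form two sets of [inS a], so bad blocks weigh at most [4 * eta] per
    word, and they are charged their l1 norm. A good block meets at most one terminal node and
    contributes only through a stopped splitting, where [split_good] applies. *)
Lemma level_bound Es : admissible (inS (beta t0)) Es ->
  \sum_(E <- Es) norm (restr E x) <= K + 4 * (size S)%:R * eta * W.
Proof.
move=> adm; apply/ler_addgt0Pr => e e0.
pose d := e / (size Es).+1%:R.
have d0 : 0 < d by rewrite divr_gt0.
have d20 : 0 < d / 2 by rewrite divr_gt0.
have [E EEs|TsF TsP] := @choice_seq _ _ (fun E Ts =>
    terminal theta beta (restr E x) tau 1 (osum beta) Ts /\
    norm (restr E x) <= tree_value theta Ts + d) Es [::].
  have [k Hk] : exists k, norm (restr E x) - d / 2 <= tnorm_it theta beta k (restr E x).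
    apply: contrapT => /forallNP H.
    have : norm (restr E x) <= norm (restr E x) - d / 2.
      by apply: tnorm_le_it => k; have /negP := H k; rewrite -ltNge => /ltW.
    by rewrite lerBrDr gerDl leNgt d20.
  have [Ts [tT HT]] := decompose beta theta01 k (c00_restr E cx) tau1 d20.
  by exists Ts; split=> //; lra.
apply: (@le_trans _ _ (\sum_(E <- Es) (tree_value theta (TsF E) + d))).
  by rewrite big_seq [leRHS]big_seq; apply: ler_sum => E /TsP[].
rewrite big_split /=; apply: lerD; last first.
  rewrite big_const_seq iter_addr_0 count_predT -[leLHS]mulr_natr /d mulrAC.
  by rewrite ler_pdivrMr // ler_pM2l // ler_nat.
have := terminal_flatten adm (fun E EEs => proj1 (TsP E EEs)).
set Ts := flatten _ => -[sT xT bT cT].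
have -> : \sum_(E <- Es) tree_value theta (TsF E) = tree_value theta Ts.
  by rewrite /tree_value big_flatten big_map.
have cT1 T : T \in Ts -> 0 < coef (lab T) <= 1.
  by move=> /cT[Tpos _ _]; rewrite prod_theta_gt0 // prod_theta_le1.
have labT T : T \in Ts -> lab T \in S.
  by move=> /cT[Tpos + _]; rewrite mul1r => /(labS Tpos)[].
have [T TTs|pt ptP] := @choice_seq _ _ (fun T p => leaf_value theta beta x tau 1 T p) Ts 0%N.
  by case: (cT T TTs).
pose Tl s := [seq T <- Ts | lab T == s].
have TlT s T : T \in Tl s -> T \in Ts by rewrite mem_filter => /andP[].
have sTl s : successive (map (@nset R) (Tl s)).
  by apply: successive_subseq sT; exact/map_subseq/filter_subseq.
have admT s : admissible (inS (oadd (osum beta s) (beta t0))) (map (@nset R) (Tl s)).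
  by split; [exact: sTl|exact: bT].
pose P1 s := map fmin (map (@nset R) (Tl s)).
pose P2 s := map pt (Tl s).
have P2P s : fset_pos (P2 s) /\ inS (oadd (osum beta s) (beta t0)) (P2 s).
  apply: admissible_points (admT s) _ => T /TlT TTs; by case: (ptP T TTs).
pose bad1 s i := has (in_block i) (P1 s).
pose bad2 s i := has (in_block i) (P2 s).
pose bad i := has (fun s => bad1 s i || bad2 s i) S.
have eta0 : 0 <= eta.
  by apply: le_trans (nF _ (inS_nil a)) => //; exact: mass_ge0.
have aP s P : s \in S -> fset_pos P -> (forall p, p \in P -> exists2 T, T \in Tl s & p \in nset T) ->
    inS (oadd (osum beta s) (beta t0)) P -> inS a P.
  move=> sS pP PT oP; have [P0|nP] := eqVneq P [::]; first by rewrite P0; exact: inS_nil.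
  have [T TT _] := PT _ (fmin_mem nP).
  have Ts' := TlT _ _ TT; have [Tpos + _] := cT T Ts'; rewrite mul1r.
  move: TT; rewrite mem_filter => /andP[/eqP lT _] /(labS Tpos)[_ H].
  apply: H => //; last by rewrite lT.
  by move=> p /PT[T' /TlT T'T pT']; exact: xT T'T pT'.
have bad_mass : \sum_(i <- F | bad i) z i <= 4 * (size S)%:R * eta.
  apply: le_trans (sum_has_le S (fun s i => bad1 s i || bad2 s i) F z0) _.
  apply: (@le_trans _ _ (\sum_(s <- S) (4 * eta))); last first.
    by rewrite big_const_seq iter_addr_0 count_predT -[leLHS]mulr_natr mulrAC.
  rewrite big_seq [leRHS]big_seq; apply: ler_sum => s sS.
  apply: (@le_trans _ _ (\sum_(i <- F | bad1 s i) z i + \sum_(i <- F | bad2 s i) z i)).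
    rewrite [leLHS]big_mkcond [X in _ <= X + _]big_mkcond [X in _ <= _ + X]big_mkcond -big_split /=.
    apply: ler_sum => i _; case: (bad1 s i); case: (bad2 s i) => //=; rewrite ?addr0 ?add0r //.
    by rewrite lerDl.
  have -> : 4 * eta = 2 * eta + 2 * eta by lra.
  apply: lerD; apply: (hit_mass pF z0 nF BF).
  - exact: mins_fset_pos (sTl s).
  - apply: (aP s _ sS (mins_fset_pos (sTl s)) _ (bT s)) => _ /mapP[_ /mapP[T TT ->] ->].
    exists T => //; apply: fmin_mem.
    by apply: successive_nonempty (sTl s) _; exact: map_f.
  - by case: (P2P s).
  - have [pP2 oP2] := P2P s; apply: (aP s _ sS pP2 _ oP2) => _ /mapP[T TT ->].
    by exists T => //; have [] := ptP T (TlT _ _ TT).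
pose hit i (T : node R) := has (in_block i) (nset T).
pose val T i := if bad i then z i * \sum_(p <- nset T) `|V i p|
                else if hit i T then z i * K else 0.
have val0 T i : 0 <= val T i.
  rewrite /val; case: ifP => _; first by rewrite mulr_ge0 // sumr_ge0.
  by case: ifP => // _; rewrite mulr_ge0.
have Tval T : T \in Ts -> coef (lab T) * T.2 <= \sum_(i <- F) val T i.
  move=> TTs; have /andP[c0 c1] := cT1 T TTs; have [pT [Tx|[n [Ds [n0 aDs cn Tv]]]]] := ptP T TTs.
    apply: (@le_trans _ _ `|x (pt T)|).
      have [T0|T0] := lerP 0 T.2; first by apply: le_trans Tx; rewrite ler_piMl.
      by apply: (@le_trans _ _ 0) => //; rewrite nmulr_lle0 ?ltW.
    apply: le_trans (ler_norm_sum _ _ _) _; rewrite big_seq [leRHS]big_seq; apply: ler_sum => i iF.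
    have [V0|Vn] := eqVneq (V i (pt T)) 0; first by rewrite V0 mulr0 normr0.
    have bi : bad i.
      apply/hasP; exists (lab T); first exact: labT.
      apply/orP; right; apply/hasP; exists (pt T); last exact: VB.
      by apply: map_f; rewrite mem_filter eqxx.
    rewrite /val bi normrM ger0_norm // ler_wpM2l //.
    by rewrite (big_rem (pt T) pT) /= lerDl sumr_ge0.
  rewrite mul1r in cn; have /andP[tn0 tn1] := theta01 n0.
  apply: (@le_trans _ _ (\sum_(i <- F) z i *
      (coef (lab T) * (theta n * \sum_(E <- Ds) norm (restr E (restr (nset T) (V i))))))).
    apply: (@le_trans _ _ (coef (lab T) * (theta n * \sum_(E <- Ds) norm (restr E (restr (nset T) x))))).
      by rewrite ler_pM2l.
    under [leRHS]eq_bigr do rewrite mulrCA [z _ * (theta n * _)]mulrCA mulr_sumr.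
    rewrite -!mulr_sumr ler_pM2l // ler_pM2l // exchange_big /=; apply: ler_sum => E _.
    have -> : restr E (restr (nset T) x) = (fun p => \sum_(i <- F) z i * restr E (restr (nset T) (V i)) p).
      rewrite /x (restr_sum (nset T) F (fun i p => z i * V i p)) restr_sum.
      by apply: funext => p; apply: eq_bigr => i _; rewrite !restrZ.
    apply: le_trans (tnorm_lincomb beta theta01 z (v := fun i => restr E (restr (nset T) (V i))) _) _.
      by move=> i /cV ?; exact/c00_restr/c00_restr.
    by apply: ler_sum => i _; rewrite ger0_norm.
  rewrite big_seq [leRHS]big_seq; apply: ler_sum => i iF.
  rewrite /val; case: ifP => [_|nb].
    rewrite ler_wpM2l //; apply: (@le_trans _ _ (norm (restr (nset T) (V i)))).
      apply: (@le_trans _ _ (1 * (theta n * \sum_(E <- Ds) norm (restr E (restr (nset T) (V i)))))).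
        apply: ler_wpM2r => //; rewrite mulr_ge0 ?(ltW tn0) //; apply: sumr_ge0 => E _.
        by apply: tnorm_ge0 => //; exact/c00_restr/c00_restr/cV.
      by rewrite mul1r; apply: tnorm_adm => //; exact/c00_restr/cV.
    have pG : fset_pos (nset T) by apply: successive_fset_pos sT _; exact: map_f.
    apply: le_trans (tnorm_le_l1 beta theta01 pG _) _.
      by move=> p; rewrite /restr => /negbTE ->.
    by rewrite big_seq [leRHS]big_seq; apply: ler_sum => p pG'; rewrite /restr pG'.
  case: ifP => [_|nh]; first by rewrite ler_wpM2l // split_good // c0.
  have -> : restr (nset T) (V i) = fun=> 0.
    apply: funext => p; rewrite /restr; case: ifP => // pG.
    apply/eqP/negPn/negP => /(VB iF) pb; move/negbT/hasPn: nh => /(_ p pG).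
    by rewrite pb.
  rewrite big1 ?mulr0 // => E _; by rewrite restr0 tnorm0.
rewrite /tree_value; apply: (@le_trans _ _ (\sum_(T <- Ts) \sum_(i <- F) val T i)).
  by rewrite big_seq [leRHS]big_seq; apply: ler_sum => T; exact: Tval.
rewrite exchange_big /=.
apply: (@le_trans _ _ (\sum_(i <- F) (z i * K + (if bad i then z i else 0) * W))).
  rewrite big_seq [leRHS]big_seq; apply: ler_sum => i iF; rewrite /val.
  have [bi|nbi] := boolP (bad i).
    rewrite -mulr_sumr -mulrDr ler_wpM2l //; apply: ler_wpDl => //.
    have := level_l1 iF (proj2 (proj1 (successiveE _) sT)).
    by rewrite big_flatten big_map.
  rewrite mul0r addr0; apply: (sum_count_le (hit := hit i)) => //.
  - by rewrite mulr_ge0.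
  - apply: count_hit_le1 => //; apply/hasPn => _ /mapP[_ /mapP[T TTs ->] ->].
    move/hasPn: nbi => /(_ (lab T) (labT T TTs)); rewrite negb_or => /andP[/hasPn nb1 _].
    by apply: nb1; do 2 apply: map_f; rewrite mem_filter eqxx.
  - by move=> T _ /negbTE ->.
  - by move=> T _ ->.
rewrite big_split /= -!mulr_suml sz mul1r lerD2l -big_mkcond /=.
by apply: ler_wpM2r.
Qed.
End LevelBound.

(** The sum own (j + d) + ... + own j: as in [osum], the outermost family is the last summand, here
    level j. *)
Fixpoint ord_tower (own : nat -> ord) (j d : nat) : ord :=
  if d is d'.+1 then oadd (ord_tower own j.+1 d') (own j) else own j.

(** The definition adds an outer level, which is how the vectors are built; this form adds an inner
    one, which is how the levels are chosen. *)
Lemma ord_towerS own j d :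
  ord_tower own j d.+1 = oadd (own (j + d.+1)%N) (ord_tower own j d).
Proof.
elim: d j => [|d IH] j; first by rewrite /= addn1.
have -> : ord_tower own j d.+2 = oadd (ord_tower own j.+1 d.+1) (own j) by [].
by rewrite IH -oaddA addSnnS.
Qed.

(** * Choice of levels and construction of the nested vectors *)

Section Positive.
Variables (R : realType) (theta : nat -> R) (xi : ord) (beta : nat -> ord).
Hypothesis theta01 : forall n, (0 < n)%N -> 0 < theta n < 1.
Hypothesis theta_noninc : forall n, (0 < n)%N -> theta n.+1 <= theta n.
Hypothesis theta_to0 : theta @ \oo --> (0 : R).
Hypothesis xi0 : olt OZero xi.
Hypothesis beta_wf : forall n, (0 < n)%N -> owf (beta n).
Hypothesis beta_lt : forall n, (0 < n)%N -> olt (beta n) (opw xi).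
Local Notation norm := (tnorm theta beta).
Variable f : nat -> ord.
Hypothesis f_wf : forall k, owf (f k).
Hypothesis f_lt : forall k, olt (f k) (opw xi).
Variable eps : R.
Hypothesis eps0 : 0 < eps.
Hypothesis dag : forall b, olt b (opw xi) -> exists m, (0 < m)%N /\
  exists g, is_gamma theta beta eps m g /\ olt (oadd (oadd g (ofin 2)) b) (beta m).

Let alpha (g b : nat -> ord) j := oadd (oadd (g j) (ofin 2)) (b j).

(** [N j] separates scales: [b j] dominates [beta t] for t <= N j, the outer splittings allowed at
    level j, while beyond [N j.+1] the weights are negligible against [theta (l j)]. The term
    [f j.+1] leaves room in [beta (l j)] for as many supports as that family indexes. *)
Definition levels (l : nat -> nat) (g b : nat -> ord) (N : nat -> nat) := forall j,
  [/\ [/\ (0 < l j)%N, (N j < l j)%N & (N j <= N j.+1)%N],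
      is_gamma theta beta eps (l j) (g j),
      owf (b j) /\ (forall t, (0 < t <= N j)%N -> olt (beta t) (b j)),
      owf (ord_tower (fun j => OSucc (alpha g b j)) 0 j) /\
      olt (oadd (ord_tower (fun j => OSucc (alpha g b j)) 0 j) (f j.+1)) (beta (l j))
    & forall n, (N j.+1 < n)%N -> theta n <= 2^-1 ^+ j.+1 * theta (l j)].

Lemma beta_bound n : exists b, [/\ owf b, olt b (opw xi)
  & forall t, (0 < t <= n)%N -> olt (beta t) b].
Proof.
elim: n => [|n [b [wb bW Hb]]].
  by exists OZero; split=> [| |[]] //; exact: opw_ge1.
have [bn|nb] := ole_total b (beta n.+1).
  exists (OSucc (beta n.+1)); split=> [| |t /andP[t0]].
  - exact: beta_wf.
  - by apply: opw_succ => //; exact: beta_lt.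
  - rewrite leq_eqVlt => /orP[/eqP ->|tn]; first by apply/oltS; exact: ole_refl.
    apply/oltS; apply: ole_trans bn; apply: oltW; apply: Hb.
    by rewrite t0.
exists b; split=> // t /andP[t0]; rewrite leq_eqVlt => /orP[/eqP ->//|tn].
by apply: Hb; rewrite t0.
Qed.

Lemma levels_exist N0 : exists l g b N, N 0%N = N0 /\ levels l g b N.
Proof.
pose T : Type := nat * ord * ord * ord * nat.
pose sl (u : T) := u.1.1.1.1; pose sg (u : T) := u.1.1.1.2.
pose sb (u : T) := u.1.1.2; pose sR (u : T) := u.1.2; pose sN (u : T) := u.2.
pose I (j : nat) (u : T) := owf (sR u) /\ olt (sR u) (opw xi).
pose Q j (u v : T) :=
  [/\ [/\ (0 < sl v)%N, (sN u < sl v)%N & (sN u <= sN v)%N],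
      is_gamma theta beta eps (sl v) (sg v),
      owf (sb v) /\ (forall t, (0 < t <= sN u)%N -> olt (beta t) (sb v)),
      sR v = oadd (OSucc (oadd (oadd (sg v) (ofin 2)) (sb v))) (sR u) /\
      olt (oadd (sR v) (f j.+1)) (beta (sl v))
    & forall n, (sN v < n)%N -> theta n <= 2^-1 ^+ j.+1 * theta (sl v)].
pose x0 : T := (0%N, OZero, OZero, OZero, N0).
have I0 : I 0%N x0 by split=> //; exact: opw_ge1.
have [|F [F0 FP]] := @dependent_choice_nat T I Q x0 I0.
  move=> j u [wR RW]; have [b [wb bW Hb]] := beta_bound (sN u).
  (* By associativity g + 2 + (b + 1) + R + f (j + 1) is the new tower followed by f (j + 1),
     exactly what must lie below [beta m]. *)
  have [|m [m0 [g [gg lt]]]] := dag (b := oadd (OSucc b) (oadd (sR u) (f j.+1))).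
    by apply: opw_add; [exact: opw_succ|exact: opw_add].
  have wg : owf g by exact: is_gamma_owf gg.
  have /andP[tm0 tm1] := theta01 m0.
  have [|n1 Hn1] := theta_small theta_to0 (e := 2^-1 ^+ j.+1 * theta m).
    by rewrite mulr_gt0 // exprn_gt0.
  pose R' := oadd (OSucc (oadd (oadd g (ofin 2)) b)) (sR u).
  have RE : oadd (oadd g (ofin 2)) (oadd (OSucc b) (oadd (sR u) (f j.+1))) = oadd R' (f j.+1).
    by rewrite !oaddA.
  have wR' : owf R'.
    by apply: owf_add => //; apply: owf_add => //; apply: owf_add => //; exact: owf_ofin.
  exists (m, g, b, R', maxn (sN u) n1); split.
    split=> //; apply: ole_olt_trans (beta_lt m0); apply: ole_trans (oltW lt).
    by rewrite RE; exact: ole_addr.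
  split=> //=.
  - split=> //; last exact: leq_maxl.
    rewrite ltnNge; apply/negP => mN.
    have mb : olt (beta m) b by apply: Hb; rewrite m0.
    apply: (@olt_irr b); apply: ole_olt_trans mb; apply: ole_trans (oltW lt).
    apply: ole_trans (ole_addl _ _); apply: ole_trans (ole_addr _ _); exact: oleS.
  - by split=> //; rewrite -RE.
  - move=> n; rewrite gtn_max => /andP[_ nn]; apply/ltW/Hn1; first exact: ltnW.
    exact: leq_ltn_trans nn.
pose own j := OSucc (oadd (oadd (sg (F j.+1)) (ofin 2)) (sb (F j.+1))).
have RE j : sR (F j.+1) = ord_tower own 0 j.
  elim: j => [|j IH]; first by have [_ [_ _ _ [-> _] _]] := FP 0%N; rewrite F0.
  by have [_ [_ _ _ [-> _] _]] := FP j.+1; rewrite IH ord_towerS add0n.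
exists (fun j => sl (F j.+1)), (fun j => sg (F j.+1)), (fun j => sb (F j.+1)), (fun j => sN (F j)).
split; first by rewrite F0.
move=> j; have [_ [H1 H2 H3 [_ H4] H5]] := FP j; have [[wR _] _] := FP j.+1.
split=> //; rewrite -[ord_tower _ _ _]/(ord_tower own 0 j) -RE; split=> //.
Qed.

Variables (l : nat -> nat) (g b : nat -> ord) (N : nat -> nat).
Hypothesis lv : levels l g b N.
Hypothesis N1 : (0 < N 0)%N.
Hypothesis theta_l : forall j, theta (l j) <= eps / 2 /\ theta (l j) * (2 / eps + 4) <= 1.

Let al := alpha g b.
Let own j := OSucc (al j).
Local Notation tower := (ord_tower own).

Let Npos j : (0 < N j)%N.
Proof. by elim: j => // j; have [[_ _ H] _ _ _ _] := lv j; move=> /leq_trans; apply. Qed.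

Let wal j : owf (al j).
Proof.
have [_ gg [wb _] _ _] := lv j.
by apply: owf_add => //; apply: owf_add; [exact: is_gamma_owf gg|exact: owf_ofin].
Qed.

(** [g j] bounds the complexity of the word and [b j] that of the outer family; the averages of
    level j, small on [inS (al j)], therefore do not see the nodes above the threshold. *)
Lemma label_lt j s t : all (fun n => 0 < n)%N s -> theta (l j) / eps < coef theta s ->
  (0 < t <= N j)%N -> olt (oadd (osum beta s) (beta t)) (al j).
Proof.
move=> spos ts tN; have [_ gg [_ Hb] _ _] := lv j.
have sg : ole (osum beta s) (g j).
  case: (eqVneq s [::]) => [->|ns]; first exact: ole_zero.
  have gs : gamma_set theta eps (l j) s.
    by split=> //; split=> //; move: ts; rewrite ltr_pdivrMr // mulrC.
  case: gg => [[g0 _]|[_ Hg]]; last exact: Hg.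
  by move: gs; rewrite g0.
apply: ole_olt_trans (olt_add2l _ (Hb t tN)); apply: ole_add2r.
exact: ole_trans sg (ole_addr _ _).
Qed.

Definition label_list j (S : seq (seq nat)) := forall s,
  all (fun n => 0 < n)%N s -> theta (l j) / eps < coef theta s -> s \in S.

Lemma label_list_exists j : exists S, label_list j S.
Proof.
have [[l0 _ _] _ _ _ _] := lv j; have /andP[t0 _] := theta01 l0.
have [S HS] := finite_labels theta01 theta_noninc theta_to0 (divr_gt0 t0 eps0).
by exists S => s; exact: HS.
Qed.

Definition good_level (A : set nat) j :=
  (forall s t, all (fun n => 0 < n)%N s -> theta (l j) / eps < coef theta s ->
     (0 < t <= N j)%N -> schreier_sub A (oadd (osum beta s) (beta t)) (al j)) /\
  schreier_sub A (oadd (tower 0 j) (f j.+1)) (beta (l j)).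

Lemma good_levels_exist M : unbounded M -> exists L, [/\ L `<=` M, unbounded L
  & forall l0, L l0 -> forall j, (j <= l0)%N -> good_level (L `&` [set p | (l0 < p)%N]) j].
Proof.
move=> uM; apply: (diagonal_thinning (P := fun j A => good_level A j)) => //.
  move=> j A B BA [H1 H2]; split; last exact: schreier_subS BA H2.
  by move=> s t spos ts tN; apply: schreier_subS BA _; exact: H1.
move=> j A uA; have [S HS] := label_list_exists j.
have [[l0 _ _] _ _ [wt lt] _] := lv j.
pose S' := [seq s <- S | all (fun n => 0 < n)%N s && (theta (l j) / eps < coef theta s)].
have [x|B [BA uB HB]] := @schreier_sub_thinnable_seq _ (fun x : seq nat * nat => oadd (osum beta x.1) (beta x.2))
    (fun=> al j) [seq (s, t) | s <- S', t <- iota 1 (N j)] _ A uA.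
  move=> /allpairsP[[s t] /= [+ + ->]] /=; rewrite mem_filter mem_iota add1n ltnS.
  move=> /andP[/andP[spos ts] _] tN; have /andP[t0 _] := tN.
  by split; [apply: owf_add; [exact: osum_owf|exact: beta_wf]|exact: wal|exact: label_lt].
have [C [CB uC HC]] := schreier_sub_thinnable (owf_add wt (f_wf j.+1)) (beta_wf l0) lt uB.
exists C; split=> [x /CB/BA| |] //; split=> // s t spos ts tN.
apply: schreier_subS CB _; apply: (HB (s, t)); apply/allpairsP; exists (s, t); split=> //=.
  by rewrite mem_filter spos ts HS.
by rewrite mem_iota add1n ltnS.
Qed.

Variable L : set nat.
Hypothesis uL : unbounded L.
Hypothesis goodL : forall l0, L l0 -> forall j, (j <= l0)%N -> good_level (L `&` [set p | (l0 < p)%N]) j.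

(** Passing from level j + 1 to level j costs 2^-(j+1) twice, for [delta] and for the bad blocks,
    and the geometric term leaves room for this. The part [2 / eps] covers the case where the tree
    exploits the unit vectors. *)
Definition level_norm j : R := 2 / eps + 4 * 2^-1 ^+ j.

(* A vector built from the levels j, ..., j + d - 1.  The bound on admissible sums with
   t <= N j, rather than just on the norm, is what the previous level needs. *)
Definition level_vector d j P W (y : nat -> R) :=
  [/\ c00 y, (forall p, 0 <= y p) /\ (forall p, y p != 0 -> L p /\ (P < p)%N),
      forall G, fset_pos G -> \sum_(p <- G) `|y p| <= W,
      norm y <= level_norm j /\ (forall t Es, (0 < t <= N j)%N -> admissible (inS (beta t)) Es ->
         \sum_(E <- Es) norm (restr E y) <= level_norm j)
    & forall i, (i < d)%N -> exists Q, [/\ fset_pos Q, inS (tower j i) Q,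
        forall p, p \in Q -> y p != 0 & (theta (l (j + i)%N))^-1 <= \sum_(p <- Q) y p]].

Lemma level_norm_gt0 j : 0 < level_norm j.
Proof. by rewrite addr_gt0 ?divr_gt0 // mulr_gt0 // exprn_gt0. Qed.

(* Each coordinate e_i is followed by a vector of the next level, so that the tree
   estimate [level_bound] applies with the blocks [i, B i]. *)
Lemma level_vector_exists d j : exists W, forall P, exists y, level_vector d j P W y.
Proof.
elim: d j => [|d IH] j.
  exists 0 => P; exists (fun=> 0); split=> //.
  - exact: c000.
  - by split=> // p; rewrite eqxx.
  - by move=> G _; rewrite big1 // => p _; rewrite normr0.
  - split; first by rewrite tnorm0 // ltW // level_norm_gt0.
    move=> t Es _ _; rewrite big1 ?ltW ?level_norm_gt0 // => E _.
    by rewrite restr0 tnorm0.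
(* One l1 bound serves all starting points: [eta] depends on it and has to be fixed before the
   indices in [F] are known. *)
have [W1 /choice[Y HY]] := IH j.+1.
have [[l0 _ _] gg [wb Hb] [wt lt] thN] := lv j.
have /andP[th0 th1] := theta01 l0; have [theps thA] := theta_l j.
have [S HS] := label_list_exists j.
pose W := (theta (l j))^-1 + W1.
have W10 : 0 <= W1 by have [_ _ /(_ [::] isT) + _ _] := HY 0%N; rewrite big_nil.
have W0 : 0 < W by rewrite ltr_wpDr ?invr_gt0.
exists W => P.
have /choice[B HB] : forall i, exists B, (i <= B)%N /\ forall p, Y i p != 0 -> (p <= B)%N.
  move=> i; have [[B YB] _ _ _ _] := HY i; exists (maxn i B); split; first exact: leq_maxl.
  move=> p; apply: contraNT; rewrite -ltnNge gtn_max => /andP[_ Bp].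
  by rewrite YB // Bp orbT.
have [l1 Ll1 jl1] := uL j.
have hB : hereditary (fun k A => forall a, A a -> (B k < a)%N).
  by move=> k A A' AA H' a /AA; exact: H'.
have dB k : thinnable (fun A => forall a, A a -> (B k < a)%N).
  move=> A uA; exists (A `&` [set a | (B k < a)%N]); split=> [a []//| |a []//].
  exact: unbounded_gt.
have [D [DL uD DB]] := diagonal_thinning hB dB (unbounded_gt (maxn l1 P) uL).
pose h : R := 2^-1 ^+ j.+1.
have h0 : 0 < h by rewrite exprn_gt0.
(* Makes the contribution [4 * size S * eta * W] of the bad blocks at most [h]. *)
pose eta := h / (4 * (size S).+1%:R * W).
have eta0 : 0 < eta by rewrite divr_gt0 // !mulr_gt0.
have [F [z [[pF FD z0 sz] SF nF]]] := average_exists (wal j) 0%N uD eta0.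
have FL i : i \in F -> [/\ D i, L i & (maxn l1 P < i)%N].
  by move=> /FD[Di _]; have [Li lti] := DL i Di.
have BF i i' : i \in F -> i' \in F -> (i < i')%N -> (B i < i')%N.
  by move=> /FL[Di _ _] /FL[Di' _ _] ii; apply: (DB i Di i (leqnn _)).
have cY i : i \in F -> c00 (Y i) by move=> _; have [cYi _ _ _ _] := HY i.
have Y0 i p : 0 <= Y i p by have [_ [H _] _ _ _] := HY i.
have YB i p : i \in F -> Y i p != 0 -> (i <= p <= B i)%N.
  move=> _ Yp; rewrite (HB i).2 // andbT; have [_ [_ /(_ p Yp)[_ /ltnW //]] _ _ _] := HY i.
have iB i : i \in F -> (i <= B i)%N by move=> _; case: (HB i).
pose C := level_norm j.+1.
have YC i : i \in F -> norm (Y i) <= C by move=> _; have [_ _ _ [H _] _] := HY i.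
have YN i n Es : i \in F -> (0 < n <= N j.+1)%N -> admissible (inS (beta n)) Es ->
    \sum_(E <- Es) norm (restr E (Y i)) <= C.
  by move=> _; have [_ _ _ [_ H] _] := HY i; exact: H.
have YW i G : i \in F -> fset_pos G -> \sum_(p <- G) `|Y i p| <= W1.
  by move=> _; have [_ _ H _ _] := HY i; exact: H.
pose V i p := (theta (l j))^-1 * unit_vec R i p + Y i p.
pose x p := \sum_(i <- F) z i * V i p.
have u0 i p : 0 <= unit_vec R i p by rewrite /unit_vec; case: ifP.
have V0 i p : 0 <= V i p by rewrite addr_ge0 // mulr_ge0 // invr_ge0 ltW.
have x0 p : 0 <= x p by apply: sumr_ge0 => i _; rewrite mulr_ge0.
have xV i p : i \in F -> z i * V i p <= x p.
  by move=> iF; rewrite /x (big_rem i iF) /= lerDl; apply: sumr_ge0 => k _; rewrite mulr_ge0.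
have Fpos i : i \in F -> (0 < i)%N by exact: fset_pos_gt0.
have cx : c00 x.
  apply: (c00_sum (v := fun i p => z i * V i p)) => i iF; apply: c00Z.
  by apply: c00D; [apply/c00Z/c00_unit_vec/Fpos|exact: cY].
have xL p : x p != 0 -> L p /\ (maxn l1 P < p)%N.
  move=> xp; apply: contrapT => nH; move/eqP: xp; apply.
  rewrite /x big_seq big1 // => i iF; have [_ Li lti] := FL i iF.
  rewrite /V /unit_vec; have [pi|_] := eqVneq p i; first by case: nH; rewrite pi.
  rewrite mulr0 add0r; have [->|Yp] := eqVneq (Y i p) 0; first by rewrite mulr0.
  case: nH; have [_ [_ /(_ p Yp)[Lp ip]] _ _ _] := HY i.
  by split=> //; exact: ltn_trans lti ip.
have [good1 good2] := goodL Ll1 (ltnW jl1).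
have sup_bound t Es : (0 < t <= N j)%N -> admissible (inS (beta t)) Es ->
    \sum_(E <- Es) norm (restr E x) <= level_norm j.
  move=> tN aEs; have /andP[t0 _] := tN.
  have tau1 : theta (l j) / eps < 1 by rewrite ltr_pdivrMr // mul1r; lra.
  have C0 : 0 <= C by apply: ltW; exact: level_norm_gt0.
  have hj : 2^-1 ^+ j = 2 * h :> R by rewrite /h exprS mulrA divff ?mul1r // pnatr_eq0.
  have CE : C = 2 / eps + 4 * h by [].
  have h1 : 2 * h <= 1 by rewrite -hj exprn_ile1 ?invr_ge0 // invf_le1 ?ler1n.
  have ei0 : 0 < eps^-1 by rewrite invr_gt0.
  have KC : (1 + theta (l j) * C) / eps <= h + C.
    have tC : theta (l j) * C <= 1.
      by apply: le_trans thA; rewrite ler_pM2l // CE; lra.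
    apply: (@le_trans _ _ (2 / eps)); last by rewrite CE; lra.
    by rewrite ler_pM2r //; lra.
  have := @level_bound R theta beta theta01 eps h C (h + C) W W1 eta (l j) (N j.+1) t (al j)
    F z B Y S l0 eps0 C0 tau1 pF z0 sz nF BF cY YB iB YC YN YW thN KC (lexx _) (lexx _) _ _ aEs.
  move=> H; apply: le_trans (H _) _ => [s spos ts|].
    split; first exact: HS.
    move=> G pG Gx; apply: (good1 s t) => // p pG'.
    by have [Lp] := xL p (Gx p pG'); rewrite gtn_max => /andP[].
  have : 4 * (size S)%:R * eta * W <= h.
    have -> : 4 * (size S)%:R * eta * W = h * ((size S)%:R / (size S).+1%:R).
      by rewrite /eta; field; rewrite ?gt_eqF // addrC natr1 pnatr_eq0.
    rewrite ler_piMr ?(ltW h0) // ler_pdivrMr // mul1r ler_nat; exact: leqnSn.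
  by rewrite /level_norm hj CE; lra.
exists x; split=> //.
- by split=> // p /xL[Lp]; rewrite gtn_max => /andP[].
- move=> G pG; apply: (@le_trans _ _ (\sum_(p <- G) \sum_(i <- F) z i * `|V i p|)).
    apply: ler_sum => p _; apply: le_trans (ler_norm_sum _ _ _) _.
    by apply: ler_sum => i _; rewrite normrM ger0_norm.
  rewrite exchange_big /= -[leRHS]mul1r -sz mulr_suml big_seq [leRHS]big_seq.
  apply: ler_sum => i iF; rewrite -mulr_sumr ler_wpM2l //.
  exact: (level_l1 theta01 l0 YW (lexx W)).
- split; last exact: sup_bound.
  (* The norm itself is the trivial splitting into one set, admissible for [beta 1], and 1 <= N
     j. *)
  apply: le_trans (split_norm_self (beta 1%N) (tnorm_l1_bounded beta theta01) cx) _.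
  by apply: split_norm_le => Es aEs; apply: sup_bound aEs; rewrite /= Npos.
(* Part 0 comes from the averaged unit vectors; part i + 1 is the union over [F] of the i-th parts
   of the inner vectors, so the family of level j becomes the outer one. *)
case=> [_|i id].
  exists [seq p <- F | x p != 0]; split.
  - exact: fset_pos_filter.
  - by apply: inS_subseq SF _ => //; exact: filter_subseq.
  - by move=> p; rewrite mem_filter => /andP[].
  rewrite addn0 big_filter big_mkcond /=.
  apply: (@le_trans _ _ (\sum_(p <- F) z p * (theta (l j))^-1)).
    by rewrite -mulr_suml sz mul1r.
  rewrite big_seq [leRHS]big_seq; apply: ler_sum => p pF'.
  have : z p * (theta (l j))^-1 <= x p.
    apply: le_trans (xV p p pF'); rewrite ler_wpM2l // /V /unit_vec eqxx mulr1 lerDl //.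
  by case: eqP => // ->.
have /choice[Q HQ] : forall k, exists Q, [/\ fset_pos Q, inS (tower j.+1 i) Q,
    forall p, p \in Q -> Y k p != 0 & (theta (l (j.+1 + i)%N))^-1 <= \sum_(p <- Q) Y k p].
  by move=> k; have [_ _ _ _ H] := HY k; exact: H.
have [[li0 _ _] _ _ _ _] := lv (j.+1 + i)%N; have /andP[thi0 _] := theta01 li0.
have QY k p : p \in Q k -> Y k p != 0 by have [_ _ H _] := HQ k; exact: H.
have Qk k p : p \in Q k -> (k < p)%N.
  by move=> /QY Yp; have [_ [_ /(_ p Yp)[_ kp]] _ _ _] := HY k.
have QB k p : p \in Q k -> (p <= B k)%N by move=> /QY; exact: (HB k).2.
have nQ k : Q k != [::].
  have [_ _ _ H] := HQ k; apply/eqP => Q0; move: H.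
  by rewrite Q0 big_nil leNgt invr_gt0 thi0.
have sQ : successive [seq Q k | k <- F].
  apply/successiveE; split; first by apply/allP => _ /mapP[k _ ->].
  suff H F' : {subset F' <= F} -> fset_pos F' -> fset_pos (flatten [seq Q k | k <- F']) by exact: H.
  elim: F' => // k F' IHF F'F; rewrite fset_pos_cons => /and3P[_ /allP kF' pF'].
  have kF : k \in F by apply: F'F; rewrite mem_head.
  have F'F2 a : a \in F' -> a \in F by move=> aF; apply: F'F; rewrite inE aF orbT.
  rewrite /= fset_pos_cat IHF // andbT; apply/andP; split; last by case: (HQ k).
  apply/allrelP => p q pk /flattenP[_ /mapP[k' k'F ->] qk].
  apply: leq_ltn_trans (QB _ _ pk) _; apply: ltn_trans (Qk _ _ qk).
  by apply: BF => //; [exact: F'F2|exact: kF'].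
have pQ : fset_pos (flatten [seq Q k | k <- F]) by case/successiveE: sQ.
exists [seq p <- flatten [seq Q k | k <- F] | x p != 0]; split.
- exact: fset_pos_filter.
- apply: inS_subseq (filter_subseq _ _) => //.
  apply/inS_add => //; exists [seq Q k | k <- F]; split=> //; split; last by move=> _ /mapP[k _ ->]; case: (HQ k).
  split=> //; apply: inS_spread SF _ => //; first exact: mins_fset_pos.
  rewrite -map_comp -{1}[F]map_id; apply: spread_map => // k _ /=.
  by apply/ltnW/Qk; exact: fmin_mem.
- by move=> p; rewrite mem_filter => /andP[].
rewrite -addSnnS big_filter big_mkcond /= big_flatten big_map /=.
apply: (@le_trans _ _ (\sum_(k <- F) z k * (theta (l (j.+1 + i)%N))^-1)).
  by rewrite -mulr_suml sz mul1r.
rewrite big_seq [leRHS]big_seq; apply: ler_sum => k kF.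
apply: (@le_trans _ _ (z k * \sum_(p <- Q k) Y k p)).
  by rewrite ler_wpM2l //; case: (HQ k).
rewrite mulr_sumr; apply: ler_sum => p _.
have : z k * Y k p <= x p.
  apply: le_trans (xV k p kF); rewrite ler_wpM2l // /V lerDr mulr_ge0 // invr_ge0 ltW //.
by case: eqP => // ->.
Qed.

End Positive.

(** The n-th vector has n levels. If F is in [inS (f k.+1)] and k < min F, every vector indexed by F
    has a part of level k, and the union of these parts is in [inS (beta (l k))]. Splitting it into
    singletons, the weight [theta (l k)] cancels against the l1 norms of the parts. *)
Lemma contains_SM (R : realType) (theta : nat -> R) (xi : ord) (beta f : nat -> ord) M :
  (forall n, (0 < n)%N -> 0 < theta n < 1) ->
  (forall n, (0 < n)%N -> theta n.+1 <= theta n) ->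
  theta @ \oo --> (0 : R) ->
  olt OZero xi ->
  (forall n, (0 < n)%N -> owf (beta n)) ->
  (forall n, (0 < n)%N -> olt (beta n) (opw xi)) ->
  owf (OLim f) -> ole (OLim f) (opw xi) ->
  dagger theta beta xi -> unbounded M -> contains_l1_SM theta beta (OLim f) M.
Proof.
move=> theta01 theta_noninc theta_to0 xi0 beta_wf beta_lt wf fW [eps [eps0 dag]] uM.
have [f_wf sf] := wf.
have f_lt k : olt (f k) (opw xi).
  by apply: olt_ole_trans (sf k) (ole_lim_inv fW _).
(* This is [level_norm] at 0, a bound for every level. Below, [theta (l j) <= eps / 2] keeps the
   threshold below 1, and [theta (l j) * A <= 1] keeps the inner vectors within the term
   [2 / eps]. *)
pose A := 2 / eps + 4; have A0 : 0 < A by rewrite addr_gt0 ?divr_gt0.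
pose norm := tnorm theta beta.
have [n0 Hn0] := theta_small theta_to0 (e := Num.min (eps / 2) A^-1)
  ltac:(by rewrite lt_min divr_gt0 // invr_gt0).
have [l [g [b [N [N0 lv]]]]] := levels_exist theta01 theta_to0 xi0 beta_wf beta_lt f_lt dag n0.+1.
have N1 : (0 < N 0)%N by rewrite N0.
have Nmono j : (n0 < N j)%N.
  by elim: j => [|j IH]; [rewrite N0|have [[_ _ H] _ _ _ _] := lv j; exact: leq_trans IH H].
have theta_l j : theta (l j) <= eps / 2 /\ theta (l j) * A <= 1.
  have [[l0 Nl _] _ _ _ _] := lv j.
  have : theta (l j) < Num.min (eps / 2) A^-1.
    by apply: Hn0 => //; apply: leq_trans (ltnW (Nmono j)) (ltnW Nl).
  by rewrite lt_min => /andP[/ltW h1 /ltW h2]; split=> //; rewrite -ler_pdivlMr // mul1r.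
have [L [LM uL goodL]] :=
  good_levels_exist theta01 theta_noninc theta_to0 beta_wf f_wf eps0 lv uM.
have ex d j := level_vector_exists theta01 theta_noninc theta_to0 beta_wf eps0 lv N1 theta_l uL goodL d j.
have /choice[W HW] : forall n, exists W, forall P, exists y, level_vector theta beta eps l g b N L n 0 P W y.
  by move=> n; exact: ex.
have /choice[Y HY] : forall nP : nat * nat, exists y,
    level_vector theta beta eps l g b N L nP.1 0 nP.2 (W nP.1) y.
  by move=> [n P]; exact: HW.
have /choice[B HB] : forall nP, exists B, forall p, Y nP p != 0 -> (p <= B)%N.
  move=> nP; have [[B YB] _ _ _ _] := HY nP; exists B => p.
  by apply: contraNT; rewrite -ltnNge => Bp; rewrite YB // Bp orbT.
have /choice[lL HL] : forall n, exists m, L m /\ (n < m)%N.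
  by move=> n; have [m Lm nm] := uL n; exists m.
(* Each vector starts past the support of the preceding one and past a point of [L] beyond n, after
   which the inclusions for the levels up to n are available. *)
pose P := fix P n := if n is n'.+1 then maxn (B (n', P n')) (maxn (P n') (lL n)) else lL 0%N.
have PB n : (B (n, P n) <= P n.+1)%N by exact: leq_maxl.
have Pmono m n : (m <= n)%N -> (P m <= P n)%N.
  elim: n => [|n IH]; first by rewrite leqn0 => /eqP ->.
  rewrite leq_eqVlt => /orP[/eqP -> //|/IH mn]; apply: leq_trans mn _.
  by rewrite /= !leq_max leqnn orbT.
have PL n : (lL n <= P n)%N by case: n => [//|n]; rewrite /= !leq_max leqnn !orbT.
pose y n := Y (n, P n).
have yP n := HY (n, P n); rewrite /= in yP.
have cy n : c00 (y n) by have [] := yP n.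
have y0 n p : 0 <= y n p by have [_ [H _] _ _ _] := yP n; exact: H.
have yl n p : y n p != 0 -> L p /\ (P n < p)%N.
  by move=> yp; have [_ [_ H] _ _ _] := yP n; exact: H.
have yB n p : y n p != 0 -> (p <= P n.+1)%N by move=> /HB /leq_trans; apply.
have ylt m n p q : (m < n)%N -> y m p != 0 -> y n q != 0 -> (p < q)%N.
  move=> mn /yB mp /yl[_ nq]; apply: leq_ltn_trans mp _.
  by apply: leq_ltn_trans nq; exact: Pmono.
have lower F (a : nat -> R) k : fset_pos F -> (0 < k)%N -> (k <= fmin F)%N -> inS (f k) F ->
    \sum_(n <- F) `|a n| <= norm (fun p => \sum_(n <- F) a n * y n p).
  move=> pF; case: k => // k _ kF fF; pose u p : R := \sum_(n <- F) a n * y n p; rewrite -[X in norm X]/u.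
  have cu : c00 u by apply: (c00_sum (v := fun n p => a n * y n p)) => n _; exact: c00Z.
  have kF' n : n \in F -> (k < n)%N by move=> nF; apply: leq_trans kF (fmin_le pF nF).
  have [n nF|Q QP] := @choice_seq nat (seq nat) (fun n Q => [/\ fset_pos Q,
      inS (ord_tower (fun j => OSucc (oadd (oadd (g j) (ofin 2)) (b j))) 0 k) Q,
      forall p, p \in Q -> y n p != 0 & (theta (l k))^-1 <= \sum_(p <- Q) y n p]) F [::].
    by have [_ _ _ _ H] := yP n; have := H k (kF' n nF); rewrite add0n.
  have [[lk0 _ _] _ _ _ _] := lv k; have /andP[tk0 tk1] := theta01 _ lk0.
  have nQ n : n \in F -> Q n != [::].
    move=> nF; have [_ _ _ H] := QP n nF; apply/eqP => Q0; move: H.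
    by rewrite Q0 big_nil leNgt invr_gt0 tk0.
  have Qy n p : n \in F -> p \in Q n -> y n p != 0 by move=> /QP[_ _ H _]; exact: H.
  have sQ : successive [seq Q n | n <- F].
    apply/successiveE; split; first by apply/allP => _ /mapP[n nF ->]; exact: nQ.
    suff H F' : {subset F' <= F} -> fset_pos F' -> fset_pos (flatten [seq Q n | n <- F']) by exact: H.
    elim: F' => // n F' IHF F'F; rewrite fset_pos_cons => /and3P[_ /allP nF' pF'].
    have nF : n \in F by apply: F'F; rewrite mem_head.
    have F'F2 m : m \in F' -> m \in F by move=> mF; apply: F'F; rewrite inE mF orbT.
    rewrite /= fset_pos_cat IHF // andbT; apply/andP; split; last by case: (QP n nF).
    apply/allrelP => p q pn /flattenP[_ /mapP[m mF ->] qm].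
    by apply: (ylt n m); [exact: nF'|exact: Qy pn|apply: Qy qm; exact: F'F2].
  pose G := flatten [seq Q n | n <- F].
  have pG : fset_pos G by case/successiveE: sQ.
  have bG : inS (beta (l k)) G.
    have [_ H] := goodL (lL k) (HL k).1 k (ltnW (HL k).2).
    apply: H => //.
      move=> p /flattenP[_ /mapP[n nF ->] pn]; have [Lp np] := yl _ _ (Qy n p nF pn).
      split=> //=; apply: leq_ltn_trans np; apply: leq_trans (PL k) _.
      exact: Pmono (ltnW (kF' n nF)).
    apply/inS_add => //; exists [seq Q n | n <- F]; split=> //; split; last by move=> _ /mapP[n nF ->]; case: (QP n nF).
    split=> //; apply: inS_spread fF _ => //; first exact: mins_fset_pos.
    rewrite -map_comp -{1}[F]map_id; apply: spread_map => // n nF /=.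
    have [_ np] := yl _ _ (Qy n _ nF (fmin_mem (nQ n nF))).
    apply: ltnW; apply: leq_ltn_trans np; apply: leq_trans (PL n).
    by case: (HL n) => _ /ltnW.
  have aG : admissible (inS (beta (l k))) [seq [:: p] | p <- G].
    by split; [exact: successive_seq1|rewrite map_fmin_seq1].
  apply: le_trans (tnorm_adm theta01 cu lk0 aG).
  rewrite [leRHS]mulrC -ler_pdivrMr // mulr_suml [leRHS]big_map.
  apply: (@le_trans _ _ (\sum_(p <- G) `|u p|)); last first.
    apply: ler_sum => p _; have := tnorm_sup beta theta01 p (c00_restr [:: p] cu).
    by rewrite {1}/restr mem_head.
  have -> : \sum_(p <- G) `|u p| = \sum_(n <- F) \sum_(p <- Q n) `|u p|.
    by rewrite /G big_flatten big_map.
  rewrite big_seq [leRHS]big_seq; apply: ler_sum => n nF.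
  have -> : \sum_(p <- Q n) `|u p| = `|a n| * \sum_(p <- Q n) y n p.
    rewrite mulr_sumr big_seq [RHS]big_seq; apply: eq_bigr => p pn.
    rewrite /u (bigD1_seq n) //=; last exact: fset_pos_uniq.
    rewrite big1 ?addr0 ?normrM ?(ger0_norm (y0 n p)) // => m mn.
    have -> : y m p = 0; last by rewrite mulr0.
    apply/eqP/negPn/negP => ym; have yn := Qy n p nF pn.
    have [lt|lt|//] := ltngtP m n.
    - by have := ylt _ _ _ _ lt ym yn; rewrite ltnn.
    - by have := ylt _ _ _ _ lt yn ym; rewrite ltnn.
    - by move=> mn'; rewrite mn' eqxx in mn.
  by rewrite ler_wpM2l //; case: (QP n nF).
have yA n : norm (y n) <= A.
  by have [_ _ _ [H _] _] := yP n; move: H; rewrite /level_norm expr0 mulr1.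
have y1 n : (0 < n)%N -> 1 <= norm (y n).
  move=> n0'; have := lower [:: n] (fun=> 1) 1%N.
  rewrite !big_seq1 normr1 fset_pos_cons n0' => /(_ isT isT isT (inS_single _ n0')).
  by under eq_fun do rewrite big_seq1 mul1r.
pose x n (k : nat) p := (norm (y n))^-1 * y n p.
have yn0 n : (0 < n)%N -> 0 < norm (y n) by move=> /y1; apply: lt_le_trans.
exists x; split=> [n n0'|].
  split; first exact: (Xelt_cst beta theta01 (c00Z (norm (y n))^-1 (cy n))).
  move=> k p; rewrite mulf_eq0 negb_or => /andP[_ /yl[Lp _]]; exact: LM.
split=> [n n0'|].
  rewrite Xnorm_cst; apply/eqP; rewrite eq_le; apply/andP; split.
    apply: le_trans (tnormZ_le beta theta01 _ (cy n)) _.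
    by rewrite ger0_norm ?invr_ge0 ?(ltW (yn0 n n0')) // mulVf // gt_eqF // yn0.
  have := tnormZ_le beta theta01 (norm (y n)) (c00Z (norm (y n))^-1 (cy n)).
  rewrite ger0_norm ?(ltW (yn0 n n0')) //.
  under eq_fun do rewrite mulrA divff ?gt_eqF ?yn0 // mul1r.
  by rewrite -[X in X <= _ -> _]mulr1 ler_pM2l // yn0.
(* Before normalization the lower constant is 1; dividing by norms that are at most [A] costs at
   most this factor. *)
exists A; split=> // F a pF wF.
rewrite -[X in Xnorm _ _ X]/(fun=> (fun i => \sum_(n <- F) a n * x n 0%N i)) Xnorm_cst.
have pos n : n \in F -> 0 < norm (y n) by move=> nF; apply: yn0; exact: fset_pos_gt0 pF nF.
case: wF => [->|[k [k0 [kF fF]]]].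
  rewrite big_nil mulr0; apply: tnorm_ge0 => //.
  by apply: (c00_sum (v := fun n p => a n * x n 0%N p)).
have := lower F (fun n => a n / norm (y n)) k pF k0 kF fF.
have -> : (fun p => \sum_(n <- F) a n / norm (y n) * y n p) = (fun i => \sum_(n <- F) a n * x n 0%N i).
  by apply: funext => p; apply: eq_bigr => n _; rewrite /x mulrA.
apply: le_trans; rewrite mulr_sumr big_seq [leRHS]big_seq; apply: ler_sum => n nF.
rewrite normrM mulrC ler_wpM2l // normfV ger0_norm ?(ltW (pos n nF)) //.
by rewrite lef_pV2 ?posrE // pos.
Qed.

Theorem theorem13 (R : realType) (theta : nat -> R) (xi : ord)
  (beta : nat -> ord) (w : ord) :
  (forall n, (0 < n)%N -> 0 < theta n < 1) ->
  (forall n, (0 < n)%N -> theta n.+1 <= theta n) ->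
  theta @ \oo --> 0 ->
  olt OZero xi ->
  (forall n, (0 < n)%N -> owf (beta n) /\ olt OZero (beta n) /\ olt (beta n) (opw xi)) ->
  is_sup_pos beta (opw xi) ->
  owf w -> ole w (opw xi) -> ole (opw xi) w ->
  (dagger theta beta xi ->
     forall M : set nat, M `<=` [set n | (0 < n)%N] -> infinite_set M ->
       contains_l1_SM theta beta w M) /\
  (~ dagger theta beta xi ->
     forall M : set nat, M `<=` [set n | (0 < n)%N] -> infinite_set M ->
       exists N : set nat, N `<=` M /\ infinite_set N /\
         ~ contains_l1_SM theta beta w N).
Proof.
move=> theta01 theta_noninc theta_to0 xi0 Hbeta beta_sup wfw wW Ww.
have beta_wf n : (0 < n)%N -> owf (beta n) by move=> /Hbeta[].
have beta_lt n : (0 < n)%N -> olt (beta n) (opw xi) by move=> /Hbeta[_ []].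
split=> [dag M _ /infinite_unbounded uM|nd M _ /infinite_unbounded uM].
  have [f wE] := opw_lim xi0 wW Ww; rewrite wE in wfw wW *.
  exact: (contains_SM (xi := xi)).
have [N [NM uN thinN]] :=
  thin_exists theta01 theta_noninc theta_to0 xi0 beta_wf beta_lt beta_sup nd uM.
exists N; split=> //; split; first exact/infinite_unbounded.
exact: (not_contains_SM theta01 theta_noninc xi0 wfw Ww uN thinN).
Qed.
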